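(* Let $X_{1,0}\in H^1_0$, $X_{2,0}\in H^1_0$, $\widetilde X\in C_tH^1_0$ (deterministic) and $\sigma\in L^2_{\mathbb F}C_tH^1_0$. A tuple $(X_{1,h\tau}^*,X_{2,h\tau}^*,U_{h\tau}^* )\in\mathbb X_{h\tau}^2\times\mathbb U_{h\tau}$ is the unique optimal tuple of SLQ$_{h\tau}$ if and only if there exists $Y_{2,h\tau}$ such that $(X_{1,h\tau}^*,X_{2,h\tau}^*,U_{h\tau}^*,Y_{2,h\tau})$ satisfies: 1. (forward state) $(X_{1,h\tau}^*,X_{2,h\tau}^* )=(\mathcal X_{1,h\tau}[U_{h\tau}^*],\mathcal X_{2,h\tau}[U_{h\tau}^*])$; 2. (backward state) $(Y_{1,h\tau},Y_{2,h\tau})=(\mathcal Y_{1,h\tau}[U_{h\tau}^*],\mathcal Y_{2,h\tau}[U_{h\tau}^*])$; 3. (optimality condition) $\alpha U_{h\tau}^*(t_n)=\mathbb E\big[Y_{2,h\tau}(t_{n+1})\,\big|\,\mathcal F_{t_n}\big]$ for all $n=0,1,\dots,N-1$.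
   Context: Setting and notation. $D\subset\mathbb R^d$, $1\le d\le 3$, is a bounded domain with sufficiently smooth boundary; $T>0$, $\alpha>0$, $\beta\ge 0$, $\gamma\in\mathbb R$ are fixed. $(\Omega,\mathcal F,\mathbb F=\{\mathcal F_t\}_{t\in[0,T]},\mathbb P)$ is a complete filtered probability space whose filtration is generated by a real-valued Wiener process $W$ and augmented by all $\mathbb P$-null sets. $L^2_x:=L^2(D)$ with inner product $\langle\cdot,\cdot\rangle$; $H^1_0:=H^1_0(D)$. For a separable Hilbert space $K$: $L^2_tK:=L^2(0,T;K)$, $C_tK:=C([0,T];K)$, $L^2_{t,x}:=L^2_tL^2_x$; $L^2_{\mathbb F}L^2_tK$, $L^2_{\mathbb F}C_tK$ are the spaces of $\mathbb F$-adapted $K$-valued processes with finite second moment of the $L^2_tK$-, $C_tK$-norm, respectively. Space discretization. $\mathcal T_h$ is a regular triangulation of $D$ with maximum mesh size $h$; $\mathbb V_h\subset H^1_0$ is the space of functions that are continuous and affine on each element. $\mathcal R_h:H^1_0\to\mathbb V_h$ is the Ritz projection, $\langle\nabla(\mathcal R_hu-u),\nabla\phi_h\rangle=0$ for all $\phi_h\in\mathbb V_h$; $\Delta_h:\mathbb V_h\to\mathbb V_h$ is defined by $\langle\Delta_h\xi_h,\varphi_h\rangle=-\langle\nabla\xi_h,\nabla\varphi_h\rangle$ for all $\varphi_h\in\mathbb V_h$. $\widetilde X_h:=\mathcal R_h\widetilde X$. Problem SLQ$_{h\tau}$. $N\in\mathbb N$, $\tau=T/N<1$, $t_n=n\tau$,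 $\Delta_nW:=W(t_n)-W(t_{n-1})$. $\mathbb U_{h\tau}$ is the set of $U_{h\tau}\in L^2_{\mathbb F}L^2_t\mathbb V_h$ that are constant in time on each $[t_n,t_{n+1})$, $n=0,\dots,N-1$; $\mathbb X_{h\tau}$ is defined likewise, its elements having in addition a value at $t_N=T$. $\widetilde X_{h\tau}(t):=\widetilde X_h(t_n)$ for $t\in[t_n,t_{n+1})$, $\widetilde X_{h\tau}(T):=\widetilde X_h(T)$. For $U_{h\tau}\in\mathbb U_{h\tau}$, $(\mathcal X_{1,h\tau}[U_{h\tau}],\mathcal X_{2,h\tau}[U_{h\tau}])=(X_1,X_2)\in\mathbb X_{h\tau}^2$ is the unique solution of $X_1(0)=\mathcal R_hX_{1,0}$, $X_2(0)=\mathcal R_hX_{2,0}$ and, for $n=0,\dots,N-1$, $$X_1(t_{n+1})-X_1(t_n)=\tfrac\tau2(X_2(t_{n+1})+X_2(t_n)),$$ $$X_2(t_{n+1})-X_2(t_n)=\tfrac\tau2\Delta_h(X_1(t_{n+1})+X_1(t_n))+\tau U_{h\tau}(t_n)+(\gamma X_1(t_n)+\mathcal R_h\sigma(t_n))\Delta_{n+1}W.$$ SLQ$_{h\tau}$: minimize over $U_{h\tau}\in\mathbb U_{h\tau}$ the functional $$\tfrac12\mathbb E\big[\|\mathcal X_{1,h\tau}[U_{h\tau}]-\widetilde X_{h\tau}\|_{L^2_{t,x}}^2+\alpha\|U_{h\tau}\|_{L^2_{t,x}}^2+\beta\|\mathcal X_{1,h\tau}[U_{h\tau}](T)-\widetilde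 X_{h\tau}(T)\|_{L^2_x}^2\big].$$ An optimal tuple consists of a minimizer $U_{h\tau}^*$ and its state $(\mathcal X_{1,h\tau}[U_{h\tau}^*],\mathcal X_{2,h\tau}[U_{h\tau}^*])$; it exists and is unique. Backward operator. For $U_{h\tau}\in\mathbb U_{h\tau}$, $(\mathcal Y_{1,h\tau}[U_{h\tau}],\mathcal Y_{2,h\tau}[U_{h\tau}])=(Y_1,Y_2)\in\mathbb X_{h\tau}^2$ is the solution of the backward difference equations, for $n=N-1,\dots,0$, $$Y_1(t_n)=\mathbb E\Big[Y_1(t_{n+1})+\tfrac\tau2\Delta_h\big(Y_2(t_{n+1})+Y_2(t_n)\big)+\gamma Y_2(t_{n+1})\Delta_{n+1}W\,\Big|\,\mathcal F_{t_n}\Big]+\tau\big(\widetilde X_h(t_n)-\mathcal X_{1,h\tau}[U_{h\tau}](t_n)\big),$$ $$Y_2(t_n)=\mathbb E\Big[Y_2(t_{n+1})+\tfrac\tau2\big(Y_1(t_{n+1})+Y_1(t_n)\big)\,\Big|\,\mathcal F_{t_n}\Big],$$ with terminal relations $Y_1(t_N)=\tfrac\tau2\Delta_hY_2(t_N)+\beta\big(\widetilde X_{h\tau}(t_N)-\mathcal X_{1,h\tau}[U_{h\tau}](t_N)\big)$ and $Y_2(t_N)=\tfrac\tau2Y_1(t_N)$. *)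

(* Defs.v *)
From HB Require Import structures.
From mathcomp Require Import all_boot all_order all_algebra.
From mathcomp Require Import all_classical all_reals all_analysis.

Set Implicit Arguments.
Unset Strict Implicit.
Unset Printing Implicit Defensive.

Import Order.TTheory GRing.Theory Num.Theory.
Import numFieldNormedType.Exports.

Local Open Scope classical_set_scope.
Local Open Scope ring_scope.

Section Space.
Context (R : realType) (d : nat).

Definition borel_rV := g_sigma_algebraType (@open 'rV[R]_d).

(* Real-valued functions on R^d; [R^o] gives them their pointwise vector space
   structure.  Functions on D are represented by functions on R^d, of which
   only the values on D count in the integrals below. *)
Definition funRd := 'rV[R]_d -> R^o.

Definition e_ (i : 'I_d) : 'rV[R]_d := delta_mx 0 i.

(* The norm that the library puts on ['rV_d] is the sup norm. *)
Definition enorm (x : 'rV[R]_d) : R := Num.sqrt (\sum_i x 0 i ^+ 2).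

Fixpoint Ck (k : nat) (f : funRd) : Prop :=
  continuous f /\
  if k is k'.+1 then
    forall i, (forall x, derivable f x (e_ i)) /\ Ck k' (fun x => 'D_(e_ i) f x)
  else True.

(* Locally around each boundary point, D is the sublevel set of a C^k function
   with nonvanishing gradient. *)
Definition Ck_boundary (k : nat) (D : set 'rV[R]_d) : Prop :=
  forall p, (closure D `\` interior D) p ->
  exists rho : funRd, [/\ Ck k rho, (exists i, 'D_(e_ i) rho p != 0) &
    \forall x \near p, (D x <-> rho x < 0)].

Definition bounded_domain (D : set 'rV[R]_d) : Prop :=
  [/\ open D, connected D, D !=set0 & bounded_set D].

End Space.

(* Lebesgue measure of Borel subsets of R^d, by slicing along the first
   coordinate (Cavalieri, i.e. Tonelli's theorem for indicator functions). *)
Fixpoint lebesgue_rV (R : realType) (d : nat) : set 'rV[R]_d -> \bar R :=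
  match d with
  | 0 => fun A => (\1_A 0)%:E
  | n.+1 => fun A => (\int[@lebesgue_measure R]_x
      lebesgue_rV [set y : 'rV[R]_n | A (row_mx (x%:M : 'M[R]_1) y)])%E
  end.

Section Sobolev.
Context (R : realType) (d : nat) (D : set 'rV[R]_d).
Local Notation F := (funRd R d).
Local Notation mu := (@lebesgue_rV R d : set (borel_rV R d) -> \bar R).

Definition L2 (u : F) : Prop :=
  measurable_fun (D : set (borel_rV R d)) (u : borel_rV R d -> R) /\
  (\int[mu]_(x in D) (u x ^+ 2)%:E < +oo)%E.

Definition ip (u v : F) : R := fine (\int[mu]_(x in D) (u x * v x)%:E)%E.

Definition L2norm (u : F) : R := Num.sqrt (ip u u).

Definition test_fun (phi : F) : Prop :=
  (forall k, Ck k phi) /\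
  exists K, [/\ compact K, K `<=` D & forall x, ~ K x -> phi x = 0].

Definition weak_gradient (u : F) (g : 'I_d -> F) : Prop :=
  forall phi, test_fun phi ->
  forall i, ip u (fun x => 'D_(e_ R i) phi x) = - ip (g i) phi.

(* u belongs to H^1_0(D), the closure of C^oo_c(D) in H^1(D), and has weak
   gradient g. *)
Definition H10_gradient (u : F) (g : 'I_d -> F) : Prop :=
  [/\ L2 u, forall i, L2 (g i), weak_gradient u g &
    forall e : R, 0 < e -> exists phi, test_fun phi /\
      L2norm (u - phi) ^+ 2 +
      \sum_i L2norm (g i - (fun x => 'D_(e_ R i) phi x)) ^+ 2 < e].

Definition H10 : set F := [set u | exists g, H10_gradient u g].

Definition grad (u : F) : 'I_d -> F := xget (fun _ => 0) (H10_gradient u).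

Definition ip_grad (u v : F) : R := \sum_i ip (grad u i) (grad v i).

(* The Hilbert space norm of H^1_0(D), a norm by Poincare's inequality since D
   is bounded. *)
Definition H10norm (u : F) : R := Num.sqrt (ip_grad u u).

Definition CtH10 (T : R) (f : R -> F) : Prop :=
  forall t, t \in `[0, T] -> H10 (f t) /\
    H10norm (f s - f t) @[s --> within `[0, T] (nbhs t)] --> (0 : R).

End Sobolev.

Section Mesh.
Context (R : realType) (d : nat).
Local Notation F := (funRd R d).

Definition simplex := 'I_d.+1 -> 'rV[R]_d.

Definition hull (s : simplex) (I : set 'I_d.+1) : set 'rV[R]_d :=
  [set x | exists w : 'I_d.+1 -> R,
    [/\ forall i, 0 <= w i, forall i, ~ I i -> w i = 0, \sum_i w i = 1 &
        x = \sum_i w i *: s i]].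

Definition diam (s : simplex) : R :=
  \big[Num.max/0]_i \big[Num.max/0]_j enorm (s i - s j).

Definition affinely_independent (s : simplex) : Prop :=
  forall w : 'I_d.+1 -> R,
    \sum_i w i = 0 -> \sum_i w i *: s i = 0 -> forall i, w i = 0.

(* A regular triangulation of D with maximum mesh size h, kappa being the
   shape regularity constant.  As no finite union of simplices is the closure
   of a domain with smooth boundary when d > 1, the closed elements are asked
   to lie in the closure of D and to cover D up to a boundary strip of
   width h; [tri_cover] holds in particular when they cover all of D. *)
Record triangulation (D : set 'rV[R]_d) (h kappa : R) (Th : set simplex)
    : Prop := {
  tri_finite : finite_set Th;
  tri_simplex : forall s, Th s -> affinely_independent s;
  tri_conforming : forall s s', Th s -> Th s' ->
    hull s setT `&` hull s' setT = hull s [set i | exists j, s i = s' j];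
  tri_inside : forall s, Th s -> hull s setT `<=` closure D;
  tri_cover : forall x, D x -> (forall y, enorm (y - x) <= h -> D y) ->
    exists2 s, Th s & hull s setT x;
  tri_mesh_size : (forall s, Th s -> diam s <= h) /\
    (exists2 s, Th s & diam s = h);
  tri_regular : 0 < kappa /\ forall s, Th s ->
    exists c, forall y, enorm (y - c) <= kappa * diam s -> hull s setT y }.

Context (D : set 'rV[R]_d) (Th : set simplex).

Definition affine_on (A : set 'rV[R]_d) (v : F) : Prop :=
  exists (a : 'cV[R]_d) (c : R), forall x, A x -> v x = (x *m a) 0 0 + c.

(* V_h: its elements are extended by zero off the mesh, so that two elements
   that agree almost everywhere on D are equal. *)
Definition Vh : set F :=
  [set v | [/\ H10 D v, continuous v, forall s, Th s -> affine_on (hull s setT) v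
    & forall x, (forall s, Th s -> ~ hull s setT x) -> v x = 0]].

Definition ritz (u : F) : F :=
  xget 0 [set w | Vh w /\ forall phi, Vh phi -> ip_grad D (w - u) phi = 0].

Definition laplace_h (xi : F) : F :=
  xget 0 [set eta | Vh eta /\
    forall phi, Vh phi -> ip D eta phi = - ip_grad D xi phi].

End Mesh.

Section Proba.
Context (R : realType) (dd : measure_display) (Om : measurableType dd).
Context (P : probability Om R).

(* The filtration generated by W, augmented by the P-null sets. *)
Definition filt (W : R -> Om -> R) (t : R) : set (set Om) :=
  <<s [set A | exists s (B : set R), [/\ 0 <= s, s <= t, measurable B &
         A = W s @^-1` B]] `|` [set A | P.-negligible A] >>.

Definition wiener (T : R) (W : R -> Om -> R) : Prop :=
  [/\ forall t, t \in `[0, T] -> measurable_fun setT (W t),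
      {ae P, forall w, W 0 w = 0},
      {ae P, forall w, {within `[0, T], continuous (W ^~ w)}},
      forall (s t : R) (B : set R), 0 <= s -> s < t -> t <= T -> measurable B ->
        P [set w | B (W t w - W s w)%R] = normal_prob 0 (Num.sqrt (t - s)) B &
      forall (s t : R) (A : set Om) (B : set R), 0 <= s -> s < t -> t <= T ->
        filt W s A -> measurable B ->
        P (A `&` [set w | B (W t w - W s w)%R]) =
        (P A * P [set w | B (W t w - W s w)%R])%E].

Context (d : nat).
Local Notation F := (funRd R d).

(* Borel measurability with respect to the sigma-algebra G of a random
   variable with values in K normed by nrm: the balls of a separable normed
   space generate its Borel sets. *)
Definition K_rv (G : set (set Om)) (K : set F) (nrm : F -> R) (X : Om -> F)
    : Prop :=
  (forall w, K (X w)) /\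
  forall v, K v -> forall B : set R, measurable B ->
    G ((fun w => nrm (X w - v)) @^-1` B).

Definition L2F_CtH10 (D : set 'rV[R]_d) (W : R -> Om -> R) (T : R)
    (X : R -> Om -> F) : Prop :=
  [/\ forall t, t \in `[0, T] -> K_rv (filt W t) (H10 D) (H10norm D) (X t),
      forall w, CtH10 D T (X ^~ w) &
      (\int[P]_w ereal_sup [set (H10norm D (X t w) ^+ 2)%:E | t in `[0%R, T]]
        < +oo)%E].

(* E[Z | G] for V_h-valued Z; equality of the Bochner integrals over A in the
   finite dimensional space V_h is tested with its elements. *)
Definition is_condE (D : set 'rV[R]_d) (Th : set (simplex R d))
    (G : set (set Om)) (Z zeta : Om -> F) : Prop :=
  [/\ K_rv G (Vh D Th) (L2norm D) zeta,
      (\int[P]_w (L2norm D (Z w))%:E < +oo)%E,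
      (\int[P]_w (L2norm D (zeta w))%:E < +oo)%E &
      forall A phi, G A -> Vh D Th phi ->
        (\int[P]_(w in A) (ip D (zeta w) phi)%:E =
         \int[P]_(w in A) (ip D (Z w) phi)%:E)%E].

Definition condE D Th G Z : Om -> F := xget (fun _ => 0) (is_condE D Th G Z).

Definition proc_eq (I : set R) (X Y : R -> Om -> F) : Prop :=
  forall t, I t -> {ae P, forall w, X t w = Y t w}.

End Proba.

Section SLQ.
Context (R : realType) (d : nat).
Local Notation F := (funRd R d).
Context (D : set 'rV[R]_d) (Th : set (simplex R d)).
Context (dd : measure_display) (Om : measurableType dd) (P : probability Om R).
Context (W : R -> Om -> R).
Context (T alpha beta gamma : R) (N : nat).
Context (X10 X20 : F) (Xt : R -> F) (sigma : R -> Om -> F).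

Local Notation V_h := (Vh D Th).
Local Notation R_h := (ritz D Th).
Local Notation Delta_h := (laplace_h D Th).
Local Notation process := (R -> Om -> F).

Definition tau : R := T / N%:R.
Definition tn (n : nat) : R := n%:R * tau.
Definition dW (n : nat) (w : Om) : R := W (tn n) w - W (tn n.-1) w.

Definition L2tx_sq (f : R -> F) : \bar R :=
  (\int[@lebesgue_measure R]_(t in `]0%R, T[) (L2norm D (f t) ^+ 2)%:E)%E.

(* Paths have finitely many steps, so their measurability in time is automatic. *)
Definition step_process (I : set R) (X : process) : Prop :=
  [/\ forall t, I t -> K_rv (filt P W t) V_h (L2norm D) (X t),
      (\int[P]_w L2tx_sq (X ^~ w) < +oo)%E &
      forall n t, (n < N)%N -> tn n <= t -> t < tn n.+1 -> X t = X (tn n)].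

Definition control_space (U : process) : Prop := step_process `[0, T[ U.

Definition state_space (X : process) : Prop :=
  step_process `[0, T] X /\ (\int[P]_w (L2norm D (X T w) ^+ 2)%:E < +oo)%E.

Definition is_state (U X1 X2 : process) : Prop :=
  [/\ state_space X1, state_space X2,
      {ae P, forall w, X1 0 w = R_h X10}, {ae P, forall w, X2 0 w = R_h X20} &
      forall n, (n < N)%N ->
        {ae P, forall w, X1 (tn n.+1) w - X1 (tn n) w =
           (tau / 2) *: (X2 (tn n.+1) w + X2 (tn n) w)} /\
        {ae P, forall w, X2 (tn n.+1) w - X2 (tn n) w =
           (tau / 2) *: Delta_h (X1 (tn n.+1) w + X1 (tn n) w)
           + tau *: U (tn n) w
           + dW n.+1 w *: (gamma *: X1 (tn n) w + R_h (sigma (tn n) w))}].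

Definition state (U : process) : process * process :=
  xget (fun _ _ => 0, fun _ _ => 0) [set X | is_state U X.1 X.2].
Definition state1 (U : process) : process := (state U).1.
Definition state2 (U : process) : process := (state U).2.

Definition Xt_h (t : R) : F := R_h (Xt t).

(* On [t_n, t_{n+1}) one has [truncn (t / tau) = n], and at T it is N. *)
Definition Xt_htau (t : R) : F := Xt_h (tn (Num.truncn (t / tau))).

Definition cost (U : process) : \bar R :=
  ((2^-1)%:E * \int[P]_w
    (L2tx_sq (fun t => (state1 U t w - Xt_htau t)%R)
     + alpha%:E * L2tx_sq (U ^~ w)
     + (beta * L2norm D (state1 U T w - Xt_htau T) ^+ 2)%:E))%E.

Definition optimal_tuple (X1 X2 U : process) : Prop :=
  [/\ control_space U, forall V, control_space V -> (cost U <= cost V)%E,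
      proc_eq P `[0, T] X1 (state1 U) & proc_eq P `[0, T] X2 (state2 U)].

Definition unique_optimal_tuple (X1 X2 U : process) : Prop :=
  optimal_tuple X1 X2 U /\
  forall X1' X2' U', state_space X1' -> state_space X2' ->
    control_space U' -> optimal_tuple X1' X2' U' ->
    [/\ proc_eq P `[0, T] X1' X1, proc_eq P `[0, T] X2' X2 &
        proc_eq P `[0, T[ U' U].

Definition is_adjoint (U Y1 Y2 : process) : Prop :=
  [/\ state_space Y1, state_space Y2,
      {ae P, forall w, Y1 (tn N) w = (tau / 2) *: Delta_h (Y2 (tn N) w)
         + beta *: (Xt_htau (tn N) - state1 U (tn N) w)},
      {ae P, forall w, Y2 (tn N) w = (tau / 2) *: Y1 (tn N) w} &
      forall n, (n < N)%N ->
        {ae P, forall w, Y1 (tn n) w =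
           condE P D Th (filt P W (tn n)) (fun w =>
             Y1 (tn n.+1) w
             + (tau / 2) *: Delta_h (Y2 (tn n.+1) w + Y2 (tn n) w)
             + (gamma * dW n.+1 w) *: Y2 (tn n.+1) w) w
           + tau *: (Xt_h (tn n) - state1 U (tn n) w)} /\
        {ae P, forall w, Y2 (tn n) w =
           condE P D Th (filt P W (tn n)) (fun w =>
             Y2 (tn n.+1) w + (tau / 2) *: (Y1 (tn n.+1) w + Y1 (tn n) w)) w}].

Definition adjoint (U : process) : process * process :=
  xget (fun _ _ => 0, fun _ _ => 0) [set Y | is_adjoint U Y.1 Y.2].
Definition adjoint1 (U : process) : process := (adjoint U).1.
Definition adjoint2 (U : process) : process := (adjoint U).2.

End SLQ.

(* Main.v *)
Require Import Defs.
From HB Require Import structures.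
From mathcomp Require Import all_boot all_order all_algebra.
From mathcomp Require Import all_classical all_reals all_analysis.
From mathcomp Require Import measurable_realfun.
From mathcomp Require Import ring lra.
Import Order.TTheory GRing.Theory Num.Theory.
Import numFieldNormedType.Exports.
Local Open Scope classical_set_scope.
Local Open Scope ring_scope.

(** All processes of the problem take values in the finite dimensional space
    [Vh], so the statement is the optimality system of a linear-quadratic
    problem for random vectors, once its ingredients are read in coordinates.

    Coordinates.  [lebesgue_rV] is a sigma-finite measure by Tonelli's theorem
    ([lebesgue_rV_sigma_additive]) that charges nonempty open sets.  Hence a
    continuous function of zero L2 norm vanishes on D, so the L2 inner product is
    definite on [Vh] ([Vh_eq0]); nodal values bound the dimension, and [Vh] has
    a finite L2-orthonormal basis ([Vh_basis]).  A function of H^1_0(D) with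
    zero gradient is zero because D is bounded ([ip_grad_eq0]), so the stiffness
    matrix is symmetric positive definite, and the Ritz projection and the
    discrete Laplacian act on coordinates by matrices ([ritz_spec],
    [laplace_spec]).

    Conditional expectations.  An increment of W is independent of the past,
    so its square integrates like a constant over every past event
    ([increment_second_moment]).  Therefore multiplication by the increment
    preserves square integrability of past random vectors ([sq_weight]), and
    the conditional expectation of the increment times a square integrable
    vector is again square integrable ([cond_product]).  A backward equation
    with conditional expectations then amounts to the same equation tested with
    all square integrable past vectors ([condEP], [adjoint_adjP]).

    Optimality.  With a = tau / 2 and A the matrix of the discrete Laplacian, a
    forward or backward step inverts 1 - a^2 A, which is possible as A <= 0
    ([cn_unit]).  Let (z, v) be the variation of the state caused by a variation
    V of the control.  The sum of E <Y1 - a A Y2, z> and E <Y2 - a Y1, v>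
    telescopes over the time steps, and the terminal relations of the adjoint
    say that at time t_N these two weights are beta times the misfit and zero.
    The result is a summation by parts ([duality]) which turns the derivative of
    the cost into tau times the sum over n of E <alpha U(t_n) - Y2(t_{n+1}), V(t_n)>
    ([cost_increment]).  The second variation is at least
    tau alpha sum_n E |V(t_n)|^2.  So U is a minimizer exactly when
    alpha U(t_n) - Y2(t_{n+1}) is orthogonal to all square integrable vectors
    measurable at time t_n, that is, when the optimality condition holds
    ([first_order], [cost_minimal_at], [stationaryP]); and the quadratic lower
    bound gives uniqueness ([stationary_unique]). *)

Set Implicit Arguments.
Unset Strict Implicit.
Unset Printing Implicit Defensive.

(** * Lebesgue measure on R^d by slicing *)

Section Cube.
Context (R : realType).

(** Balls of the sup norm; in coordinates they are products of intervals,
    which suits slicing. *)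
Definition cube n (p : 'rV[R]_n) (r : R) : set 'rV[R]_n :=
  [set y | forall j, `|y 0 j - p 0 j| < r].

Lemma cube_ball n (p : 'rV[R]_n) r : 0 < r -> cube p r = ball p r.
Proof.
move=> r0; apply/seteqP; split=> y /=.
  move=> H; split => // i j; rewrite ord1 -ball_normE /= distrC; exact: H.
by case=> _ H j; have := H 0 j; rewrite -ball_normE /= distrC.
Qed.

Lemma cube_open n (p : 'rV[R]_n) r : 0 < r -> open (cube p r).
Proof. by move=> r0; rewrite cube_ball//; exact: ball_open. Qed.

Lemma open_cube n (O : set 'rV[R]_n) x : open O -> O x ->
  exists2 r : R, 0 < r & cube x r `<=` O.
Proof.
move=> oO Ox; have /nbhs_ballP[r /= r0 rO] := open_nbhs_nbhs (conj oO Ox).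
by exists r => //; rewrite cube_ball.
Qed.

Lemma measurable_cube n (p : 'rV[R]_n) r : 0 < r ->
  measurable (cube p r : set (borel_rV R n)).
Proof. by move=> r0; apply: sub_sigma_algebra; exact: cube_open. Qed.

Lemma open_borel n (O : set 'rV[R]_n) : open O -> measurable (O : set (borel_rV R n)).
Proof. by move=> oO; apply: sub_sigma_algebra. Qed.

Definition rcons_rV n (z : R * 'rV[R]_n) : 'rV[R]_n.+1 :=
  row_mx (z.1%:M : 'M[R]_1) z.2.

Lemma rcons_rV0 n (z : R * 'rV[R]_n) : rcons_rV z 0 0 = z.1.
Proof.
have := row_mxEl (z.1%:M : 'M[R]_1) z.2 0 0.
by rewrite [in RHS]mxE /= mulr1n (_ : lshift n 0 = 0)//; exact/val_inj.
Qed.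

Lemma rcons_rVS n (z : R * 'rV[R]_n) (j : 'I_n) :
  rcons_rV z 0 (rshift 1 j) = z.2 0 j.
Proof. exact: (row_mxEr (z.1%:M : 'M[R]_1) z.2 0 j). Qed.

Lemma cube_rcons n (p : 'rV[R]_n.+1) r (z : R * 'rV[R]_n) :
  cube p r (rcons_rV z) <->
  `|z.1 - p 0 0| < r /\ cube (rsubmx (p : 'rV_(1 + n))) r z.2.
Proof.
split=> [H|[H0 H] j].
  split=> [|j]; first by have := H 0; rewrite rcons_rV0.
  by have := H (rshift 1 j); rewrite rcons_rVS !mxE.
have [i ->|i ->] := @split_ordP 1 n j.
  by rewrite ord1 (_ : lshift n 0 = 0) ?rcons_rV0//; exact/val_inj.
by rewrite rcons_rVS; have := H i; rewrite !mxE.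
Qed.

Lemma rat_dist (x r : R) : 0 < r -> exists q : rat, `|x - ratr q| < r.
Proof.
move=> r0; have : x - r < x + r by lra.
move=> /rat_in_itvoo[q]; rewrite in_itv/= => /andP[? ?].
by exists q; rewrite ltr_norml; apply/andP; split; lra.
Qed.

Definition rcons_borel n : measurableTypeR R * borel_rV R n -> borel_rV R n.+1 :=
  @rcons_rV n.

(** The Borel sets of R^(n+1) are generated by the open sets, and an open
    set is a countable union of rational boxes, which are measurable for the
    product sigma-algebra. *)
Lemma measurable_rcons n : measurable_fun setT (@rcons_borel n).
Proof.
refine (@measurability _ _ _ (borel_rV R n.+1) setT (@rcons_borel n) (@open 'rV[R]_n.+1) _ _) => //.
move=> _ [V oV <-]; rewrite setTI.
pose box (q : rat * 'rV[rat]_n * rat) : set (R * 'rV[R]_n) :=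
  `]ratr q.1.1 - ratr q.2, ratr q.1.1 + ratr q.2[%classic `*`
  cube (map_mx ratr q.1.2) (ratr q.2).
pose I := [set q | 0 < (ratr q.2 : R) /\ box q `<=` @rcons_rV n @^-1` V].
rewrite (_ : _ @^-1` _ = \bigcup_(q in I) box q); last first.
  apply/seteqP; split => z /=; last by move=> [q [_]]; apply.
  move=> Vz; have [r r0 rV] := open_cube oV Vz.
  have : 0 < r / 2 by lra.
  move=> /rat_in_itvoo[s]; rewrite in_itv/= => /andP[s0 s1].
  have [q hq] := rat_dist z.1 s0.
  have /choice[p hp] : forall j, exists q : rat, `|z.2 0 j - ratr q| < (ratr s : R).
    by move=> j; exact: rat_dist.
  exists (q, \row_j p j, s) => /=.
    split => //= z' [/= ]; rewrite in_itv /= => h1 h2; apply: rV; apply/cube_rcons; split.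
      rewrite rcons_rV0; move: h1 hq => /andP[]; rewrite !ltr_norml => ? ? /andP[? ?].
      by apply/andP; split; lra.
    move=> j; have := hp j; have := h2 j.
    have -> : rsubmx (rcons_borel z : 'rV_(1 + n)) 0 j = z.2 0 j.
      by rewrite mxE; exact: rcons_rVS.
    rewrite !mxE !ltr_norml.
    by move=> /andP[? ?] /andP[? ?]; apply/andP; split; lra.
  split => /=.
    by move: hq; rewrite in_itv/= ltr_norml => /andP[? ?]; apply/andP; split; lra.
  by move=> j; rewrite !mxE.
rewrite bigcup_mkcond; apply: countable_bigcupT_measurable => [|q].
  exact: countableP.
case: ifPn => [|_]; last exact: measurable0.
rewrite inE => -[q0 _]; apply: measurableX; first exact: measurable_itv.
exact: measurable_cube.
Qed.

Definition slice n (A : set 'rV[R]_n.+1) (x : R) : set 'rV[R]_n :=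
  [set y | A (rcons_rV (x, y))].

Lemma sliceE n (A : set 'rV[R]_n.+1) x :
  slice A x = xsection (@rcons_rV n @^-1` A) x.
Proof. by apply/seteqP; split => y; rewrite /xsection /slice /= inE. Qed.

Lemma lebesgue_rVS n (A : set 'rV[R]_n.+1) : lebesgue_rV A =
  (\int[@lebesgue_measure R]_x lebesgue_rV (slice A x))%E.
Proof. by []. Qed.


Lemma lebesgue_rV_ge0 n (A : set 'rV[R]_n) : (0 <= lebesgue_rV A)%E.
Proof.
elim: n A => [|n IH] A; first by rewrite /= lee_fin.
by rewrite lebesgue_rVS; apply: integral_ge0.
Qed.

Lemma lebesgue_rV_set0 n : lebesgue_rV (set0 : set 'rV[R]_n) = 0%E.
Proof.
elim: n => [|n IH]; first by rewrite /= indicE in_set0.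
by rewrite lebesgue_rVS integral0_eq.
Qed.

(** By induction: the slices of a cube are cubes of one dimension less over
    an interval of length 2 r, and empty elsewhere. *)
Lemma lebesgue_rV_cube n (p : 'rV[R]_n) (r : R) : 0 < r ->
  lebesgue_rV (cube p r) = ((2 * r) ^+ n)%:E.
Proof.
move=> r0; elim: n p => [|n IH] p.
  rewrite /= expr0 indicE mem_set//; by case.
rewrite lebesgue_rVS; under eq_integral.
  move=> x _; rewrite (_ : lebesgue_rV _ = ((2 * r) ^+ n)%:E *
    (\1_`]p 0 0 - r, p 0 0 + r[ x)%:E)%E; last first.
    rewrite indicE; have [xp|xp] := boolP (`|x - p 0 0| < r).
      rewrite mem_set ?mule1; last first.
        by rewrite /= in_itv /=; move: xp; rewrite ltr_norml => /andP[? ?]; apply/andP; split; lra.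
      rewrite -(IH (rsubmx (p : 'rV_(1 + n)))); congr lebesgue_rV.
      apply/seteqP; split => y; rewrite /slice/=.
        by move=> /cube_rcons[].
      by move=> ?; apply/cube_rcons.
    rewrite memNset ?mule0; last first.
      rewrite /= in_itv /=; apply/negP; apply: contraNN xp; rewrite ltr_norml => /andP[? ?]; apply/andP; split; lra.
    rewrite (_ : slice _ _ = set0) ?lebesgue_rV_set0//.
    by rewrite -subset0 => y /cube_rcons[/= h _]; move: xp; rewrite h.
  over.
rewrite ge0_integralZl//; last 2 first.
- by apply/measurable_EFinP; exact: measurable_indic.
- by rewrite lee_fin exprn_ge0// mulr_ge0// ltW.
rewrite integral_indic// setIT [X in (_ * X)%E]lebesgue_measure_itv /= lte_fin ifT; last by lra.
by rewrite -EFinD -EFinM; congr EFin; rewrite exprSr; congr (_ * _); lra.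
Qed.

End Cube.

Section Lebesgue.
Context (R : realType).
Local Notation leb n := (@lebesgue_rV R n : set (borel_rV R n) -> \bar R).

Definition is_measure_rV n := semi_sigma_additive (leb n).

(** The product measure that gives [lebesgue_rV] in dimension n + 1 requires
    a measure structure in dimension n. Sigma-additivity is an argument here
    so that the induction hypothesis provides this structure. *)
Definition rV_measure n (h : is_measure_rV n) : set (borel_rV R n) -> \bar R := leb n.
HB.instance Definition _ n (h : is_measure_rV n) := isMeasure.Build _ _ _ (rV_measure h)
  (@lebesgue_rV_set0 R n) (@lebesgue_rV_ge0 R n) h.

Lemma cover_cube n (y : 'rV[R]_n) : exists k : nat, cube 0 (k.+1%:R : R) y.
Proof.
pose M := \sum_j `|y 0 j|.
exists (Num.truncn M) => j; rewrite mxE subr0.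
apply: (@le_lt_trans _ _ M); last exact: truncnS_gt.
by rewrite /M (bigD1 j)//= lerDl sumr_ge0.
Qed.

Lemma rV_sigma_finite n (h : is_measure_rV n) : sigma_finite setT (rV_measure h).
Proof.
exists (fun k => cube 0 k.+1%:R) => [|k]; last first.
  split; first exact: measurable_cube.
  by rewrite /rV_measure lebesgue_rV_cube// ltry.
apply/seteqP; split => // y _; have [k yk] := cover_cube y.
by exists k.
Qed.

HB.instance Definition _ n (h : is_measure_rV n) :=
  @Measure_isSigmaFinite.Build _ _ _ (rV_measure h) (rV_sigma_finite h).

(** In dimension n + 1, slicing is the definition of the product of the
    Lebesgue measure of the line with the measure obtained in dimension n. *)
Lemma lebesgue_rV_sigma_additive n : is_measure_rV n.
Proof.
elim: n => [|n IH].
  exact: (@measure_semi_sigma_additive _ _ _ (\d_(0 : borel_rV R 0))).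
have E A : leb n.+1 A = (@lebesgue_measure R \x rV_measure IH)%E (@rcons_borel R n @^-1` A).
  rewrite /product_measure1 lebesgue_rVS.
  by apply: eq_integral => x _; rewrite sliceE.
have mr A : measurable A -> measurable (@rcons_borel R n @^-1` A).
  by move=> mA; rewrite -[X in measurable X]setTI; exact: measurable_rcons.
move=> F mF tF mUF; rewrite E preimage_bigcup.
rewrite [X in X @ _](_ : _ = (fun n => \sum_(0 <= i < n)
    (@lebesgue_measure R \x rV_measure IH)%E (@rcons_borel R _ @^-1` F i))%E); last first.
  by apply/funext => k; apply: eq_bigr => i _; rewrite E.
apply: (@measure_semi_sigma_additive _ _ _
  ((@lebesgue_measure R \x rV_measure IH)%E : {measure set _ -> \bar R})
  (fun i => @rcons_borel R n @^-1` F i)).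
- by move=> i; exact: mr.
- apply/trivIsetP => /= i j _ _ ij; rewrite -preimage_setI.
  by move/trivIsetP : tF => /(_ _ _ _ _ ij) ->//; rewrite preimage_set0.
- by rewrite -preimage_bigcup; exact: mr.
Qed.

HB.instance Definition _ n := isMeasure.Build _ _ _ (leb n)
  (@lebesgue_rV_set0 R n) (@lebesgue_rV_ge0 R n) (@lebesgue_rV_sigma_additive n).

Lemma coord_norm_le n (x : 'rV[R]_n) j : `|x 0 j| <= `|x|.
Proof.
have [z|z] := eqVneq `|x| 0; first by rewrite (normr0_eq0 z) mxE normr0.
rewrite [leRHS]/Num.norm/= mx_normrE; exact: (le_bigmax _ _ (0, j)).
Qed.

Lemma lebesgue_rV_bounded n (A : set 'rV[R]_n) : measurable (A : set (borel_rV R n)) ->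
  bounded_set A -> (leb n A < +oo)%E.
Proof.
move=> mA bA; have [M [_ hM]] := bA.
have hA : A `<=` cube 0 (`|M| + 2).
  move=> x Ax j; rewrite mxE subr0.
  have /= := hM (`|M| + 1) _ x Ax.
  rewrite ltr_pwDr ?ler_norm// => /(_ isT) h.
  suff : `|x 0 j| <= `|M| + 1 by move=> ?; lra.
  by apply: le_trans h; exact: coord_norm_le.
have k0 : 0 < `|M| + 2 by have := normr_ge0 M; lra.
apply: le_lt_trans (le_measure (leb n) _ _ hA) _; rewrite ?inE//; first exact: measurable_cube.
by rewrite [X in (X < _)%E]lebesgue_rV_cube// ltry.
Qed.

(** A nonempty open set contains a cube. *)
Lemma lebesgue_rV_open_gt0 n (A : set 'rV[R]_n) : open A -> A !=set0 ->
  (0 < leb n A)%E.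
Proof.
move=> oA [x Ax]; have [r r0 rA] := open_cube oA Ax.
apply: (@lt_le_trans _ _ (leb n (cube x r))).
  by rewrite lebesgue_rV_cube// lte_fin exprn_gt0//; lra.
by apply: (le_measure (leb n)) rA; rewrite inE; [exact: measurable_cube|exact: open_borel].
Qed.
End Lebesgue.

(** * Square integrable functions on a measure space *)

Section SquareIntegrable.
Context (dd : measure_display) (T : measurableType dd) (R : realType).
Context (mu : {measure set T -> \bar R}) (D : set T).
Hypothesis mD : measurable D.
Implicit Types f g h : T -> R.

Definition sqint f :=
  measurable_fun D f /\ (\int[mu]_(x in D) (f x ^+ 2)%:E < +oo)%E.

(** The L2 inner product on D with respect to [mu], used both for functions
    on D and for random variables. *)
Definition ipr f g : R := fine (\int[mu]_(x in D) (f x * g x)%:E)%E.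

Lemma sqint_sq f : sqint f -> mu.-integrable D (fun x => (f x ^+ 2)%:E).
Proof.
move=> [mf If]; apply/integrableP; split.
  by apply/measurable_EFinP; exact: measurable_funX.
by under eq_integral do rewrite gee0_abs ?lee_fin ?sqr_ge0//.
Qed.

(** From |f g| <= f^2 + g^2. *)
Lemma sqintM f g : sqint f -> sqint g ->
  mu.-integrable D (fun x => (f x * g x)%:E).
Proof.
move=> sf sg; have [mf _] := sf; have [mg _] := sg.
apply: (le_integrable mD) (integrableD mD (sqint_sq sf) (sqint_sq sg)) => //.
  by apply/measurable_EFinP; exact: measurable_funM.
move=> x _; rewrite -EFinD !abse_EFin lee_fin.
rewrite [leRHS]ger0_norm ?addr_ge0 ?sqr_ge0// ler_norml; apply/andP; split.
  by have := sqr_ge0 (f x + g x); have := sqr_ge0 (f x); have := sqr_ge0 (g x); rewrite !expr2; nra.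
by have := sqr_ge0 (f x - g x); have := sqr_ge0 (f x); have := sqr_ge0 (g x); rewrite !expr2; nra.
Qed.

Lemma iprE f g : sqint f -> sqint g ->
  (\int[mu]_(x in D) (f x * g x)%:E)%E = (ipr f g)%:E.
Proof. by move=> sf sg; rewrite fineK//; exact/integrable_fin_num/sqintM. Qed.

Lemma ipr_sqE f : sqint f -> (\int[mu]_(x in D) (f x ^+ 2)%:E)%E = (ipr f f)%:E.
Proof. by move=> sf; rewrite -iprE//; apply: eq_integral => x _; rewrite expr2. Qed.

Lemma sqintD f g : sqint f -> sqint g -> sqint (fun x => f x + g x).
Proof.
move=> sf sg; have [mf _] := sf; have [mg _] := sg.
split; first exact: measurable_funD.
have /integrableP[_] : mu.-integrable D (fun x => ((f x + g x) ^+ 2)%:E).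
  apply: (le_integrable mD)
    (integrableZl mD 2 (integrableD mD (sqint_sq sf) (sqint_sq sg))) => //.
    by apply/measurable_EFinP; apply: measurable_funX; exact: measurable_funD.
  move=> x _; rewrite -EFinD -EFinM !abse_EFin lee_fin !ger0_norm ?sqr_ge0//.
    by have := sqr_ge0 (f x - g x); rewrite !expr2; nra.
  by rewrite mulr_ge0// addr_ge0// sqr_ge0.
by under eq_integral do rewrite gee0_abs ?lee_fin ?sqr_ge0//.
Qed.

Lemma sqintZ a f : sqint f -> sqint (fun x => a * f x).
Proof.
move=> sf; have [mf If] := sf; split; first exact: measurable_funM.
under eq_integral do rewrite exprMn EFinM.
rewrite integralZl//; last exact: sqint_sq.
by rewrite ipr_sqE// -EFinM ltry.
Qed.

Lemma sqint0 : sqint (fun=> 0).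
Proof.
split; first exact: measurable_cst.
by under eq_integral do rewrite expr0n; rewrite integral0 ltry.
Qed.

Lemma sqintN f : sqint f -> sqint (fun x => - f x).
Proof.
move=> /(sqintZ (-1)); congr sqint; apply/funext => x; lra.
Qed.

Lemma sqintB f g : sqint f -> sqint g -> sqint (fun x => f x - g x).
Proof. by move=> sf /sqintN sg; exact: sqintD. Qed.

Lemma sqint_sum (I : Type) (r : seq I) (F : I -> T -> R) :
  (forall i, sqint (F i)) -> sqint (fun x => \sum_(i <- r) F i x).
Proof.
move=> h; elim: r => [|i r IH].
  by have := sqint0; congr sqint; apply/funext => x; rewrite big_nil.
by have := sqintD (h i) IH; congr sqint; apply/funext => x; rewrite big_cons.
Qed.

Lemma iprC f g : ipr f g = ipr g f.
Proof. by congr fine; apply: eq_integral => x _; rewrite mulrC. Qed.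

Lemma iprDl f g h : sqint f -> sqint g -> sqint h ->
  ipr (fun x => f x + g x) h = ipr f h + ipr g h.
Proof.
move=> sf sg sh; apply: EFin_inj; rewrite EFinD -!iprE//; last exact: sqintD.
rewrite -integralD//; try exact: sqintM.
by apply: eq_integral => x _; rewrite mulrDl EFinD.
Qed.

Lemma iprZl a f h : sqint f -> sqint h ->
  ipr (fun x => a * f x) h = a * ipr f h.
Proof.
move=> sf sh; apply: EFin_inj; rewrite EFinM -!iprE//; last exact: sqintZ.
rewrite -integralZl//; last exact: sqintM.
by apply: eq_integral => x _; rewrite -mulrA EFinM.
Qed.

Lemma iprDr f g h : sqint f -> sqint g -> sqint h ->
  ipr h (fun x => f x + g x) = ipr h f + ipr h g.
Proof. by move=> *; rewrite iprC iprDl// !(iprC h). Qed.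

Lemma iprZr a f h : sqint f -> sqint h ->
  ipr h (fun x => a * f x) = a * ipr h f.
Proof. by move=> *; rewrite iprC iprZl// iprC. Qed.

Lemma ipr0l h : ipr (fun=> 0) h = 0.
Proof.
by rewrite /ipr; under eq_integral do rewrite mul0r; rewrite integral0.
Qed.

Lemma ipr_suml (I : Type) (r : seq I) (F : I -> T -> R) h :
  (forall i, sqint (F i)) -> sqint h ->
  ipr (fun x => \sum_(i <- r) F i x) h = \sum_(i <- r) ipr (F i) h.
Proof.
move=> hF sh; elim: r => [|i r IH].
  rewrite big_nil -[RHS](ipr0l h); congr ipr.
  by apply/funext => x; rewrite big_nil.
rewrite big_cons -IH -iprDl//; last exact: sqint_sum.
by congr ipr; apply/funext => x; rewrite big_cons.
Qed.

Lemma ipr_ge0 f : 0 <= ipr f f.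
Proof.
rewrite /ipr fine_ge0//; apply: integral_ge0 => x _.
by rewrite lee_fin -expr2 sqr_ge0.
Qed.

(** The quadratic form a^2 (f, f) + 2 a b (f, g) + b^2 (g, g) is
    nonnegative; the case (g, g) = 0 needs its own choice of a and b. *)
Lemma ipr_CS f g : sqint f -> sqint g -> ipr f g ^+ 2 <= ipr f f * ipr g g.
Proof.
move=> sf sg.
have q (a b : R) : 0 <= a ^+ 2 * ipr f f + 2 * a * b * ipr f g + b ^+ 2 * ipr g g.
  have := ipr_ge0 (fun x => a * f x + b * g x).
  have sa := sqintZ a sf; have sb := sqintZ b sg.
  rewrite iprDl ?iprDr//; do ?exact: sqintD.
  by rewrite !(iprZl, iprZr)// (iprC g f) => h; apply: le_trans h _; lra.
have [g0|g0] := eqVneq (ipr g g) 0.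
  have := q (ipr f g) (- (ipr f f + 1)); have f0 := ipr_ge0 f.
  rewrite g0 !mulr0 addr0 => h.
  have : 0 <= - (ipr f g ^+ 2 * (ipr f f + 2)).
    rewrite (_ : - _ = ipr f g ^+ 2 * ipr f f + 2 * ipr f g * - (ipr f f + 1) * ipr f g) //.
    by ring.
  by rewrite oppr_ge0 pmulr_lle0//; lra.
have gp : 0 < ipr g g by rewrite lt_neqAle eq_sym g0 ipr_ge0.
have := q (ipr g g) (- ipr f g).
rewrite (_ : _ + _ = ipr g g * (ipr f f * ipr g g - ipr f g ^+ 2)); last by ring.
by rewrite pmulr_rge0// subr_ge0.
Qed.

Lemma ipr_eq0 f : sqint f -> ipr f f = 0 ->
  {ae mu, forall x, D x -> f x = 0}.
Proof.
move=> sf f0; have [mf _] := sf.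
have m2 : measurable_fun D (fun x => (f x * f x)%:E).
  by apply/measurable_EFinP; exact: measurable_funM.
have /(ae_eq_integral_abs mu mD m2) : (\int[mu]_(x in D) `| (f x * f x)%:E | = 0)%E.
  have -> : 0%E = (ipr f f)%:E :> \bar R by rewrite f0.
  rewrite -iprE//.
  by apply: eq_integral => x _; rewrite gee0_abs// lee_fin -expr2 sqr_ge0.
apply: filterS => x h Dx; have := h Dx => /eqP.
by rewrite eqe mulf_eq0 orbb => /eqP.
Qed.

Lemma ae_eq_ipr f g f' g' : sqint f -> sqint g -> sqint f' -> sqint g' ->
  {ae mu, forall x, D x -> f x = f' x} -> {ae mu, forall x, D x -> g x = g' x} ->
  ipr f g = ipr f' g'.
Proof.
move=> [mf _] [mg _] [mf' _] [mg' _] hf hg; congr fine; apply: ae_eq_integral => //.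
- by apply/measurable_EFinP; exact: measurable_funM.
- by apply/measurable_EFinP; exact: measurable_funM.
by apply: filterS2 hf hg => x h1 h2 Dx; rewrite h1// h2.
Qed.

End SquareIntegrable.

(** * Test functions and coordinates *)

Section TestFunctions.
Context (R : realType) (d : nat).
Local Notation F := (funRd R d).
Local Notation V := 'rV[R]_d.

Lemma Ck_cont k (f : F) : Ck k f -> continuous f.
Proof. by case: k => [|k] []. Qed.

Lemma CkW k (f : F) : Ck k.+1 f -> Ck k f.
Proof.
elim: k f => [|k IH] f [cf hf]; first by split.
by split=> // i; have [df Df] := hf i; split=> //; exact: IH.
Qed.

Lemma CkD k (f g : F) : Ck k f -> Ck k g -> Ck k (f + g).
Proof.
elim: k f g => [|k IH] f g [cf hf] [cg hg].
  by split=> // x; exact: (continuousD (cf x) (cg x)).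
split=> [x|i]; first exact: (continuousD (cf x) (cg x)).
have [df Df] := hf i; have [dg Dg] := hg i; split=> [x|]; first exact: derivableD.
rewrite (_ : (fun x => _) = (fun x => 'D_(e_ R i) f x) + (fun x => 'D_(e_ R i) g x)).
  exact: IH.
by apply/funext => x; rewrite deriveD.
Qed.

Lemma CkZ k a (f : F) : Ck k f -> Ck k (a *: f).
Proof.
elim: k f => [|k IH] f [cf hf].
  by split=> // x; exact: (cvgZl_tmp (k := a) (cf x)).
split=> [x|i]; first exact: (cvgZl_tmp (k := a) (cf x)).
have [df Df] := hf i; split=> [x|]; first exact: derivableZ.
rewrite (_ : (fun x => _) = a *: (fun x => 'D_(e_ R i) f x)); first exact: IH.
by apply/funext => x; rewrite deriveZ.
Qed.

(** Multiplication by a coordinate function; it enters through the identity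
    phi = D_i (x_i phi) - x_i D_i phi, the source of the Poincare
    inequality. *)
Definition coord_mul (i : 'I_d) (f : F) : F := fun x => x 0 i * f x.

Lemma is_derive_coord (i j : 'I_d) (x : V) :
  is_derive x (e_ R j) (fun y : V => y 0 i : R^o) (i == j)%:R.
Proof.
have L : h^-1 *: (((fun y : V => y 0 i : R^o) \o shift x) (h *: e_ R j) - x 0 i)
    @[h --> 0^'] --> ((i == j)%:R : R^o).
  apply: cvg_near_cst; near=> h.
  have h0 : h != 0 by near: h; exact: nbhs_dnbhs_neq.
  by rewrite /= !mxE addrK eqxx /= -[LHS]/(h^-1 * (h * _)) mulKf.
by apply: DeriveDef; [exact: cvgP L|exact: cvg_lim L].
Unshelve. all: by end_near.
Qed.

Lemma derive_coord_mul i j (f : F) x : derivable f x (e_ R j) ->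
  is_derive x (e_ R j) (coord_mul i f)
    ((i == j)%:R * f x + x 0 i * 'D_(e_ R j) f x).
Proof.
move=> df.
have h := is_derive_coord i j x.
have [d1 d2] := is_deriveM h (derivableP df).
apply: DeriveDef; first exact: d1.
by rewrite [LHS]d2 addrC mulrC.
Qed.

Lemma Ck_coord_mul k i (f : F) : Ck k f -> Ck k (coord_mul i f).
Proof.
elim: k f => [|k IH] f Cf; have [cf hf] := Cf.
  by split=> // x; exact: (continuousM (@coord_continuous R 1 d 0 i x) (cf x)).
split=> [x|j]; first exact: (continuousM (@coord_continuous R 1 d 0 i x) (cf x)).
have [df Df] := hf j; split=> [x|].
  by have [] := derive_coord_mul i (df x).
rewrite (_ : (fun x => _) = (i == j)%:R *: f + coord_mul i (fun x => 'D_(e_ R j) f x)).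
  by apply: CkD; [apply: CkZ; exact: CkW|exact: IH].
by apply/funext => x; have [_ ->] := derive_coord_mul i (df x).
Qed.

Context (D : set V).

Lemma test_derivable (phi : F) i x : test_fun D phi -> derivable phi x (e_ R i).
Proof. by move=> [/(_ 1) [_ /(_ i) [h _]] _]. Qed.

Lemma test_funD (phi psi : F) : test_fun D phi -> test_fun D psi ->
  test_fun D (phi + psi).
Proof.
move=> [Cf [K [cK KD K0]]] [Cg [L [cL LD L0]]]; split=> [k|]; first exact: CkD.
exists (K `|` L); split; first exact: compactU.
  by move=> x [/KD|/LD].
by move=> x /not_orP[/K0 h1 /L0 h2]; rewrite [LHS](_ : _ = phi x + psi x)// h1 h2 addr0.
Qed.

Lemma test_funZ a (phi : F) : test_fun D phi -> test_fun D (a *: phi).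
Proof.
move=> [Cf [K [cK KD K0]]]; split=> [k|]; first exact: CkZ.
by exists K; split=> // x /K0 h; rewrite [LHS](_ : _ = a * phi x)// h mulr0.
Qed.

Lemma test_coord_mul i (phi : F) : test_fun D phi -> test_fun D (coord_mul i phi).
Proof.
move=> [Cf [K [cK KD K0]]]; split=> [k|]; first exact: Ck_coord_mul.
by exists K; split=> // x /K0 h; rewrite /coord_mul h mulr0.
Qed.

(** Off its compact support a test function is locally zero, so its
    derivatives vanish there. *)
Lemma test_derive i (phi : F) : test_fun D phi ->
  test_fun D (fun x => 'D_(e_ R i) phi x).
Proof.
move=> [Cf [K [cK KD K0]]]; split=> [k|]; first by have [_ /(_ i) []] := Cf k.+1.
exists K; split=> // x Kx.
have : \forall y \near x, phi y = cst 0 y.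
  have oK : open (~` K) by apply: closed_openC; apply: compact_closed => //; exact: norm_hausdorff.
  by apply: filterS (open_nbhs_nbhs (conj oK Kx)) => y /K0.
move=> /near_eq_derive h; rewrite h ?derive_cst//.
Qed.

Lemma measurable_cont (f : F) : continuous f ->
  measurable_fun setT (f : borel_rV R d -> R).
Proof.
move=> cf; apply: (@measurability _ _ _ _ setT _ _ (RGenOInfty.measurableE R)).
move=> _ [_ [a ->] <-]; rewrite setTI; apply: open_borel.
have oI : open (`]a, +oo[%classic : set R^o) by exact: rray_open.
exact: (open_comp (fun x _ => cf x) oI).
Qed.
Local Notation mu := (@lebesgue_rV R d : set (borel_rV R d) -> \bar R).
Hypothesis hD : bounded_domain D.

Lemma measurable_domain : measurable (D : set (borel_rV R d)).
Proof. by have [oD _ _ _] := hD; exact: open_borel. Qed.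

(** Test functions are bounded and D has finite measure. *)
Lemma test_L2 (phi : F) : test_fun D phi -> L2 D phi.
Proof.
have mD := measurable_domain.
move=> [Cf [K [cK KD K0]]]; have cf := Ck_cont (Cf 0%N).
have mf : measurable_fun (D : set (borel_rV R d)) (phi : borel_rV R d -> R).
  by apply: measurable_funTS; exact: measurable_cont.
have [M [_ hM]] : bounded_set (phi @` K).
  by apply: compact_bounded; apply: continuous_compact => //; exact: continuous_subspaceT.
have bphi x : `|phi x| <= `|M| + 1.
  have [Kx|/K0 ->] := pselect (K x); last by rewrite normr0 addr_ge0.
  by apply: (hM (`|M| + 1)); [rewrite ltr_pwDr ?ler_norm|exists x].
suff : mu.-integrable D (EFin \o (fun x => phi x ^+ 2)).
  move=> /integrableP[_]; split=> //.
  move: (b); by under eq_integral do rewrite /= ger0_norm ?sqr_ge0//.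
apply: measurable_bounded_integrable => //.
- by have [_ _ _ bD] := hD; exact: lebesgue_rV_bounded.
- exact: measurable_funX.
exists ((`|M| + 1) ^+ 2); split=> // z hz x _.
by apply: ltW; apply: le_lt_trans hz; rewrite /= normrX lerXn2r ?nnegrE ?addr_ge0.
Qed.

End TestFunctions.

(** * The spaces L2 and H10 *)

Lemma quarter_sum (R : realType) (e : R) : e / 4 + e / 4 <= e / 2.
Proof. by lra. Qed.

Lemma regroup_double (R : realType) (a b c e : R) :
  2 * a + 2 * b + (2 * c + 2 * e) <= 2 * (a + c) + 2 * (b + e).
Proof. by lra. Qed.

Lemma ler_sum_double (R : realType) n (a b c : 'I_n -> R) :
  (forall i, c i <= 2 * a i + 2 * b i) ->
  \sum_i c i <= 2 * (\sum_i a i) + 2 * (\sum_i b i).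
Proof. by move=> h; rewrite !mulr_sumr -big_split; exact: ler_sum. Qed.

Section H10Space.
Context (R : realType) (d : nat) (D : set 'rV[R]_d).
Hypothesis hD : bounded_domain D.
Local Notation F := (funRd R d).
Local Notation mu := (@lebesgue_rV R d : set (borel_rV R d) -> \bar R).
Implicit Types u v w : F.

Let mD : measurable (D : set (borel_rV R d)) := measurable_domain hD.

Lemma L2D u v : L2 D u -> L2 D v -> L2 D (u + v).
Proof. exact: (sqintD mD). Qed.

Lemma L2Z a u : L2 D u -> L2 D (a *: u).
Proof. exact: (sqintZ mD). Qed.

Lemma L2N u : L2 D u -> L2 D (- u).
Proof. exact: (sqintN mD). Qed.

Lemma L2B u v : L2 D u -> L2 D v -> L2 D (u - v).
Proof. exact: (sqintB mD). Qed.

Lemma ipC u v : ip D u v = ip D v u.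
Proof. exact: (iprC (mu : {measure set (borel_rV R d) -> \bar R})). Qed.

Lemma ipDl u v w : L2 D u -> L2 D v -> L2 D w ->
  ip D (u + v) w = ip D u w + ip D v w.
Proof. exact: (iprDl mD). Qed.

Lemma ipZl a u w : L2 D u -> L2 D w -> ip D (a *: u) w = a * ip D u w.
Proof. exact: (iprZl mD). Qed.

Lemma ipDr u v w : L2 D u -> L2 D v -> L2 D w ->
  ip D w (u + v) = ip D w u + ip D w v.
Proof. exact: (iprDr mD). Qed.

Lemma ipZr a u w : L2 D u -> L2 D w -> ip D w (a *: u) = a * ip D w u.
Proof. exact: (iprZr mD). Qed.

Lemma ipBl u v w : L2 D u -> L2 D v -> L2 D w ->
  ip D (u - v) w = ip D u w - ip D v w.
Proof.
by move=> hu hv hw; rewrite -[in LHS]scaleN1r ipDl ?ipZl ?mulN1r//; exact: L2Z.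
Qed.

Lemma ipBr u v w : L2 D u -> L2 D v -> L2 D w ->
  ip D w (u - v) = ip D w u - ip D w v.
Proof. by move=> hu hv hw; rewrite ipC ipBl// !(ipC w). Qed.

Lemma ip_ge0 u : 0 <= ip D u u.
Proof. exact: (ipr_ge0 (mu : {measure set (borel_rV R d) -> \bar R})). Qed.

Lemma ip_CS u v : L2 D u -> L2 D v -> ip D u v ^+ 2 <= ip D u u * ip D v v.
Proof. exact: (ipr_CS mD). Qed.

Lemma L2norm_sq u : L2norm D u ^+ 2 = ip D u u.
Proof. by rewrite sqr_sqrtr// ip_ge0. Qed.

Lemma ip_ae0 u : L2 D u -> ip D u u = 0 -> {ae mu, forall x, D x -> u x = 0}.
Proof. exact: (ipr_eq0 mD). Qed.

Lemma ip0l u : ip D 0 u = 0.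
Proof. exact: (ipr0l (mu : {measure set (borel_rV R d) -> \bar R})). Qed.

Lemma L2_0 : L2 D 0.
Proof. exact: (sqint0 (mu : {measure set (borel_rV R d) -> \bar R}) D). Qed.

Lemma ip_le u v : L2 D u -> L2 D v -> (forall x, D x -> `|u x| <= `|v x|) ->
  ip D u u <= ip D v v.
Proof.
move=> Lu Lv h; rewrite -lee_fin -!(iprE mD)//.
have m (w : F) : L2 D w -> measurable_fun (D : set (borel_rV R d))
    (fun x : borel_rV R d => (w x * w x)%:E).
  by move=> [mw _]; apply/measurable_EFinP; exact: measurable_funM.
apply: ge0_le_integral => //; do ?exact: m.
- by move=> x _; rewrite lee_fin -expr2 sqr_ge0.
move=> x Dx; rewrite lee_fin -!expr2.
by rewrite -(real_normK (num_real (u x))) -(real_normK (num_real (v x))) lerXn2r ?nnegrE ?h.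
Qed.

Opaque L2 ip L2norm.

Lemma L2norm_parallelogram u v : L2 D u -> L2 D v ->
  L2norm D (u + v) ^+ 2 <= 2 * L2norm D u ^+ 2 + 2 * L2norm D v ^+ 2.
Proof.
move=> Lu Lv; rewrite !L2norm_sq; have := ip_ge0 (u - v).
have LD := L2D Lu Lv; have LB := L2B Lu Lv.
rewrite (ipBl Lu Lv LB) !(ipBr Lu Lv)// ipDl// !ipDr// (ipC v u).
move: (ip D u u) (ip D u v) (ip D v v) => x y z; clear -x y z; lra.
Qed.

(** If phi and psi approximate u and v up to e / 4, then phi + psi
    approximates u + v up to e by the parallelogram inequality. *)
Lemma H10_gradientD u v g k : H10_gradient D u g -> H10_gradient D v k ->
  H10_gradient D (u + v) (fun i => g i + k i).
Proof.
move=> [Lu Lg wg ag] [Lv Lk wk ak]; split.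
- exact: L2D.
- by move=> i; exact: L2D.
- move=> phi tphi i; have Lphi := test_L2 hD (test_derive i tphi).
  by rewrite !ipDl// ?wg ?wk ?opprD//; exact: test_L2.
move=> e e0; have e4 : 0 < e / 4 by lra.
have [phi [tphi hphi]] := ag _ e4; have [psi [tpsi hpsi]] := ak _ e4.
exists (phi + psi); split; first exact: test_funD.
have Lphi := test_L2 hD tphi; have Lpsi := test_L2 hD tpsi.
apply: (@le_lt_trans _ _ (2 * (L2norm D (u - phi) ^+ 2 +
    \sum_i L2norm D (g i - (fun x => 'D_(e_ R i) phi x)) ^+ 2) +
  2 * (L2norm D (v - psi) ^+ 2 +
    \sum_i L2norm D (k i - (fun x => 'D_(e_ R i) psi x)) ^+ 2))); last first.
  rewrite -mulrDr mulrC -ltr_pdivlMr//; apply: lt_le_trans (ltrD hphi hpsi) _.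
  exact: quarter_sum.
have h1 : L2norm D (u + v - (phi + psi)) ^+ 2 <=
    2 * L2norm D (u - phi) ^+ 2 + 2 * L2norm D (v - psi) ^+ 2.
  have -> : u + v - (phi + psi) = (u - phi) + (v - psi).
    by apply/funext => x; rewrite opprD [LHS]addrACA.
  by apply: L2norm_parallelogram; exact: L2B.
have h2 i : L2norm D (g i + k i - (fun x => 'D_(e_ R i) (phi + psi) x)) ^+ 2 <=
    2 * L2norm D (g i - (fun x => 'D_(e_ R i) phi x)) ^+ 2 +
    2 * L2norm D (k i - (fun x => 'D_(e_ R i) psi x)) ^+ 2.
  have -> : g i + k i - (fun x => 'D_(e_ R i) (phi + psi) x) =
      (g i - (fun x => 'D_(e_ R i) phi x)) + (k i - (fun x => 'D_(e_ R i) psi x)).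
    rewrite [RHS]addrACA -opprD; congr (_ - _); apply/funext => x.
    by rewrite (deriveD (@test_derivable R d D phi i x tphi) (@test_derivable R d D psi i x tpsi)).
  by apply: L2norm_parallelogram; apply: L2B => //; apply: test_L2 => //; exact: test_derive.
exact: le_trans (lerD h1 (ler_sum_double h2)) (regroup_double _ _ _ _).
Qed.

Lemma H10_gradientZ a u g : H10_gradient D u g ->
  H10_gradient D (a *: u) (fun i => a *: g i).
Proof.
move=> [Lu Lg wg ag]; split.
- exact: L2Z.
- by move=> i; exact: L2Z.
- move=> phi tphi i; have Lphi := test_L2 hD (test_derive i tphi).
  by rewrite !ipZl// ?wg ?mulrN//; exact: test_L2.
move=> e e0; have a1 : 0 < a ^+ 2 + 1 by rewrite ltr_pwDr ?sqr_ge0.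
have e4 : 0 < e / (a ^+ 2 + 1) by rewrite divr_gt0.
have [phi [tphi hphi]] := ag _ e4.
exists (a *: phi); split; first exact: test_funZ.
have sc (b : F) : L2 D b -> L2norm D (a *: b) ^+ 2 = a ^+ 2 * L2norm D b ^+ 2.
  move=> Lb; rewrite !L2norm_sq; have La := L2Z a Lb.
  by rewrite ipZl// ipZr// mulrA expr2.
have Lphi := test_L2 hD tphi.
rewrite (ltr_pdivlMr _ _ a1) mulrC in hphi.
apply: le_lt_trans hphi.
rewrite [leRHS]mulrDl mul1r; apply: ler_wpDr.
  by apply: addr_ge0; [exact: sqr_ge0|apply: sumr_ge0 => i _; exact: sqr_ge0].
rewrite mulrDr; apply: lerD.
  by rewrite -scalerBr sc//; exact: L2B.
rewrite mulr_sumr; apply: ler_sum => i _; rewrite -sc; last first.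
  by apply: L2B => //; apply: test_L2 => //; exact: test_derive.
rewrite scalerBr le_eqVlt; apply/orP; left; apply/eqP; congr (L2norm D (_ - _) ^+ 2).
by apply/funext => x; rewrite (deriveZ _ (@test_derivable R d D phi i x tphi)).
Qed.

Lemma H10D u v : H10 D u -> H10 D v -> H10 D (u + v).
Proof. by move=> [g hg] [k hk]; eexists; exact: H10_gradientD hg hk. Qed.

Lemma H10Z a u : H10 D u -> H10 D (a *: u).
Proof. by move=> [g hg]; eexists; exact: H10_gradientZ hg. Qed.

Lemma test_fun0 : test_fun D (0 : F).
Proof.
split; last by exists set0; split => //; exact: compact0.
elim=> [|k IH]; (split; first exact: cst_continuous) => // i; split.
  by move=> x; exact: derivable_cst.
rewrite (_ : (fun x => _) = 0); first exact: IH.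
by apply/funext => x; exact: derive_cst.
Qed.

Lemma H10_0 : H10 D 0.
Proof.
exists (fun=> 0); split=> //; do ?exact: L2_0.
  by move=> _; exact: L2_0.
  by move=> phi _ i; rewrite !ip0l oppr0.
move=> e e0; exists 0; split; first exact: test_fun0.
rewrite L2norm_sq subr0 ip0l add0r big1// => i _.
rewrite (_ : (fun x => _) = 0) ?subr0 ?L2norm_sq ?ip0l//.
by apply/funext => x; exact: derive_cst.
Qed.

Lemma H10_L2 u : H10 D u -> L2 D u.
Proof. by move=> [g []]. Qed.

Lemma H10_grad u : H10 D u -> H10_gradient D u (grad D u).
Proof. by move=> [g hg]; exact: (xgetI _ hg). Qed.

(** Used to pass to the limit along approximating test functions. *)
Lemma le_small_eq0 (x C : R) : 0 <= C -> (forall e, 0 < e -> x ^+ 2 <= C * e) -> x = 0.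
Proof.
move=> C0 h; apply/eqP; rewrite -sqrf_eq0; apply/eqP/le_anti; rewrite sqr_ge0 andbT.
apply/ler_addgt0Pr => e e0; rewrite add0r.
have C1 : 0 < C + 1 by lra.
apply: le_trans (h (e / (C + 1)) _) _; first by rewrite divr_gt0.
by rewrite mulrA ler_pdivrMr// mulrC ler_wpM2l ?ltW//; lra.
Qed.

(** Two weak gradients of u agree when tested with derivatives of test
    functions, and these approximate the components of the gradient of v. So
    the choice of gradient in [grad] does not affect [ip_grad]. *)
Lemma ip_grad_unique u g g' v k i : H10_gradient D u g -> H10_gradient D u g' ->
  H10_gradient D v k -> ip D (g i) (k i) = ip D (g' i) (k i).
Proof.
move=> [_ Lg wg _] [_ Lg' wg' _] [_ Lk _ ak].
apply/eqP; rewrite -subr_eq0 -ipBl//; apply/eqP.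
apply: (@le_small_eq0 _ (ip D (g i - g' i) (g i - g' i))); first exact: ip_ge0.
move=> e e0; have [phi [tphi hphi]] := ak _ e0.
pose p : F := fun x => 'D_(e_ R i) phi x.
have tp : test_fun D p := test_derive i tphi.
have Lp := test_L2 hD tp; have LB := L2B (Lg i) (Lg' i).
have -> : ip D (g i - g' i) (k i) = ip D (g i - g' i) (k i - p).
  rewrite ipBr// [ip D _ p](_ : _ = 0) ?subr0// ipBl//.
  have := wg _ tp i; rewrite -/p wg'// => /eqP; rewrite eqr_opp => /eqP ->.
  by rewrite subrr.
apply: le_trans (ip_CS LB (L2B (Lk i) Lp)) _; apply: ler_wpM2l; first exact: ip_ge0.
apply: ltW; apply: le_lt_trans hphi; rewrite (bigD1 i)//= addrCA -L2norm_sq lerDl.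
by rewrite addr_ge0 ?sqr_ge0 ?sumr_ge0// => j _; exact: sqr_ge0.
Qed.

Lemma ip_gradE u g v k : H10_gradient D u g -> H10_gradient D v k ->
  ip_grad D u v = \sum_i ip D (g i) (k i).
Proof.
move=> hg hk; apply: eq_bigr => i _.
have Hu : H10 D u by exists g. have Hv : H10 D v by exists k.
rewrite (ip_grad_unique i (H10_grad Hu) hg (H10_grad Hv)) ipC.
by rewrite (ip_grad_unique i (H10_grad Hv) hk hg) ipC.
Qed.

Lemma ip_gradC u v : ip_grad D u v = ip_grad D v u.
Proof. by apply: eq_bigr => i _; exact: ipC. Qed.

Lemma ip_gradDl u v w : H10 D u -> H10 D v -> H10 D w ->
  ip_grad D (u + v) w = ip_grad D u w + ip_grad D v w.
Proof.
move=> [g hg] [k hk] [l hl].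
rewrite (ip_gradE (H10_gradientD hg hk) hl) (ip_gradE hg hl) (ip_gradE hk hl).
have [_ Lg _ _] := hg; have [_ Lk _ _] := hk; have [_ Ll _ _] := hl.
by rewrite -big_split; apply: eq_bigr => i _; exact: ipDl.
Qed.

Lemma ip_gradZl a u w : H10 D u -> H10 D w ->
  ip_grad D (a *: u) w = a * ip_grad D u w.
Proof.
move=> [g hg] [l hl]; rewrite (ip_gradE (H10_gradientZ a hg) hl) (ip_gradE hg hl).
have [_ Lg _ _] := hg; have [_ Ll _ _] := hl.
by rewrite mulr_sumr; apply: eq_bigr => i _; exact: ipZl.
Qed.

Lemma ip_grad_ge0 u : 0 <= ip_grad D u u.
Proof. by apply: sumr_ge0 => i _; exact: ip_ge0. Qed.

Lemma H10norm_sq u : H10norm D u ^+ 2 = ip_grad D u u.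
Proof. by rewrite sqr_sqrtr// ip_grad_ge0. Qed.

(** Poincare's inequality in its qualitative form. If the gradient of v
    vanishes then (v, D_i (x_i phi)) = 0, that is (v, phi) = - (v, x_i D_i
    phi), for every test function phi. When phi approximates v in H^1, the
    left side tends to (v, v) and the right side to 0, since x_i is bounded
    on D and D_i phi tends to D_i v = 0. *)
Lemma ip_grad_eq0 v : (0 < d)%N -> H10 D v -> ip_grad D v v = 0 -> ip D v v = 0.
Proof.
move=> d0 Hv g0; pose i := Ordinal d0.
have [Lv Lg wg ag] := H10_grad Hv; set g := grad D v in Lg wg ag.
have gi0 : ip D (g i) (g i) = 0.
  apply/le_anti; rewrite ip_ge0 andbT -g0 /ip_grad (bigD1 i)//= lerDl.
  by apply: sumr_ge0 => j _; exact: ip_ge0.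
have [_ _ _ [M [_ hM]]] := hD.
pose B : R := `|M| + 1.
have B0 : 0 <= B by rewrite addr_ge0.
have hB x : D x -> `|x 0 i| <= B.
  move=> Dx; have := hM B _ x Dx; rewrite /B ltr_pwDr ?ler_norm// => /(_ isT) h.
  by apply: le_trans h; exact: coord_norm_le.
apply: (@le_small_eq0 _ (2 * ip D v v * (1 + 2 * B ^+ 2))).
  by rewrite !mulr_ge0 ?ip_ge0// addr_ge0// mulr_ge0// sqr_ge0.
move=> e e0; have [phi [tphi hphi]] := ag _ e0.
pose p : F := fun x => 'D_(e_ R i) phi x.
have tp : test_fun D p := test_derive i tphi.
have Lphi := test_L2 hD tphi; have Lp := test_L2 hD tp.
have Lxp := test_L2 hD (test_coord_mul i tp).
have h1 : ip D (v - phi) (v - phi) <= e.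
  rewrite -L2norm_sq; apply: le_trans (ltW hphi); rewrite lerDl.
  by apply: sumr_ge0 => j _; exact: sqr_ge0.
have h2 : ip D p p <= 2 * e.
  have h : ip D (g i - p) (g i - p) <= e.
    rewrite -L2norm_sq; apply: le_trans (ltW hphi); rewrite (bigD1 i)//= addrCA lerDl.
    by rewrite addr_ge0 ?sqr_ge0 ?sumr_ge0// => j _; exact: sqr_ge0.
  have Lgp := L2B (Lg i) Lp.
  have := L2norm_parallelogram (Lg i) (L2N Lgp).
  rewrite opprB addrC subrK !L2norm_sq gi0 mulr0 add0r => /le_trans; apply.
  rewrite ler_pM2l//; apply: le_trans h; rewrite -[p - g i]opprB -scaleN1r.
  by rewrite ipZl ?ipZr//; [rewrite mulrA mulrNN !mul1r|exact: L2Z].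
have h3 : ip D v phi = - ip D v (coord_mul i p).
  have := wg _ (test_coord_mul i tphi) i.
  have -> : ip D (g i) (coord_mul i phi) = 0.
    have := ip_CS (Lg i) (test_L2 hD (test_coord_mul i tphi)).
    rewrite gi0 mul0r => h; apply/eqP; rewrite -sqrf_eq0.
    by apply/eqP/le_anti; rewrite h sqr_ge0.
  have -> : (fun x => 'D_(e_ R i) (coord_mul i phi) x) = phi + coord_mul i p.
    apply/funext => x; have [_ ->] := derive_coord_mul i (@test_derivable R d D phi i x tphi).
    by rewrite eqxx mul1r.
  by rewrite ipDr// oppr0 => /eqP; rewrite addr_eq0 => /eqP.
have h4 : ip D (coord_mul i p) (coord_mul i p) <= B ^+ 2 * (2 * e).
  apply: (@le_trans _ _ (ip D (B *: p) (B *: p))); last first.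
    have LBp := L2Z B Lp.
    by rewrite ipZl// ipZr// mulrA -expr2 ler_wpM2l ?sqr_ge0.
  apply: ip_le => //; first exact: L2Z.
  move=> x Dx; rewrite -[coord_mul i p x]/(x 0 i * p x : R) -[(B *: p) x]/(B * p x : R) !normrM.
  by apply: ler_wpM2r => //; rewrite (ger0_norm B0) hB.
have h5 : ip D v v = ip D v (v - phi) - ip D v (coord_mul i p).
  by rewrite ipBr// -h3 subrK.
have := ip_CS Lv (L2B Lv Lphi); have := ip_CS Lv Lxp.
have := ip_ge0 v; move: h1 h4; rewrite [in ip D v v ^+ 2]h5.
set a := ip D v v; set b := ip D v (v - phi); set c := ip D v (coord_mul i p).
set b2 := ip D _ _; set c2 := ip D _ _ => h1 h4 a0 hc hb.
clearbody a b c b2 c2; clear -h1 h4 a0 hc hb e0 B0.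
have hb' : a * b2 <= a * e by rewrite ler_wpM2l.
have hc' : a * c2 <= a * (B ^+ 2 * (2 * e)) by rewrite ler_wpM2l.
have := sqr_ge0 (b + c); rewrite !expr2 in hc hb *; nra.
Qed.

End H10Space.

(** * The finite element space *)

Section OrthonormalBasis.
Context (R : rcfType) (V : lmodType R) (S : set V) (b : V -> V -> R).
Context (K : nat) (ev : V -> 'rV[R]_K).
Hypothesis S0 : S 0.
Hypothesis SD : forall u v, S u -> S v -> S (u + v).
Hypothesis SZ : forall a u, S u -> S (a *: u).
Hypothesis bC : forall u v, b u v = b v u.
Hypothesis bDl : forall u v w, S u -> S v -> S w -> b (u + v) w = b u w + b v w.
Hypothesis bZl : forall a u w, S u -> S w -> b (a *: u) w = a * b u w.
Hypothesis b_ge0 : forall u, 0 <= b u u.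
Hypothesis b_eq0 : forall u, S u -> b u u = 0 -> u = 0.
Hypothesis evD : forall u v, ev (u + v) = ev u + ev v.
Hypothesis evZ : forall a u, ev (a *: u) = a *: ev u.
Hypothesis ev_eq0 : forall u, S u -> ev u = 0 -> u = 0.

Definition orthonormal_in m (e : 'I_m -> V) :=
  (forall i, S (e i)) /\ forall i j, b (e i) (e j) = (i == j)%:R.

Lemma S_sum m (c : 'I_m -> R) (e : 'I_m -> V) : (forall i, S (e i)) ->
  S (\sum_i c i *: e i).
Proof. by move=> he; elim/big_ind: _ => // i _; exact: SZ. Qed.

Lemma b_suml m (c : 'I_m -> R) (e : 'I_m -> V) w : (forall i, S (e i)) -> S w ->
  b (\sum_i c i *: e i) w = \sum_i c i * b (e i) w.
Proof.
move=> he Sw.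
have b0 : b 0 w = 0 by rewrite -(scale0r 0) bZl// mul0r.
suff [] : S (\sum_i c i *: e i) /\ b (\sum_i c i *: e i) w = \sum_i c i * b (e i) w by [].
elim/big_rec2: _ => [|i y x _ [Sx hx]]; first by split.
by split; [apply: SD => //; exact: SZ|rewrite bDl ?bZl ?hx//; exact: SZ].
Qed.

Lemma b_orthonormal m (c : 'I_m -> R) (e : 'I_m -> V) j : orthonormal_in e ->
  b (\sum_i c i *: e i) (e j) = c j.
Proof.
move=> [he oe]; rewrite b_suml// (bigD1 j)//= oe eqxx mulr1 big1 ?addr0// => i ij.
by rewrite oe (negbTE ij) mulr0.
Qed.

(** An injective linear map into R^K sends an orthonormal family to linearly
    independent rows. *)
Lemma orthonormal_bound m (e : 'I_m -> V) : orthonormal_in e -> (m <= K)%N.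
Proof.
move=> oe; have [he _] := oe.
have : row_free (\matrix_i ev (e i)).
  apply: inj_row_free => c /rowP hc.
  have ev0 : ev 0 = 0 by rewrite -(scale0r 0) evZ scale0r.
  have evS : ev (\sum_i c 0 i *: e i) = 0.
    transitivity (\sum_i c 0 i *: ev (e i)).
      by elim/big_rec2: _ => // i y x _ <-; rewrite evD evZ.
    apply/rowP => j; rewrite -(hc j) mxE summxE; apply: eq_bigr => i _.
    by rewrite !mxE.
  have := ev_eq0 (S_sum _ he) evS => s0; apply/rowP => j.
  by rewrite -(b_orthonormal (c 0) j oe) s0 -(scale0r 0) bZl// mul0r mxE.
by move=> /eqP <-; exact: rank_leq_col.
Qed.

(** An orthonormal family of maximal size spans, since otherwise the
    normalized residual of some vector could be added to it. *)
Lemma orthonormal_basis : exists m (e : 'I_m -> V), orthonormal_in e /\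
  forall v, S v -> v = \sum_i b v (e i) *: e i.
Proof.
pose Q m := `[< exists e : 'I_m -> V, orthonormal_in e >].
have Q0 : exists m, Q m.
  by exists 0%N; apply/asboolP; exists (fun=> 0); split=> // -[].
have QK m : Q m -> (m <= K)%N by move=> /asboolP[e]; exact: orthonormal_bound.
case: (ex_maxnP Q0 QK) => m /asboolP[e oe] mmax; have [he ee] := oe.
exists m, e; split=> // v Sv.
pose r := v - \sum_i b v (e i) *: e i.
have Sr : S r by apply: SD => //; rewrite -scaleN1r; apply: SZ; exact: S_sum.
have re j : b r (e j) = 0.
  rewrite bDl//; last by rewrite -scaleN1r; apply: SZ; exact: S_sum.
  by rewrite -scaleN1r bZl ?b_orthonormal ?mulN1r ?subrr//; exact: S_sum.
apply/eqP; rewrite -subr_eq0 -/r; apply/negPn/negP => r0.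
have rr : b r r != 0 by apply: contra_neq r0; exact: b_eq0.
pose s := Num.sqrt (b r r).
have ss : s * s = b r r by rewrite -expr2 sqr_sqrtr.
have s0 : s != 0 by apply: contra_neq rr => s0; rewrite -ss s0 mulr0.
pose e' (i : 'I_m.+1) := if unlift ord0 i is Some j then e j else s^-1 *: r.
suff /mmax : Q m.+1 by rewrite ltnn.
apply/asboolP; exists e'; split=> [i|i j].
  by rewrite /e'; case: unliftP => // _; exact: SZ.
rewrite /e'; case: (unliftP ord0 i) => [i' ->|->]; case: (unliftP ord0 j) => [j' ->|->].
- by rewrite ee (inj_eq lift_inj).
- by rewrite bC bZl// re mulr0.
- by rewrite bZl// re mulr0.
rewrite (bZl _ Sr (SZ _ Sr)) bC (bZl _ Sr Sr) -ss eqxx.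
by rewrite mulKf// mulVf.
Qed.

End OrthonormalBasis.

Section FiniteElementSpace.
Context (R : realType) (d : nat) (D : set 'rV[R]_d) (h kappa : R).
Context (Th : set (simplex R d)).
Hypothesis hD : bounded_domain D.
Hypothesis d0 : (0 < d)%N.
Hypothesis hTh : triangulation D h kappa Th.
Local Notation F := (funRd R d).
Local Notation mu := (@lebesgue_rV R d : set (borel_rV R d) -> \bar R).
Implicit Types u v w : F.
Local Notation V_h := (Vh D Th).

Lemma Vh_H10 v : V_h v -> H10 D v. Proof. by case. Qed.

Lemma Vh_L2 v : V_h v -> L2 D v. Proof. by move=> /Vh_H10; exact: H10_L2. Qed.

Lemma Vh0 : V_h 0.
Proof.
split=> //; first exact: H10_0.
- exact: cst_continuous.
move=> s _; exists 0, 0 => x _; by rewrite mulmx0 mxE addr0.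
Qed.

Lemma VhD u v : V_h u -> V_h v -> V_h (u + v).
Proof.
move=> [Hu cu au zu] [Hv cv av zv]; split.
- exact: H10D.
- by move=> x; exact: (continuousD (cu x) (cv x)).
- move=> s Ts; have [a [c ha]] := au s Ts; have [a' [c' ha']] := av s Ts.
  exists (a + a'), (c + c') => x hx; rewrite -[LHS]/(u x + v x : R) ha// ha'//.
  by rewrite mulmxDr [in RHS]mxE addrACA.
move=> x hx; by rewrite -[LHS]/(u x + v x : R) zu// zv// addr0.
Qed.

Lemma VhZ a u : V_h u -> V_h (a *: u).
Proof.
move=> [Hu cu au zu]; split.
- exact: H10Z.
- by move=> x; exact: (cvgZl_tmp (k := a) (cu x)).
- move=> s Ts; have [b [c ha]] := au s Ts.
  exists (a *: b), (a * c) => x hx; rewrite -[LHS]/(a * u x : R) ha//.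
  by rewrite -scalemxAr [in RHS]mxE mulrDr.
move=> x hx; by rewrite -[LHS]/(a * u x : R) zu// mulr0.
Qed.

(** A continuous function of zero L2 norm vanishes on D because open sets
    have positive measure, on the elements because they lie in the closure
    of D, and elsewhere by the definition of [Vh]. *)
Lemma Vh_eq0 v : V_h v -> ip D v v = 0 -> v = 0.
Proof.
move=> Vv v0; have [Hv cv av zv] := Vv; have [oD _ _ _] := hD.
pose N0 : set 'rV[R]_d := [set x | v x != 0].
have oN : open N0.
  have o0 : open ([set y | y != 0] : set R^o) by exact: open_neq.
  exact: (open_comp (fun x _ => cv x) o0).
have oDN : open (D `&` N0) by exact: openI.
have vD x : D x -> v x = 0.
  move=> Dx; apply/eqP/negPn/negP => vx.
  have : (0 < mu (D `&` N0))%E by apply: lebesgue_rV_open_gt0 => //; exists x.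
  have /negligibleP : mu.-negligible (D `&` N0).
    have := ip_ae0 hD (Vh_L2 Vv) v0; apply: negligibleS => y [Dy Ny] /= H.
    by move: Ny; rewrite /N0 /= H// eqxx.
  move=> /(_ _) ->; rewrite ?ltxx//; exact: open_borel.
have vcD x : closure D x -> v x = 0.
  move=> cDx; apply/eqP/negPn/negP => vx.
  have [y [Dy]] := cDx N0 (open_nbhs_nbhs (conj oN vx)).
  by rewrite /N0 /= vD ?eqxx.
apply/funext => x; have [[s Ts hs]|H] := pselect (exists2 s, Th s & hull s setT x).
  by apply: vcD; exact: (tri_inside hTh Ts).
by apply: zv => s Ts hs; apply: H; exists s.
Qed.

(** An affine function on a simplex is determined by its values at the
    vertices. *)
Lemma Vh_nodal v : V_h v -> (forall s i, Th s -> v (s i) = 0) -> v = 0.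
Proof.
move=> [Hv cv av zv] hn; apply/funext => x.
have [[s Ts hs]|H] := pselect (exists2 s, Th s & hull s setT x); last first.
  by apply: zv => s Ts hs; apply: H; exists s.
have [a [c hac]] := av s Ts; rewrite hac//.
have hi i : (s i *m a) 0 0 + c = 0.
  rewrite -hac ?hn//; exists (fun j => (j == i)%:R); split=> //.
  - by move=> j [].
  - by rewrite (bigD1 i)//= eqxx big1 ?addr0// => k /negbTE ->.
  by rewrite (bigD1 i)//= eqxx scale1r big1 ?addr0// => k /negbTE ->; rewrite scale0r.
have [w [_ _ w1 ->]] := hs.
rewrite mulmx_suml summxE -[c]mul1r -w1 mulr_suml -big_split big1// => i _ /=.
by rewrite -scalemxAl mxE -mulrDr hi mulr0.
Qed.

(** The values at the vertices of the finitely many elements; it serves to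
    show that [Vh] is finite dimensional. *)
Definition nodal (s : seq (simplex R d)) (v : F) : 'rV[R]_(size s * d.+1) :=
  mxvec (\matrix_(i < size s, j < d.+1) v (nth (fun=> 0) s i j)).

Lemma Vh_basis : exists m (e : 'I_m -> F), [/\ forall i, V_h (e i),
  forall i j, ip D (e i) (e j) = (i == j)%:R &
  forall v, V_h v -> v = \sum_i ip D v (e i) *: e i].
Proof.
have /finite_seqP[s hs] := tri_finite hTh.
have [|||||||||||m [e [[h1 h2] h3]]] := @orthonormal_basis R F V_h (ip D) _ (nodal s).
- exact: Vh0.
- exact: VhD.
- exact: VhZ.
- exact: ipC.
- by move=> u v w Vu Vv Vw; apply: (ipDl hD); exact: Vh_L2.
- by move=> a u w Vu Vw; apply: (ipZl hD); exact: Vh_L2.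
- exact: ip_ge0.
- exact: Vh_eq0.
- move=> u v; rewrite /nodal -linearD; congr mxvec; by apply/matrixP => i j; rewrite !mxE.
- move=> a u; rewrite /nodal -linearZ; congr mxvec; by apply/matrixP => i j; rewrite !mxE.
- move=> u Vu /(canRL mxvecK); rewrite linear0 => /matrixP h0; apply: Vh_nodal => // t i.
  rewrite hs /= => ts; have ti : (index t s < size s)%N by rewrite index_mem.
  by have := h0 (Ordinal ti) i; rewrite !mxE /= nth_index.
by exists m, e.
Qed.

End FiniteElementSpace.

(** * Coordinates in an orthonormal basis *)

(** What the rest of the argument uses of the finite element space: an
    L2-orthonormal basis of [Vh]. *)
Record vh_frame (R : realType) (d : nat) (D : set 'rV[R]_d) (Th : set (simplex R d))
    (m : nat) (e : 'I_m -> funRd R d) : Prop := {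
  frame_dom : bounded_domain D;
  frame_dim : (0 < d)%N;
  frame_in : forall i, Vh D Th (e i);
  frame_on : forall i j, ip D (e i) (e j) = (i == j)%:R;
  frame_span : forall v, Vh D Th v -> v = \sum_i ip D v (e i) *: e i;
  frame_eq0 : forall v, Vh D Th v -> ip D v v = 0 -> v = 0 }.

Section Coordinates.
Context (R : realType) (d : nat) (D : set 'rV[R]_d).
Context (Th : set (simplex R d)).
Local Notation F := (funRd R d).
Local Notation V_h := (Vh D Th).
Context (m : nat) (e : 'I_m -> F).
Hypothesis fr : vh_frame D Th e.
Let hD := frame_dom fr.
Let d0 := frame_dim fr.
Let Ve := frame_in fr.
Let ee := frame_on fr.
Let V_span := frame_span fr.
Let V_h_eq0 := frame_eq0 fr.
Implicit Types u v w : F.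

Definition co v : 'rV[R]_m := \row_j ip D v (e j).
Definition syn (c : 'rV[R]_m) : F := \sum_i c 0 i *: e i.
Definition dot n (a b : 'rV[R]_n) : R := \sum_j a 0 j * b 0 j.

Lemma Vh_syn c : V_h (syn c).
Proof.
rewrite /syn; elim/big_ind: _ => [|u v|i _]; [exact: Vh0|exact: VhD|].
by apply: VhZ => //; exact: Ve.
Qed.

Lemma coK v : V_h v -> syn (co v) = v.
Proof. by move=> Vv; rewrite [RHS]V_span//; apply: eq_bigr => i _; rewrite mxE. Qed.

Let eL2 i : L2 D (e i). Proof. exact: (Vh_L2 (Ve i)). Qed.

Lemma ip_synl c w : L2 D w -> ip D (syn c) w = \sum_i c 0 i * ip D (e i) w.
Proof.
move=> Lw.
suff [] : L2 D (syn c) /\ ip D (syn c) w = \sum_i c 0 i * ip D (e i) w by [].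
rewrite /syn; elim/big_rec2: _ => [|i y x _ [Lx hx]].
  by split; [exact: L2_0|exact: ip0l].
have LZ : L2 D (c 0 i *: e i) by exact: L2Z.
split; first exact: L2D.
by rewrite (ipDl hD LZ Lx Lw) (ipZl hD _ (eL2 i) Lw) hx.
Qed.

Lemma ip_grad_synl c w : H10 D w ->
  ip_grad D (syn c) w = \sum_i c 0 i * ip_grad D (e i) w.
Proof.
move=> Hw.
have He i : H10 D (e i) by exact: (Vh_H10 (Ve i)).
have g0 : ip_grad D 0 w = 0.
  by rewrite -(scale0r (0 : F)) (ip_gradZl hD 0 (H10_0 D) Hw) mul0r.
suff [] : H10 D (syn c) /\ ip_grad D (syn c) w = \sum_i c 0 i * ip_grad D (e i) w by [].
rewrite /syn; elim/big_rec2: _ => [|i y x _ [Lx hx]].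
  by split => //; exact: H10_0.
have LZ : H10 D (c 0 i *: e i) by exact: H10Z.
split; first exact: H10D.
by rewrite (ip_gradDl hD LZ Lx Hw) (ip_gradZl hD _ (He i) Hw) hx.
Qed.

Lemma synK c : co (syn c) = c.
Proof.
apply/rowP => j; rewrite mxE ip_synl// (bigD1 j)//= ee eqxx mulr1 big1 ?addr0//.
by move=> i ij; rewrite ee (negbTE ij) mulr0.
Qed.

Lemma coD u v : V_h u -> V_h v -> co (u + v) = co u + co v.
Proof.
move=> Vu Vv; apply/rowP => j; rewrite !mxE.
exact: (ipDl hD (Vh_L2 Vu) (Vh_L2 Vv) (eL2 j)).
Qed.

Lemma coZ a u : V_h u -> co (a *: u) = a *: co u.
Proof.
move=> Vu; apply/rowP => j; rewrite !mxE.
exact: (ipZl hD a (Vh_L2 Vu) (eL2 j)).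
Qed.

Lemma VhB u v : V_h u -> V_h v -> V_h (u - v).
Proof. by move=> Vu Vv; rewrite -scaleN1r; apply: VhD => //; exact: VhZ. Qed.

Lemma coB u v : V_h u -> V_h v -> co (u - v) = co u - co v.
Proof.
move=> Vu Vv; rewrite -scaleN1r coD//; last exact: VhZ.
by rewrite coZ// scaleN1r.
Qed.

Lemma co_inj u v : V_h u -> V_h v -> co u = co v -> u = v.
Proof. by move=> Vu Vv h; rewrite -(coK Vu) -(coK Vv) h. Qed.

Lemma ip_co u v : V_h u -> V_h v -> ip D u v = dot (co u) (co v).
Proof.
move=> Vu Vv; rewrite -{1}(coK Vu) ip_synl; last exact: Vh_L2 Vv.
by apply: eq_bigr => i _; rewrite [co v 0 i]mxE [in RHS]ipC.
Qed.

Lemma L2norm_co u : V_h u -> L2norm D u ^+ 2 = dot (co u) (co u).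
Proof. by move=> Vu; rewrite L2norm_sq ip_co. Qed.

Definition stiff : 'M[R]_m := \matrix_(i, j) ip_grad D (e i) (e j).

Lemma stiff_sym : stiff^T = stiff.
Proof. by apply/matrixP => i j; rewrite !mxE ip_gradC. Qed.

Lemma stiffE c : c *m stiff = \row_j ip_grad D (syn c) (e j).
Proof.
apply/rowP => j; rewrite !mxE ip_grad_synl; last exact: Vh_H10.
by apply: eq_bigr => i _; rewrite mxE.
Qed.

Lemma ip_grad_syn c v : V_h v -> ip_grad D (syn c) v = dot (c *m stiff) (co v).
Proof.
move=> Vv; rewrite ip_gradC -{1}(coK Vv) ip_grad_synl; last exact: Vh_H10 (Vh_syn c).
by apply: eq_bigr => i _; rewrite stiffE [in RHS]mxE mulrC ip_gradC.
Qed.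

Lemma stiff_ge0 c : 0 <= dot (c *m stiff) c.
Proof. by rewrite -{2}(synK c) -ip_grad_syn ?ip_grad_ge0//; exact: Vh_syn. Qed.

(** The gradient form is definite on [Vh]. *)
Lemma stiff_unit : stiff \in unitmx.
Proof.
rewrite -row_free_unit; apply: inj_row_free => c hc.
have Vc := Vh_syn c.
have : ip_grad D (syn c) (syn c) = 0.
  by rewrite ip_grad_syn// hc /dot big1// => i _; rewrite mxE mul0r.
move=> /(ip_grad_eq0 hD d0 (Vh_H10 Vc)) /(V_h_eq0 Vc) s0.
by rewrite -(synK c) s0; apply/rowP => j; rewrite !mxE; exact: ip0l.
Qed.

(** The defining equations of the Ritz projection, tested with the basis,
    are a linear system with the stiffness matrix; uniqueness shows that the
    chosen solution has these coordinates. *)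
Lemma ritz_spec u : H10 D u -> V_h (ritz D Th u) /\
  co (ritz D Th u) = (\row_j ip_grad D u (e j)) *m invmx stiff.
Proof.
move=> Hu; pose r := \row_j ip_grad D u (e j).
have He j : H10 D (e j) by exact: Vh_H10 (Ve j).
pose w := syn (r *m invmx stiff).
have Vw : V_h w by exact: Vh_syn.
have gw v : V_h v -> ip_grad D w v = ip_grad D u v.
  move=> Vv; rewrite ip_grad_syn// mulmxKV ?stiff_unit//.
  rewrite (ip_gradC D u) -{2}(coK Vv) ip_grad_synl//.
  by apply: eq_bigr => i _; rewrite mxE mulrC ip_gradC.
have gB a v : H10 D a -> H10 D v -> ip_grad D (a - u) v = ip_grad D a v - ip_grad D u v.
  move=> Ha Hv; rewrite -scaleN1r (ip_gradDl hD Ha (H10Z hD _ Hu) Hv).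
  by rewrite (ip_gradZl hD _ Hu Hv) mulN1r.
have : [set w | V_h w /\ forall phi, V_h phi -> ip_grad D (w - u) phi = 0] w.
  by split=> // phi Vp; rewrite (gB w phi (Vh_H10 Vw) (Vh_H10 Vp)) gw// subrr.
move=> /(xgetI (0 : F)); rewrite -/(ritz D Th u) => -[Vr hr]; split=> //.
rewrite -[LHS](mulmxK stiff_unit); congr (_ *m _).
rewrite stiffE (coK Vr); apply/rowP => j; rewrite [LHS]mxE [RHS]mxE; apply/eqP.
by rewrite -subr_eq0 -(gB _ _ (Vh_H10 Vr) (He j)); apply/eqP; exact: hr.
Qed.

Lemma laplace_spec v : V_h v -> V_h (laplace_h D Th v) /\
  co (laplace_h D Th v) = - (co v *m stiff).
Proof.
move=> Vv; pose w := syn (- (co v *m stiff)).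
have Vw : V_h w by exact: Vh_syn.
have : [set eta | V_h eta /\ forall phi, V_h phi -> ip D eta phi = - ip_grad D v phi] w.
  split=> // phi Vp; rewrite ip_co// synK -[in RHS](coK Vv) ip_grad_syn//.
  by rewrite /dot -sumrN; apply: eq_bigr => i _; rewrite mxE mulNr.
move=> /(xgetI (0 : F)); rewrite -/(laplace_h D Th v) => -[Vr hr]; split=> //.
by apply/rowP => j; rewrite stiffE coK// !mxE hr.
Qed.

End Coordinates.

(** * Conditional expectation on a generated sigma-algebra *)

Import HBNNSimple.

Section Restriction.
Context (R : realType) (dd : measure_display) (Om : measurableType dd).
Context (C : set (set Om)) (hC : <<s C >> `<=` (measurable : set (set Om))).
Local Notation GT := (g_sigma_algebraType C).

(** [P] and a charge seen on the smaller sigma-algebra generated by [C]; the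
    proof [hC] is an argument so that instances can be attached to the names. *)
Definition restr_prob (h : <<s C >> `<=` (measurable : set (set Om)))
  (P : probability Om R) : set GT -> \bar R := P.
Definition restr_charge (h : <<s C >> `<=` (measurable : set (set Om)))
  (nu : {charge set Om -> \bar R}) : set GT -> \bar R := nu.

Variables (P : probability Om R) (nu : {charge set Om -> \bar R}).

Let restr_prob_sigma_additive : semi_sigma_additive (restr_prob hC P).
Proof.
move=> F mF tF mUF; apply: (@measure_semi_sigma_additive _ _ _ P) => //.
- by move=> n; apply: hC; exact: mF.
- by apply: hC; exact: mUF.
Qed.

HB.instance Definition _ := isMeasure.Build _ _ _ (restr_prob hC P)
  (measure0 P) (measure_ge0 P) restr_prob_sigma_additive.
HB.instance Definition _ := @Measure_isProbability.Build _ _ _ (restr_prob hC P)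
  (probability_setT P).

Let restr_charge_fin A : measurable A -> restr_charge hC nu A \is a fin_num.
Proof. by move=> mA; apply: (@fin_num_measure _ _ _ nu); exact: hC. Qed.

Let restr_charge_sigma_additive : semi_sigma_additive (restr_charge hC nu).
Proof.
move=> F mF tF mUF; apply: (@charge_semi_sigma_additive _ _ _ nu) => //.
- by move=> n; apply: hC; exact: mF.
- by apply: hC; exact: mUF.
Qed.

HB.instance Definition _ := isCharge.Build _ _ _ (restr_charge hC nu)
  (charge0 nu) restr_charge_fin restr_charge_sigma_additive.

Lemma restr_probE : restr_prob hC P = pushforward P (idfun : Om -> GT).
Proof. by apply/funext. Qed.

Lemma measurable_idfun : measurable_fun setT (idfun : Om -> GT).
Proof. by move=> _ A mA; rewrite setTI; exact: hC. Qed.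

End Restriction.

Section SubSigmaAlgebra.
Context (R : realType) (dd : measure_display) (Om : measurableType dd).
Context (P : probability Om R).

(** Measurability with respect to a sub-sigma-algebra, for functions on the
    ambient space. *)
Definition Gmeas (G : set (set Om)) (f : Om -> R) :=
  forall B : set R, measurable B -> G (f @^-1` B).

Definition L2G (G : set (set Om)) (f : Om -> R) :=
  Gmeas G f /\ (\int[P]_w (f w ^+ 2)%:E < +oo)%E.

Context (C : set (set Om)).
Local Notation G := <<s C >>.
Hypothesis hG : G `<=` measurable.
Local Notation GT := (g_sigma_algebraType C).

Lemma GmeasP f : Gmeas G f <-> measurable_fun setT (f : GT -> R).
Proof.
split=> [h _ B mB|h B mB]; first by rewrite setTI; exact: h.
by rewrite -[X in G X]setTI; exact: h.
Qed.

Lemma Gmeas_measurable f : Gmeas G f -> measurable_fun setT f.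
Proof. by move=> h _ B mB; rewrite setTI; apply: hG; exact: h. Qed.

Lemma L2G_sqint f : L2G G f -> sqint P setT f.
Proof. by move=> [h I]; split=> //; exact: Gmeas_measurable. Qed.

Lemma nnsfun_Gmeas (f : {nnsfun GT >-> R}) : Gmeas G f.
Proof. by apply/GmeasP; exact: measurable_funPT. Qed.

(** Reduces the weighted integral with a simple weight to integrals over
    events of the sub-sigma-algebra. *)
Lemma nnsfun_integral_weight (f : {nnsfun GT >-> R}) (g : Om -> R)
    (s := finmap.enum_fset (fset_set (range (f : GT -> R)))) :
  measurable_fun setT g -> (forall w, 0 <= g w) ->
  (\int[P]_w (f w * g w)%:E = \sum_(i < size s)
     (s`_i)%:E * \int[P]_(w in f @^-1` [set s`_i]) (g w)%:E)%E.
Proof.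
move=> mg g0.
have mA (y : R) : measurable (f @^-1` [set y] : set Om).
  by apply: hG; apply: nnsfun_Gmeas; exact: measurable_set1.
have s0 (i : 'I_(size s)) : 0 <= s`_i.
  have : s`_i \in s by rewrite mem_nth.
  by rewrite in_fset_set// inE => -[w _ <-].
transitivity (\int[P]_w \sum_(i < size s) ((s`_i)%:E * (\1_(f @^-1` [set s`_i]) w * g w)%:E))%E.
  apply: eq_integral => w _; rewrite fimfunEord mulr_suml -sumEFin.
  by apply: eq_bigr => i _; rewrite -EFinM mulrA.
rewrite ge0_integral_sum//; last 2 first.
- move=> i; apply/measurable_EFinP; apply: measurable_funM => //.
  by apply: measurable_funM => //; exact: measurable_indic.
- by move=> i w _; rewrite -EFinM lee_fin !mulr_ge0.
apply: eq_bigr => i _; rewrite ge0_integralZl//; last 3 first.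
- apply/measurable_EFinP; apply: measurable_funM => //; exact: measurable_indic.
- by move=> w _; rewrite lee_fin mulr_ge0.
- by rewrite lee_fin.
congr (_ * _)%E; rewrite [RHS]integral_mkcond; apply: eq_integral => w _.
rewrite patchE indicE; case: ifPn => _; by rewrite ?mul1r ?mul0r.
Qed.

(** For simple G-measurable weights this is the hypothesis on events;
    nonnegative weights are increasing limits of those. *)
Lemma ge0_integral_weight (f g1 g2 : Om -> R) : Gmeas G f -> (forall w, 0 <= f w) ->
  measurable_fun setT g1 -> (forall w, 0 <= g1 w) ->
  measurable_fun setT g2 -> (forall w, 0 <= g2 w) ->
  (forall A, G A -> \int[P]_(w in A) (g1 w)%:E = \int[P]_(w in A) (g2 w)%:E)%E ->
  (\int[P]_w (f w * g1 w)%:E = \int[P]_w (f w * g2 w)%:E)%E.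
Proof.
move=> /GmeasP mf f0 mg1 g10 mg2 g20 H.
have mf' : measurable_fun setT (EFin \o f : GT -> \bar R) by exact/measurable_EFinP.
pose fn := nnsfun_approx measurableT mf'.
have lim (g : Om -> R) : measurable_fun setT g -> (forall w, 0 <= g w) ->
    (\int[P]_w (f w * g w)%:E = limn (fun n => \int[P]_w (fn n w * g w)%:E))%E.
  move=> mg g0; rewrite -monotone_convergence//; last 3 first.
  - move=> n; apply/measurable_EFinP; apply: measurable_funM => //.
    apply: Gmeas_measurable; apply/GmeasP; exact: measurable_funPT.
  - by move=> n w _; rewrite lee_fin mulr_ge0.
  - move=> w _ a b ab; rewrite lee_fin ler_wpM2r//.
    by have /lefP := nd_nnsfun_approx measurableT mf' ab; exact.
  apply: eq_integral => w _; apply/esym/cvg_lim => //.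
  under eq_fun do rewrite EFinM.
  rewrite EFinM; apply: cvgeZr => //.
  apply: (cvg_nnsfun_approx measurableT mf') => // x _; rewrite lee_fin; exact: f0.
rewrite !lim//; congr (limn _); apply/funext => n.
rewrite !nnsfun_integral_weight//; apply: eq_bigr => i _; rewrite H//.
by apply: nnsfun_Gmeas; exact: measurable_set1.
Qed.

(** Reduced to [ge0_integral_weight] by adding the same integrable function
    to both sides: b = |g1| + |g2| makes the functions nonnegative, and the
    weight f is treated as the difference of f + |f| and |f|. *)
Lemma integral_weight (f g1 g2 : Om -> R) : Gmeas G f ->
  P.-integrable setT (EFin \o g1) -> P.-integrable setT (EFin \o g2) ->
  P.-integrable setT (fun w => (f w * g1 w)%:E) ->
  P.-integrable setT (fun w => (f w * g2 w)%:E) ->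
  (forall A, G A -> \int[P]_(w in A) (g1 w)%:E = \int[P]_(w in A) (g2 w)%:E)%E ->
  (\int[P]_w (f w * g1 w)%:E = \int[P]_w (f w * g2 w)%:E)%E.
Proof.
move=> Gf i1 i2 if1 if2 H.
have mR (u : Om -> R) A : P.-integrable A (EFin \o u) -> measurable_fun A u.
  by move=> iu; apply/measurable_EFinP; exact: measurable_int iu.
have norm (u v : Om -> R) : P.-integrable setT (EFin \o u) -> measurable_fun setT v ->
    (forall w, `|v w| = `|u w|) -> P.-integrable setT (EFin \o v).
  move=> iu mv uv; apply: (le_integrable measurableT) iu => //.
    exact/measurable_EFinP.
  by move=> w _; rewrite /= uv.
have iD A (u v : Om -> R) : P.-integrable A (EFin \o u) -> P.-integrable A (EFin \o v) ->
    measurable A -> P.-integrable A (fun w => (u w + v w)%:E).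
  by move=> iu iv mA; exact: (integrableD mA iu iv).
have intD A (u v : Om -> R) : P.-integrable A (EFin \o u) -> P.-integrable A (EFin \o v) ->
    measurable A -> (\int[P]_(w in A) (u w + v w)%:E =
      \int[P]_(w in A) (u w)%:E + \int[P]_(w in A) (v w)%:E)%E.
  by move=> iu iv mA; exact: (integralD mA iu iv).
have cancel (u v b : Om -> R) : P.-integrable setT (EFin \o u) -> P.-integrable setT (EFin \o v) ->
    P.-integrable setT (EFin \o b) ->
    (\int[P]_w (u w + b w)%:E = \int[P]_w (v w + b w)%:E)%E ->
    (\int[P]_w (u w)%:E = \int[P]_w (v w)%:E)%E.
  move=> iu iv ib; rewrite !intD// => E.
  have fb : (\int[P]_w (b w)%:E)%E \is a fin_num by exact: integrable_fin_num ib.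
  by rewrite -[LHS](addeK _ fb) E addeK.
have mn (u : Om -> R) : measurable_fun setT u -> measurable_fun setT (fun w => `|u w|).
  by move=> mu; exact: measurableT_comp.
have m1 := mR _ _ i1; have m2 := mR _ _ i2.
(* nonnegative weights: shift both functions by b to make them nonnegative *)
have key (a : Om -> R) : Gmeas G a -> (forall w, 0 <= a w) ->
    P.-integrable setT (EFin \o (fun w => a w * g1 w)) ->
    P.-integrable setT (EFin \o (fun w => a w * g2 w)) ->
    (\int[P]_w (a w * g1 w)%:E = \int[P]_w (a w * g2 w)%:E)%E.
  move=> Ga a0 ia1 ia2; pose b : Om -> R := fun w => `|g1 w| + `|g2 w|.
  have ma := Gmeas_measurable Ga.
  have in1 := norm _ _ i1 (mn _ m1) (fun w => normr_id _).
  have in2 := norm _ _ i2 (mn _ m2) (fun w => normr_id _).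
  have ib : P.-integrable setT (EFin \o b) := iD _ _ _ in1 in2 measurableT.
  have j (g : Om -> R) : measurable_fun setT g -> P.-integrable setT (EFin \o (fun w => a w * g w)) ->
      P.-integrable setT (EFin \o (fun w => a w * `|g w|)).
    move=> mg iag; apply: norm iag _ _; first by apply: measurable_funM => //; exact: mn.
    by move=> w; rewrite !normrM normr_id.
  have iab : P.-integrable setT (EFin \o (fun w => a w * b w)).
    have := iD _ _ _ (j _ m1 ia1) (j _ m2 ia2) measurableT.
    by congr (_.-integrable _ _); apply/funext => w; rewrite /= mulrDr.
  apply: (cancel _ _ _ ia1 ia2 iab).
  under eq_integral => w _ do rewrite -mulrDr.
  under [RHS]eq_integral => w _ do rewrite -mulrDr.
  have mb := mR _ _ ib.
  apply: ge0_integral_weight => //; try exact: measurable_funD.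
  - move=> w; have := ler_norm (- g1 w); have := normr_ge0 (g2 w); rewrite normrN /b.
    by move: `|g1 w| `|g2 w| (g1 w) => x y z; lra.
  - move=> w; have := ler_norm (- g2 w); have := normr_ge0 (g1 w); rewrite normrN /b.
    by move: `|g1 w| `|g2 w| (g2 w) => x y z; lra.
  move=> A GA; have mA := hG GA.
  have r u : P.-integrable setT (EFin \o u) -> P.-integrable A (EFin \o u) by exact: integrableS.
  by rewrite !intD ?H//; exact: r.
have mf := Gmeas_measurable Gf; have nf := mn _ mf.
have Gn : Gmeas G (fun w => `|f w|).
  by apply/GmeasP; apply: measurableT_comp => //; exact/GmeasP.
have i_n (g : Om -> R) : measurable_fun setT g -> P.-integrable setT (fun w => (f w * g w)%:E) ->
    P.-integrable setT (EFin \o (fun w => `|f w| * g w)).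
  move=> mg ifg; apply: norm ifg _ _; first exact: measurable_funM.
  by move=> w; rewrite !normrM normr_id.
have k1 := i_n _ m1 if1; have k2 := i_n _ m2 if2.
(* f is the difference of the nonnegative weights f + |f| and |f| *)
apply: (cancel (fun w => f w * g1 w) (fun w => f w * g2 w) (fun w => `|f w| * g2 w)) => //.
rewrite [RHS](eq_integral (fun w => ((f w + `|f w|) * g2 w)%:E)); last first.
  by move=> w _; rewrite mulrDl.
rewrite -(key (fun w => f w + `|f w|)).
- under [RHS]eq_integral => w _ do rewrite mulrDl.
  rewrite !intD//; congr (_ + _)%E; apply/esym/key => //.
- by apply/GmeasP; apply: measurable_funD; exact/GmeasP.
- by move=> w; have := ler_norm (- f w); rewrite normrN -subr_ge0 opprK addrC.
- have := iD _ _ _ if1 k1 measurableT; congr (_.-integrable _ _).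
  by apply/funext => w; rewrite /= mulrDl.
- have := iD _ _ _ if2 k2 measurableT; congr (_.-integrable _ _).
  by apply/funext => w; rewrite /= mulrDl.
Qed.

(** Conditional expectation as a Radon-Nikodym density on the
    sub-sigma-algebra. *)
Lemma cond_density (Z : Om -> R) : P.-integrable setT (EFin \o Z) ->
  exists zeta : Om -> R, [/\ Gmeas G zeta, P.-integrable setT (EFin \o zeta) &
    forall A, G A -> (\int[P]_(w in A) (zeta w)%:E = \int[P]_(w in A) (Z w)%:E)%E].
Proof.
move=> iZ; pose nu : {charge set Om -> \bar R} := induced_charge iZ.
pose PG : probability GT R := restr_prob hG P.
pose nG : {charge set GT -> \bar R} := restr_charge hG nu.
have dom : nG `<< PG.
  apply/null_content_dominatesP => A mA A0.
  rewrite -[nG A]/(\int[P]_(w in A) (Z w)%:E)%E.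
  apply: null_set_integral; [exact: hG| |exact: A0].
  apply: measurable_funTS; exact: measurable_int iZ.
have mid := measurable_idfun hG.
pose f : GT -> R := fun w => fine ((Radon_Nikodym nG PG : GT -> \bar R) w).
have fE w : (f w)%:E = (Radon_Nikodym nG PG : GT -> \bar R) w.
  by rewrite fineK//; exact: Radon_Nikodym_fin_num.
have iF : PG.-integrable setT (EFin \o f).
  rewrite (_ : _ \o _ = Radon_Nikodym nG PG); first exact: Radon_Nikodym_integrable.
  by apply/funext => w; rewrite -fE.
have mf : measurable_fun setT f by apply/measurable_EFinP; exact: measurable_int iF.
have iP : P.-integrable setT (EFin \o (f : Om -> R)).
  apply/integrableP; split.
    by apply/measurable_EFinP; apply: Gmeas_measurable; exact/GmeasP.
  have /integrableP[_] := iF.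
  rewrite -[PG : set GT -> \bar R]/(restr_prob hG P) restr_probE.
  rewrite (ge0_integral_pushforward mid)//.
  by apply/measurable_EFinP; apply: measurableT_comp.
exists f; split=> // [|A GA]; first exact/GmeasP.
have mA : measurable (A : set GT) by [].
have E : (\int[PG]_(w in A) (f w)%:E = \int[P]_(w in A) (f w)%:E)%E.
  transitivity (\int[pushforward P (idfun : Om -> GT)]_(w in A) (f w)%:E)%E.
    by rewrite -(restr_probE hG).
  rewrite (integral_pushforward mid)//; first exact/measurable_EFinP.
  by apply: (integrableS measurableT) iP => //; exact: hG.
rewrite -E -[RHS]/(nG A) (Radon_Nikodym_integral dom mA).
by apply: eq_integral => w _; rewrite fE.
Qed.

(** E (h^2 eta^2) = c E eta^2: the weight h^2 integrates like the constant c
    over the events of G, hence also against eta^2. *)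
Lemma sq_weight (h : Om -> R) (c : R) eta : measurable_fun setT h -> 0 <= c ->
  (forall A, G A -> \int[P]_(w in A) (h w ^+ 2)%:E = c%:E * P A)%E ->
  L2G G eta -> sqint P setT (fun w => h w * eta w) /\
  ipr P setT (fun w => h w * eta w) (fun w => h w * eta w) = c * ipr P setT eta eta.
Proof.
move=> mh c0 hh Leta; have [Geta Ieta] := Leta.
have meta := Gmeas_measurable Geta; have Seta := L2G_sqint Leta.
have E : (\int[P]_w ((h w * eta w) ^+ 2)%:E = (c * ipr P setT eta eta)%:E)%E.
  rewrite (eq_integral (fun w => (eta w ^+ 2 * h w ^+ 2)%:E)); last first.
    by move=> w _; rewrite exprMn mulrC.
  rewrite (@ge0_integral_weight (fun w => eta w ^+ 2) (fun w => h w ^+ 2) (fun=> c))//.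
  - rewrite EFinM -ipr_sqE// -ge0_integralZl//; last 2 first.
    + by apply/measurable_EFinP; exact: measurable_funX.
    + by move=> w _; rewrite lee_fin sqr_ge0.
    by apply: eq_integral => w _; rewrite -EFinM mulrC.
  - by apply/GmeasP; apply: measurable_funX; exact/GmeasP.
  - by move=> w; exact: sqr_ge0.
  - exact: measurable_funX.
  - by move=> w; exact: sqr_ge0.
  by move=> A GA; rewrite hh// integral_cst//; exact: hG.
have Sh : sqint P setT (fun w => h w * eta w).
  by split; [exact: measurable_funM|rewrite E ltry].
by split=> //; apply: EFin_inj; rewrite -E ipr_sqE.
Qed.

(** The conditional expectation of g h. As a density it is merely
    integrable; tested with its own truncations zn it satisfies E zn^2 = E
    (g h zn) <= (E g^2)^(1/2) (c E zn^2)^(1/2), so E zn^2 <= c E g^2 for all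
    n, and it is square integrable by monotone convergence. *)
Lemma cond_product (g h : Om -> R) (c : R) : sqint P setT g ->
  measurable_fun setT h -> 0 <= c ->
  (forall A, G A -> \int[P]_(w in A) (h w ^+ 2)%:E = c%:E * P A)%E ->
  exists zeta, L2G G zeta /\ forall eta, L2G G eta ->
    ipr P setT zeta eta = ipr P setT g (fun w => h w * eta w).
Proof.
move=> sg mh c0 hh; have mg := sg.1.
have L1 : L2G G (cst 1).
  split; first by apply/GmeasP; exact: measurable_cst.
  by under eq_integral do rewrite expr1n; rewrite integral_cst//= mul1e; apply: (le_lt_trans (probability_le1 P measurableT)); rewrite ltry.
have sh : sqint P setT h.
  have [+ _] := sq_weight mh c0 hh L1; congr sqint; apply/funext => w; exact: mulr1.
have iZ : P.-integrable setT (EFin \o (fun w => g w * h w)) by exact: sqintM.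
have [zeta [Gz iz Hz]] := cond_density iZ.
have mz := Gmeas_measurable Gz.
have prodE eta : L2G G eta -> P.-integrable setT (fun w => (eta w * zeta w)%:E) ->
    (\int[P]_w (zeta w * eta w)%:E = (ipr P setT g (fun w => h w * eta w))%:E)%E.
  move=> Le ie; have [Sh _] := sq_weight mh c0 hh Le.
  have iR : P.-integrable setT (fun w => (eta w * (g w * h w))%:E).
    have := sqintM measurableT sg Sh; congr (integrable _ _ _); apply/funext => w.
    by congr EFin; rewrite [RHS]mulrC mulrA.
  rewrite (eq_integral (fun w => (eta w * zeta w)%:E)); last by move=> w _; rewrite mulrC.
  rewrite (integral_weight (Le.1) iz iZ ie iR Hz) -iprE//.
  by apply: eq_integral => w _; congr EFin; rewrite [LHS]mulrC mulrA.
pose zn (n : nat) w : R := if `|zeta w| <= n%:R then zeta w else 0.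
have Lzn n : L2G G (zn n).
  split.
    apply/GmeasP; apply: measurable_fun_ifT => //; last exact/GmeasP.
    apply: measurable_fun_ler => //; apply: measurableT_comp => //; exact/GmeasP.
  apply: (@le_lt_trans _ _ (\int[P]_w (n%:R ^+ 2)%:E)%E); last first.
    by rewrite integral_cst//= [X in (_ * X)%E]probability_setT mule1 ltry.
  apply: ge0_le_integral => //.
  - by move=> w _; rewrite lee_fin sqr_ge0.
  - apply/measurable_EFinP; apply: measurable_funX; apply: measurable_fun_ifT => //.
    by apply: measurable_fun_ler => //; apply: measurableT_comp.
  - move=> w _; rewrite lee_fin /zn; case: ifPn => [h1|_]; last by rewrite expr0n sqr_ge0.
    by rewrite -(real_normK (num_real (zeta w))) lerXn2r ?nnegrE.
have izn n : P.-integrable setT (fun w => (zn n w * zeta w)%:E).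
  have := sqint_sq (L2G_sqint (Lzn n)); congr (integrable _ _ _).
  by apply/funext => w; rewrite /zn; case: ifP; rewrite ?expr2 ?mul0r.
have bound n : (\int[P]_w (zn n w ^+ 2)%:E <= (c * ipr P setT g g)%:E)%E.
  have := prodE _ (Lzn n) (izn n).
  rewrite (eq_integral (fun w => (zn n w ^+ 2)%:E)); last first.
    by move=> w _; rewrite /zn; case: ifP; rewrite ?expr2 ?mulr0.
  have [Sh Eh] := sq_weight mh c0 hh (Lzn n).
  rewrite ipr_sqE//; last exact: L2G_sqint.
  move=> [E]; rewrite lee_fin; have := ipr_CS measurableT sg Sh.
  rewrite -E Eh; have := ipr_ge0 P setT (zn n); have := ipr_ge0 P setT g.
  move: (ipr P setT g g) (ipr P setT (zn n) (zn n)) => a b a0 b0; rewrite mulrA (mulrC a) expr2.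
  have [->|bn] := eqVneq b 0; first by rewrite mulr_ge0.
  by rewrite ler_pM2r// lt_neqAle eq_sym bn.
have Lz : L2G G zeta.
  split=> //; apply: (@le_lt_trans _ _ (c * ipr P setT g g)%:E); last exact: ltry.
  have -> : (\int[P]_w (zeta w ^+ 2)%:E = limn (fun n => \int[P]_w (zn n w ^+ 2)%:E))%E.
    rewrite -monotone_convergence//; last 3 first.
    - by move=> n; apply/measurable_EFinP; apply: measurable_funX; exact: (L2G_sqint (Lzn n)).1.
    - by move=> n w _; rewrite lee_fin sqr_ge0.
    - move=> w _ a b ab; rewrite lee_fin /zn; case: ifPn => h1; last by rewrite expr0n sqr_ge0.
      by rewrite ifT//; apply: le_trans h1 _; rewrite ler_nat.
    apply: eq_integral => w _; apply/esym/cvg_lim => //.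
    apply: cvg_near_cst; near=> n; rewrite /zn ifT//.
    near: n; exact: nbhs_infty_ger.
  apply: lime_le; last by near=> n; exact: bound.
  apply: ereal_nondecreasing_is_cvgn => a b ab.
  apply: ge0_le_integral => //.
  - by move=> w _; rewrite lee_fin sqr_ge0.
  - by apply/measurable_EFinP; apply: measurable_funX; exact: (L2G_sqint (Lzn a)).1.
  - by apply/measurable_EFinP; apply: measurable_funX; exact: (L2G_sqint (Lzn b)).1.
  move=> w _; rewrite lee_fin /zn; case: ifPn => h1; last by rewrite expr0n sqr_ge0.
  by rewrite ifT//; apply: le_trans h1 _; rewrite ler_nat.
exists zeta; split=> // eta Le; apply: EFin_inj; rewrite -prodE//; last first.
  exact: sqintM (L2G_sqint Le) (L2G_sqint Lz).
by rewrite iprE//; exact: L2G_sqint.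
Unshelve. all: by end_near.
Qed.

End SubSigmaAlgebra.

(** * Increments of the Wiener process *)

Section NormalMoment.
Context (R : realType).
Local Notation leb := (@lebesgue_measure R).

(** The density of the normal law agrees almost everywhere with its
    Radon-Nikodym derivative. *)
Lemma ge0_integral_normal (s : R) (f : R -> \bar R) : (forall x, 0 <= f x)%E ->
  measurable_fun setT f ->
  (\int[normal_prob 0 s]_x f x = \int[leb]_x (f x * (normal_pdf 0 s x)%:E))%E.
Proof.
move=> f0 mf.
have dom := normal_prob_dominates (0 : R) s.
have iRN := Radon_Nikodym_SigmaFinite.f_integrable dom.
have mp : measurable_fun setT (fun x => (normal_pdf (0 : R) s x)%:E).
  by apply/measurable_EFinP; exact: measurable_normal_pdf.
rewrite -(Radon_Nikodym_SigmaFinite.change_of_variables dom f0 measurableT mf).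
have mRN : measurable_fun setT (Radon_Nikodym_SigmaFinite.f (normal_prob (0 : R) s) leb).
  exact: measurable_int iRN.
apply: ge0_ae_eq_integral => //.
- exact: emeasurable_funM.
- exact: emeasurable_funM.
- by move=> x _; rewrite mule_ge0//; exact: Radon_Nikodym_SigmaFinite.f_ge0.
- by move=> x _; rewrite mule_ge0// lee_fin normal_pdf_ge0.
have : ae_eq leb setT (Radon_Nikodym_SigmaFinite.f (normal_prob (0 : R) s) leb)
    (fun x => (normal_pdf (0 : R) s x)%:E).
  apply: integral_ae_eq => // A _ mA.
  by rewrite -Radon_Nikodym_SigmaFinite.f_integral.
by apply: filterS => x /[apply] ->.
Qed.

(** With y = x^2 / (8 s^2), the integrand is a multiple of y exp (- 4 y) <=
    exp (- y), and the latter is up to a constant the normal density with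
    deviation 2 s. *)
Lemma normal_second_moment (s : R) : s != 0 ->
  (\int[normal_prob 0 s]_x (x ^+ 2)%:E < +oo)%E.
Proof.
move=> s0.
have s20 : 0 < s ^+ 2 by rewrite exprn_even_gt0.
have t0 : 2 * s != 0 by rewrite mulf_neq0// pnatr_eq0.
rewrite ge0_integral_normal//; last by apply/measurable_EFinP; exact: measurable_funX.
  2: by move=> x; rewrite lee_fin sqr_ge0.
pose K := normal_peak s / normal_peak (2 * s) * (8 * s ^+ 2).
have pk := normal_peak_gt0 s0; have pk2 := normal_peak_gt0 t0.
have K0 : 0 < K by rewrite mulr_gt0 ?divr_gt0// mulr_gt0.
apply: (@le_lt_trans _ _ (\int[leb]_x (K%:E * (normal_pdf 0 (2 * s) x)%:E))%E); last first.
  rewrite integralZl//; last exact: integrable_normal_pdf.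
  by rewrite integral_normal_pdf mule1 ltry.
have mn (u : R) : measurable_fun setT (normal_pdf (0 : R) u) by exact: measurable_normal_pdf.
have m2 : measurable_fun setT (fun x : R => x ^+ 2) by exact: measurable_funX.
apply: ge0_le_integral => //.
- by move=> x _; rewrite -EFinM lee_fin mulr_ge0 ?sqr_ge0// normal_pdf_ge0.
- by apply: emeasurable_funM; apply/measurable_EFinP; [exact: m2|exact: mn].
- by apply: emeasurable_funM; apply/measurable_EFinP; [exact: measurable_cst|exact: mn].
move=> x _; rewrite -!EFinM lee_fin !normal_pdfE//= /normal_fun subr0.
pose y := x ^+ 2 / (8 * s ^+ 2).
have x2 : x ^+ 2 = 8 * s ^+ 2 * y by rewrite /y mulrC divfK// mulf_neq0// gt_eqF.
have y0 : 0 <= y by apply: divr_ge0; [exact: sqr_ge0|rewrite mulr_ge0// ltW].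
have -> : - x ^+ 2 / (s ^+ 2 *+ 2) = - y *+ 4.
  by rewrite x2 -mulr_natr -[RHS]mulr_natr; field; rewrite ?s0.
have -> : - x ^+ 2 / ((2 * s) ^+ 2 *+ 2) = - y.
  by rewrite x2 -mulr_natr; field; rewrite ?s0.
clearbody y.
have ye : y * expR (- y *+ 4) <= expR (- y).
  rewrite (_ : - y *+ 4 = - y + - y *+ 3); last by rewrite -mulrS.
  rewrite expRD mulrCA ger_pMr ?expR_gt0//.
  have e1 : expR (- y *+ 3) <= expR (- y) by rewrite ler_expR; lra.
  apply: (@le_trans _ _ (y * expR (- y))); first exact: ler_wpM2l.
  rewrite expRN ler_pdivrMr ?expR_gt0// mul1r.
  by apply: le_trans (expR_ge1Dx y); lra.
move: ye; move: (expR (- y *+ 4)) (expR (- y)) => a b ab; rewrite /K x2.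
rewrite [leRHS](_ : _ = (8 * s ^+ 2) * normal_peak s * b); last first.
  by field; rewrite gt_eqF.
rewrite [leLHS](_ : _ = (8 * s ^+ 2) * normal_peak s * (y * a)); last by ring.
by apply: ler_wpM2l => //; rewrite ltW// mulr_gt0// mulr_gt0.
Qed.

End NormalMoment.

Section WienerIncrement.
Context (R : realType) (dd : measure_display) (Om : measurableType dd).
Context (P : probability Om R) (T : R) (W : R -> Om -> R).
Hypothesis hP : measure_is_complete P.
Hypothesis hW : wiener P T W.

Lemma filt_measurable t : t <= T -> filt P W t `<=` measurable.
Proof.
move=> tT; have [mW _ _ _ _] := hW.
apply: smallest_sub; first exact: sigma_algebra_measurable.
move=> A [[s [B [s0 st mB ->]]]|/hP//].
have ms : measurable_fun setT (W s).
  by apply: mW; rewrite /= in_itv/= s0 (le_trans st tT).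
by rewrite -[X in measurable X]setTI; exact: ms.
Qed.

Lemma filt_mono s t : s <= t -> filt P W s `<=` filt P W t.
Proof.
move=> st; apply: sub_sigma_algebra2 => A [[r [B [r0 rs mB ->]]]|nA]; last by right.
by left; exists r, B; split=> //; exact: le_trans st.
Qed.

Lemma increment_measurable s t : 0 <= s -> s <= t -> t <= T ->
  measurable_fun setT (fun w => W t w - W s w).
Proof.
move=> s0 st tT; have [mW _ _ _ _] := hW; apply: measurable_funB; apply: mW.
  by rewrite /= in_itv/= tT (le_trans s0 st).
by rewrite /= in_itv/= s0 (le_trans st tT).
Qed.

(** By independence, the indicator of a past event integrates like the
    constant P A over the events generated by the increment; the weight is
    the squared increment. *)
Lemma increment_second_moment s t : 0 <= s -> s < t -> t <= T ->
  exists2 c, 0 <= c & forall A, filt P W s A ->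
    (\int[P]_(w in A) ((W t w - W s w) ^+ 2)%:E = c%:E * P A)%E.
Proof.
move=> s0 st tT; have [mW _ _ law ind] := hW.
have mX := increment_measurable s0 (ltW st) tT.
set X : Om -> R := fun w => W t w - W s w in mX *.
pose nu : probability (measurableTypeR R) R := normal_prob (0 : R) (Num.sqrt (t - s)).
have sq0 : Num.sqrt (t - s) != 0 by rewrite gt_eqF// sqrtr_gt0 subr_gt0.
have fin : (\int[P]_w (X w ^+ 2)%:E < +oo)%E.
  apply: le_lt_trans (normal_second_moment sq0).
  rewrite -[X in (_ <= X)%E]/(\int[nu]_x (x ^+ 2)%:E)%E.
  pose X' : {mfun Om >-> measurableTypeR R} :=
    @mfun_Sub _ _ Om (measurableTypeR R) X (mem_set mX).
  pose q : measurableTypeR R -> \bar R := fun x => ((x : R) ^+ 2)%:E.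
  have E1 : (\int[distribution P X']_x q x = \int[P]_w (X w ^+ 2)%:E)%E.
    rewrite (ge0_integral_pushforward (phi := X') mX)//.
    - by apply/measurable_EFinP; exact: measurable_funX.
    - by move=> x _; rewrite lee_fin sqr_ge0.
  have E2 : (\int[distribution P X']_x q x = \int[nu]_x q x)%E.
    apply: (eq_measure_integral nu) => B mB _.
    exact: (law s t B s0 st tT mB).
  by rewrite -E1 E2.
have I0 : (0 <= \int[P]_w (X w ^+ 2)%:E)%E.
  by apply: integral_ge0 => w _; rewrite lee_fin sqr_ge0.
exists (fine (\int[P]_w (X w ^+ 2)%:E)%E); first exact: fine_ge0.
move=> A GA; have mA : measurable A by apply: (@filt_measurable s) => //; exact: ltW (lt_le_trans st tT).
rewrite fineK ?ge0_fin_numE// muleC.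
pose C := preimage_set_system setT X measurable.
have CE : <<s C >> = C.
  by apply: sigma_algebra_id; apply: sigma_algebra_preimage; exact: sigma_algebra_measurable.
have hC : <<s C >> `<=` measurable.
  by rewrite CE => _ [B mB <-]; exact: mX.
have mX2 : measurable_fun setT (fun w => X w ^+ 2) by exact: measurable_funX.
transitivity (\int[P]_w (X w ^+ 2 * \1_A w)%:E)%E.
  rewrite integral_mkcond; apply: eq_integral => w _.
  by rewrite patchE indicE; case: ifPn => _; rewrite ?mulr1 ?mulr0.
rewrite (@ge0_integral_weight _ _ _ P C hC (fun w => X w ^+ 2) (\1_A) (fun=> fine (P A)))//.
- under eq_integral do rewrite EFinM muleC.
  rewrite ge0_integralZl//.
  + by rewrite fineK// fin_num_measure.
  + exact/measurable_EFinP.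
  + by move=> w _; rewrite lee_fin sqr_ge0.
  + by rewrite lee_fin fine_ge0.
- move=> B mB; rewrite CE; exists ((fun x => x ^+ 2) @^-1` B); last by rewrite setTI.
  by rewrite -[X in measurable X]setTI; apply: measurable_funX.
- by move=> w; rewrite sqr_ge0.
- by move=> w; rewrite fine_ge0.
move=> A'; rewrite CE => -[B mB]; rewrite setTI => <-.
have mXB : measurable (X @^-1` B) by rewrite -[X in measurable X]setTI; exact: mX.
rewrite integral_indic// integral_cst// fineK ?fin_num_measure//.
by rewrite -ind.
Qed.

End WienerIncrement.

(** * Square integrable random vectors *)

Section RandomVectors.
Context (R : realType) (dd : measure_display) (Om : measurableType dd).
Context (P : probability Om R).
Context (m : nat).
Local Notation vec := (Om -> 'rV[R]_m).
Implicit Types x y z : vec.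

Definition vS x := forall j, sqint P setT (fun w => x w 0 j).
Definition vL2 (G : set (set Om)) x := forall j, L2G P G (fun w => x w 0 j).
(** The pairing E <x, y> for the Euclidean inner product. *)
Definition vE x y : R := \sum_j ipr P setT (fun w => x w 0 j) (fun w => y w 0 j).

Section Pairing.

Lemma vSD x y : vS x -> vS y -> vS (fun w => x w + y w).
Proof.
move=> sx sy j; have := sqintD measurableT (sx j) (sy j).
by congr sqint; apply/funext => w; rewrite mxE.
Qed.

Lemma vSZ a x : vS x -> vS (fun w => a *: x w).
Proof.
move=> sx j; have := sqintZ measurableT a (sx j).
by congr sqint; apply/funext => w; rewrite mxE.
Qed.

Lemma vSN x : vS x -> vS (fun w => - x w).
Proof.
move=> sx j; have := sqintN measurableT (sx j).
by congr sqint; apply/funext => w; rewrite mxE.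
Qed.

Lemma vSB x y : vS x -> vS y -> vS (fun w => x w - y w).
Proof. by move=> sx sy; apply: vSD => //; exact: vSN. Qed.

Lemma vSM (M : 'M[R]_m) x : vS x -> vS (fun w => x w *m M).
Proof.
move=> sx j.
have := sqint_sum measurableT (index_enum 'I_m) (F := fun k w => M k j * x w 0 k)
  (fun k => sqintZ measurableT (M k j) (sx k)).
by congr sqint; apply/funext => w; rewrite mxE; apply: eq_bigr => k _; rewrite mulrC.
Qed.

Lemma vEC x y : vE x y = vE y x.
Proof. by apply: eq_bigr => j _; exact: iprC. Qed.

Lemma vEDl x y z : vS x -> vS y -> vS z ->
  vE (fun w => x w + y w) z = vE x z + vE y z.
Proof.
move=> sx sy sz; rewrite -big_split; apply: eq_bigr => j _ /=.
rewrite -(iprDl measurableT (sx j) (sy j) (sz j)); congr ipr.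
by apply/funext => w; rewrite mxE.
Qed.

Lemma vEZl a x z : vS x -> vS z -> vE (fun w => a *: x w) z = a * vE x z.
Proof.
move=> sx sz; rewrite mulr_sumr; apply: eq_bigr => j _ /=.
rewrite -(iprZl measurableT a (sx j) (sz j)); congr ipr.
by apply/funext => w; rewrite mxE.
Qed.

Lemma vENl x z : vS x -> vS z -> vE (fun w => - x w) z = - vE x z.
Proof.
move=> sx sz; rewrite -[RHS]mulN1r -vEZl//; congr vE.
by apply/funext => w; rewrite scaleN1r.
Qed.

Lemma vEBl x y z : vS x -> vS y -> vS z ->
  vE (fun w => x w - y w) z = vE x z - vE y z.
Proof. by move=> sx sy sz; rewrite vEDl ?vENl//; exact: vSN. Qed.

Lemma vEDr x y z : vS x -> vS y -> vS z ->
  vE z (fun w => x w + y w) = vE z x + vE z y.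
Proof. by move=> *; rewrite vEC vEDl// !(vEC z). Qed.

Lemma vEZr a x z : vS x -> vS z -> vE z (fun w => a *: x w) = a * vE z x.
Proof. by move=> *; rewrite vEC vEZl// vEC. Qed.

Lemma vEBr x y z : vS x -> vS y -> vS z ->
  vE z (fun w => x w - y w) = vE z x - vE z y.
Proof. by move=> *; rewrite vEC vEBl// !(vEC z). Qed.

Lemma vEM (M : 'M[R]_m) x y : vS x -> vS y ->
  vE (fun w => x w *m M) y = vE x (fun w => y w *m M^T).
Proof.
move=> sx sy; rewrite /vE.
transitivity (\sum_j \sum_k M k j * ipr P setT (fun w => x w 0 k) (fun w => y w 0 j)).
  apply: eq_bigr => j _.
  under eq_bigr => k _ do rewrite -(iprZl measurableT (M k j) (sx k) (sy j)).
  rewrite -(ipr_suml measurableT (index_enum 'I_m) (F := fun k w => M k j * x w 0 k))//.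
    by congr ipr; apply/funext => w; rewrite mxE; apply: eq_bigr => k _; rewrite mulrC.
  by move=> k; exact: sqintZ.
rewrite exchange_big; apply: eq_bigr => k _ /=; rewrite [RHS]iprC.
under eq_bigr => j _ do rewrite iprC -(iprZl measurableT (M k j) (sy j) (sx k)).
rewrite -(ipr_suml measurableT (index_enum 'I_m) (F := fun j w => M k j * y w 0 j))//.
  by congr ipr; apply/funext => w; rewrite mxE; apply: eq_bigr => j _; rewrite mxE mulrC.
by move=> j; exact: sqintZ.
Qed.

Lemma vE_ge0 x : 0 <= vE x x.
Proof. by apply: sumr_ge0 => j _; exact: ipr_ge0. Qed.

Lemma vE_eq0 x : vS x -> vE x x = 0 -> {ae P, forall w, x w = 0}.
Proof.
move=> sx /eqP; rewrite psumr_eq0; last by move=> j _; exact: ipr_ge0.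
move=> /allP h.
have /filter_forall : forall j, {ae P, forall w, x w 0 j = 0}.
  move=> j; have /eqP := h j (mem_index_enum j).
  by move=> /(ipr_eq0 measurableT (sx j)); apply: filterS => w; exact.
by apply: filterS => w h'; apply/rowP => j; rewrite mxE.
Qed.

Lemma vE_ae x x' y y' : vS x -> vS x' -> vS y -> vS y' ->
  {ae P, forall w, x w = x' w} -> {ae P, forall w, y w = y' w} ->
  vE x y = vE x' y'.
Proof.
move=> sx sx' sy sy' hx hy; apply: eq_bigr => j _.
by apply: (ae_eq_ipr measurableT) => //;
  [apply: filterS hx|apply: filterS hy] => w ->.
Qed.

End Pairing.

Section Adapted.
Context (C : set (set Om)).
Local Notation G := <<s C >>.
Hypothesis hG : G `<=` measurable.

Lemma L2GE f : L2G P G f <-> Gmeas G f /\ sqint P setT f.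
Proof. by split=> [h|[h1 [h2 h3]]]; split=> //; [exact: h.1|exact: (L2G_sqint hG)]. Qed.

Lemma vL2_vS x : vL2 G x -> vS x.
Proof. by move=> h j; exact: (L2G_sqint hG). Qed.

Lemma L2GD f g : L2G P G f -> L2G P G g -> L2G P G (fun w => f w + g w).
Proof.
move=> /L2GE[Gf sf] /L2GE[Gg sg]; apply/L2GE; split; last exact: (sqintD measurableT).
by apply/GmeasP; apply: measurable_funD; exact/GmeasP.
Qed.

Lemma L2GZ a f : L2G P G f -> L2G P G (fun w => a * f w).
Proof.
move=> /L2GE[Gf sf]; apply/L2GE; split; last exact: (sqintZ measurableT).
by apply/GmeasP; apply: measurable_funM => //; exact/GmeasP.
Qed.

Lemma L2G_cst c : L2G P G (fun=> c).
Proof.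
split; first by apply/GmeasP; exact: measurable_cst.
rewrite integral_cst//; apply: lte_mul_pinfty => //; first by rewrite lee_fin sqr_ge0.
exact: le_lt_trans (probability_le1 P measurableT) (ltry _).
Qed.

Lemma L2G_sum (I : Type) (r : seq I) (F : I -> Om -> R) :
  (forall i, L2G P G (F i)) -> L2G P G (fun w => \sum_(i <- r) F i w).
Proof.
move=> h; elim: r => [|i r IH].
  by have := L2G_cst 0; congr L2G; apply/funext => x; rewrite big_nil.
by have := L2GD (h i) IH; congr L2G; apply/funext => x; rewrite big_cons.
Qed.

Lemma vL2D x y : vL2 G x -> vL2 G y -> vL2 G (fun w => x w + y w).
Proof.
by move=> hx hy j; have := L2GD (hx j) (hy j); congr L2G; apply/funext => w; rewrite mxE.
Qed.

Lemma vL2Z a x : vL2 G x -> vL2 G (fun w => a *: x w).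
Proof.
by move=> hx j; have := L2GZ a (hx j); congr L2G; apply/funext => w; rewrite mxE.
Qed.

Lemma vL2N x : vL2 G x -> vL2 G (fun w => - x w).
Proof.
by move=> /(vL2Z (-1)); congr vL2; apply/funext => w; rewrite scaleN1r.
Qed.

Lemma vL2B x y : vL2 G x -> vL2 G y -> vL2 G (fun w => x w - y w).
Proof. by move=> hx hy; apply: vL2D => //; exact: vL2N. Qed.

Lemma vL2_cst c : vL2 G (fun=> c).
Proof. by move=> j; exact: L2G_cst. Qed.

Lemma vL2M (M : 'M[R]_m) x : vL2 G x -> vL2 G (fun w => x w *m M).
Proof.
move=> hx j.
have := L2G_sum (index_enum 'I_m) (F := fun k w => M k j * x w 0 k) (fun k => L2GZ (M k j) (hx k)).
by congr L2G; apply/funext => w; rewrite mxE; apply: eq_bigr => k _; rewrite mulrC.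
Qed.

End Adapted.

Lemma vL2_mono (G G' : set (set Om)) x : G `<=` G' -> vL2 G x -> vL2 G' x.
Proof. by move=> GG' hx j; have [h1 h2] := hx j; split=> // B mB; apply: GG'; exact: h1. Qed.

Section Noise.
Context (C C' : set (set Om)) (h : Om -> R) (c : R).
Local Notation G := <<s C >>.
Local Notation G' := <<s C' >>.
Hypothesis hG' : G' `<=` measurable.
Hypothesis GG' : G `<=` G'.
Hypothesis hh : Gmeas G' h.
Hypothesis c0 : 0 <= c.
Hypothesis hsq : forall A, G A -> (\int[P]_(w in A) (h w ^+ 2)%:E = c%:E * P A)%E.

Let hG : G `<=` measurable. Proof. by move=> A /GG' /hG'. Qed.
Let mh : measurable_fun setT h. Proof. exact: (Gmeas_measurable hG'). Qed.

Lemma vL2_noise x : vL2 G x -> vL2 G' (fun w => h w *: x w).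
Proof.
move=> hx j; have [s _] := sq_weight hG mh c0 hsq (hx j).
apply/(L2GE hG'); split; last first.
  by move: s; congr sqint; apply/funext => w; rewrite mxE.
rewrite (_ : (fun w => _) = (fun w => h w * x w 0 j)); last first.
  by apply/funext => w; rewrite mxE.
apply/GmeasP; apply: measurable_funM; apply/GmeasP => //.
by move=> B mB; apply: GG'; exact: (hx j).1.
Qed.

Lemma cond_noise (y : vec) : vS y -> exists z, vL2 G z /\
  forall x, vL2 G x -> vE z x = vE y (fun w => h w *: x w).
Proof.
move=> sy.
have /choice[z hz] : forall j, exists z : Om -> R, L2G P G z /\ forall eta, L2G P G eta ->
    ipr P setT z eta = ipr P setT (fun w => y w 0 j) (fun w => h w * eta w).
  by move=> j; exact: (cond_product hG (sy j) mh c0 hsq).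
exists (fun w => \row_j z j w); split=> [j|x hx].
  have [+ _] := hz j; congr L2G; by apply/funext => w; rewrite mxE.
apply: eq_bigr => j _; have [_ /(_ _ (hx j))] := hz j.
rewrite (_ : (fun w => (\row_j0 z j0 w) 0 j) = z j); last by apply/funext => w; rewrite mxE.
by move=> ->; congr ipr; apply/funext => w; rewrite mxE.
Qed.

End Noise.

Lemma cond_vec (C : set (set Om)) (y : vec) : <<s C >> `<=` measurable -> vS y ->
  exists z, vL2 <<s C >> z /\ forall x, vL2 <<s C >> x -> vE z x = vE y x.
Proof.
move=> hG sy.
have h1 : Gmeas <<s C >> (fun _ : Om => 1 : R) by apply/GmeasP; exact: measurable_cst.
have hsq A : <<s C >> A -> (\int[P]_(w in A) (1 ^+ 2)%:E = 1%:E * P A)%E.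
  by move=> /hG mA; rewrite integral_cst// expr1n.
have [z [Lz hz]] := cond_noise hG (fun A (hA : <<s C >> A) => hA) h1 ler01 hsq sy.
exists z; split=> // x Lx; rewrite hz//; congr vE.
by apply/funext => w; rewrite scale1r.
Qed.

End RandomVectors.

(** * The discrete control problem in coordinates *)

Section CrankNicolson.
Context (R : realFieldType) (m : nat) (A : 'M[R]_m) (a : R).
Hypothesis A_le0 : forall x : 'rV[R]_m, \sum_j (x *m A) 0 j * x 0 j <= 0.

Definition cn_mx : 'M[R]_m := 1%:M - a ^+ 2 *: A.

(** The matrix is at least the identity because A is nonpositive. *)
Lemma cn_unit : cn_mx \in unitmx.
Proof.
rewrite -row_free_unit; apply: inj_row_free => x /eqP.
rewrite mulmxBr mulmx1 -scalemxAr subr_eq0 => /eqP h.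
have : \sum_j x 0 j * x 0 j <= 0.
  rewrite {1}h; under eq_bigr => j _ do rewrite mxE -mulrA.
  by rewrite -mulr_sumr mulr_ge0_le0// sqr_ge0.
move=> s0; have /eqP : \sum_j x 0 j * x 0 j = 0.
  by apply/le_anti; rewrite s0 sumr_ge0// => j _; rewrite -expr2 sqr_ge0.
rewrite psumr_eq0; last by move=> j _; rewrite -expr2 sqr_ge0.
move=> /allP hj; apply/rowP => j; rewrite mxE.
by have /eqP/eqP := hj j (mem_index_enum j); rewrite mulf_eq0 orbb => /eqP.
Qed.

(** [cn1 p q] and [cn2 p q] solve the implicit system x - a v = p, v - a A x
    = q by eliminating x. *)
Definition cn2 (p q : 'rV[R]_m) := (q + a *: (p *m A)) *m invmx cn_mx.
Definition cn1 (p q : 'rV[R]_m) := p + a *: cn2 p q.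

Lemma cnP (x v p q : 'rV[R]_m) :
  (x - a *: v = p /\ v - a *: (x *m A) = q) <-> (x = cn1 p q /\ v = cn2 p q).
Proof.
split=> [[<- <-]|[-> ->]].
  have E : cn2 (x - a *: v) (v - a *: (x *m A)) = v.
    rewrite /cn2 -[RHS](mulmxK cn_unit); congr (_ *m _).
    rewrite /cn_mx mulmxBr mulmx1 mulmxBl scalerBr -!scalemxAl -scalemxAr scalerA.
    by rewrite -expr2 addrA subrK.
  by rewrite /cn1 E subrK.
split; first by rewrite /cn1 addrK.
have : cn2 p q *m cn_mx = q + a *: (p *m A) by rewrite /cn2 mulmxKV// cn_unit.
rewrite /cn_mx mulmxBr mulmx1 -scalemxAr => /eqP; rewrite subr_eq => /eqP E.
rewrite {1}E /cn1 mulmxDl scalerDr -scalemxAl scalerA -expr2.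
by rewrite -(addrA q) addrK.
Qed.

End CrankNicolson.

Section DiscreteLQ.
Context (R : realType) (dd : measure_display) (Om : measurableType dd).
Context (P : probability Om R) (m : nat).
Context (C : nat -> set (set Om)) (N : nat) (h : nat -> Om -> R) (c : nat -> R).
Context (A : 'M[R]_m) (tau gamma alpha beta : R).
Local Notation G n := <<s C n >>.
Local Notation vec := (Om -> 'rV[R]_m).
Local Notation a := (tau / 2).
Local Notation vE := (vE P).
Local Notation vL2 n := (vL2 P (G n)).
Hypothesis hG : forall n, (n <= N)%N -> G n `<=` measurable.
Hypothesis GG : forall n, (n < N)%N -> G n `<=` G n.+1.
Hypothesis hh : forall n, (n < N)%N -> Gmeas (G n.+1) (h n).
Hypothesis c0 : forall n, (n < N)%N -> 0 <= c n.
Hypothesis hsq : forall n, (n < N)%N -> forall B, G n B ->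
  (\int[P]_(w in B) (h n w ^+ 2)%:E = (c n)%:E * P B)%E.
Hypothesis A_le0 : forall x : 'rV[R]_m, \sum_j (x *m A) 0 j * x 0 j <= 0.
Hypothesis A_sym : A^T = A.

Lemma vL2_S n (x : vec) : (n < N)%N -> vL2 n x -> vL2 n.+1 x.
Proof. by move=> nN; apply: vL2_mono; exact: GG. Qed.

Lemma vL2_noiseS n (x : vec) : (n < N)%N -> vL2 n x -> vL2 n.+1 (fun w => h n w *: x w).
Proof.
by move=> nN; apply: (vL2_noise (hG nN) (GG nN) (hh nN) (c0 nN) (hsq nN)).
Qed.

Lemma vS_of n (x : vec) : (n <= N)%N -> vL2 n x -> vS P x.
Proof. by move=> nN; apply: vL2_vS; exact: hG. Qed.

Lemma vL2_cn1 n (p q : vec) : (n <= N)%N -> vL2 n p -> vL2 n q ->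
  vL2 n (fun w => cn1 A a (p w) (q w)).
Proof.
move=> nN Lp Lq; have g := hG nN; apply: vL2D => //; apply: vL2Z => //; apply: vL2M => //.
by apply: vL2D => //; apply: vL2Z => //; exact: vL2M.
Qed.

Lemma vL2_cn2 n (p q : vec) : (n <= N)%N -> vL2 n p -> vL2 n q ->
  vL2 n (fun w => cn2 A a (p w) (q w)).
Proof.
move=> nN Lp Lq; have g := hG nN; apply: vL2M => //.
by apply: vL2D => //; apply: vL2Z => //; exact: vL2M.
Qed.

(** The Crank-Nicolson equations of one step, in the shape of [is_state]. *)
Definition step_eq n (u f x v x' v' : 'rV[R]_m) (w : Om) :=
  x' - x = a *: (v' + v) /\
  v' - v = a *: ((x' + x) *m A) + tau *: u + h n w *: (gamma *: x + f).

Lemma step_eqP n u f x v x' v' w : step_eq n u f x v x' v' w <->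
  (x' = cn1 A a (x + a *: v) (v + a *: (x *m A) + tau *: u + h n w *: (gamma *: x + f)) /\
   v' = cn2 A a (x + a *: v) (v + a *: (x *m A) + tau *: u + h n w *: (gamma *: x + f))).
Proof.
rewrite -cnP//; split=> -[h1 h2]; split.
- move/eqP: h1; rewrite subr_eq => /eqP ->; rewrite scalerDr.
  by rewrite addrAC [_ + a *: v]addrC addrK addrC.
- move/eqP: h2; rewrite subr_eq => /eqP ->; rewrite mulmxDl scalerDr.
  by apply/rowP => j; rewrite !mxE; ring.
- move/eqP: h1; rewrite subr_eq => /eqP ->; rewrite scalerDr.
  by apply/rowP => j; rewrite !mxE; ring.
move/eqP: h2; rewrite subr_eq => /eqP ->; rewrite mulmxDl scalerDr.
by apply/rowP => j; rewrite !mxE; ring.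
Qed.

Definition is_st (u f x v : nat -> vec) := forall n, (n < N)%N ->
  {ae P, forall w, step_eq n (u n w) (f n w) (x n w) (v n w) (x n.+1 w) (v n.+1 w) w}.

Fixpoint st (x0 v0 : 'rV[R]_m) (u f : nat -> vec) n : vec * vec :=
  if n is k.+1 then
    let x := (st x0 v0 u f k).1 in let v := (st x0 v0 u f k).2 in
    let p w := x w + a *: v w in
    let q w := v w + a *: (x w *m A) + tau *: u k w + h k w *: (gamma *: x w + f k w) in
    (fun w => cn1 A a (p w) (q w), fun w => cn2 A a (p w) (q w))
  else (fun=> x0, fun=> v0).

Lemma st_step x0 v0 u f n w : step_eq n (u n w) (f n w)
  ((st x0 v0 u f n).1 w) ((st x0 v0 u f n).2 w)
  ((st x0 v0 u f n.+1).1 w) ((st x0 v0 u f n.+1).2 w) w.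
Proof. by apply/step_eqP. Qed.

Lemma st_L2 x0 v0 u f : (forall n, (n < N)%N -> vL2 n (u n)) ->
  (forall n, (n < N)%N -> vL2 n (f n)) -> forall n, (n <= N)%N ->
  vL2 n (st x0 v0 u f n).1 /\ vL2 n (st x0 v0 u f n).2.
Proof.
move=> Lu Lf; elim=> [_|n IH nN]; first by split; exact: vL2_cst.
have [Lx Lv] := IH (ltnW nN); have g := hG (ltnW nN); have g' := hG nN.
have Lp : vL2 n.+1 (fun w => (st x0 v0 u f n).1 w + a *: (st x0 v0 u f n).2 w).
  by apply: vL2_S => //; apply: vL2D => //; exact: vL2Z.
have Lq : vL2 n.+1 (fun w => (st x0 v0 u f n).2 w + a *: ((st x0 v0 u f n).1 w *m A)
    + tau *: u n w + h n w *: (gamma *: (st x0 v0 u f n).1 w + f n w)).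
  apply: vL2D => //; last first.
    by apply: vL2_noiseS => //; apply: vL2D => //; [exact: vL2Z|exact: Lf].
  apply: vL2_S => //; apply: vL2D => //; last by apply: vL2Z => //; exact: Lu.
  by apply: vL2D => //; apply: vL2Z => //; exact: vL2M.
by split; [exact: vL2_cn1|exact: vL2_cn2].
Qed.

Lemma st_unique u f x v u' x' v' : is_st u f x v -> is_st u' f x' v' ->
  {ae P, forall w, x 0%N w = x' 0%N w} -> {ae P, forall w, v 0%N w = v' 0%N w} ->
  (forall n, (n < N)%N -> {ae P, forall w, u n w = u' n w}) ->
  forall n, (n <= N)%N -> {ae P, forall w, x n w = x' n w /\ v n w = v' n w}.
Proof.
move=> S S' x0 v0 uu; elim=> [_|n IH nN].
  by apply: filterS2 x0 v0 => w -> ->.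
have I1 := IH (ltnW nN); have I2 := uu n nN; have I3 := S n nN; have I4 := S' n nN.
apply: filterS2 (filterI I1 I2) (filterI I3 I4) => w [[e1 e2] e3] [/step_eqP s1 /step_eqP s2].
by move: s1 s2; rewrite e1 e2 e3 => -[-> ->] [-> ->].
Qed.

(** The backward equations, tested with square integrable random vectors
    instead of written with conditional expectations. *)
Definition is_adj (d Y1 Y2 : nat -> vec) := [/\
  {ae P, forall w, Y1 N w = a *: (Y2 N w *m A) + beta *: d N w},
  {ae P, forall w, Y2 N w = a *: Y1 N w} &
  forall n, (n < N)%N -> forall eta, vL2 n eta ->
    vE (fun w => Y1 n w - tau *: d n w) eta =
      vE (fun w => Y1 n.+1 w + a *: ((Y2 n.+1 w + Y2 n w) *m A)) eta
      + gamma * vE (Y2 n.+1) (fun w => h n w *: eta w) /\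
    vE (Y2 n) eta = vE (fun w => Y2 n.+1 w + a *: (Y1 n.+1 w + Y1 n w)) eta].

Definition L2seq (x : nat -> vec) := forall n, (n <= N)%N -> vL2 n (x n).

(** The right-hand sides are conditional expectations of known quantities;
    the unknowns at time n then solve the system of [cnP], with the roles of
    the two components exchanged. *)
Lemma adj_step n (d y1 y2 : vec) : (n < N)%N -> vL2 n d ->
  vL2 n.+1 y1 -> vL2 n.+1 y2 -> exists z1 z2, [/\ vL2 n z1, vL2 n z2 &
  forall eta, vL2 n eta ->
    vE (fun w => z1 w - tau *: d w) eta =
      vE (fun w => y1 w + a *: ((y2 w + z2 w) *m A)) eta
      + gamma * vE y2 (fun w => h n w *: eta w) /\
    vE z2 eta = vE (fun w => y2 w + a *: (y1 w + z1 w)) eta].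
Proof.
move=> nN Ld L1 L2; have g := hG (ltnW nN); have g' := hG nN.
have S1 := vS_of nN L1; have S2 := vS_of nN L2; have Sd := vS_of (ltnW nN) Ld.
have [p [Lp hp]] := cond_vec g (vSD S1 (vSZ a (vSM A S2))).
have [r [Lr hr]] := cond_noise g' (GG nN) (hh nN) (c0 nN) (hsq nN) S2.
have [q [Lq hq]] := cond_vec g (vSD S2 (vSZ a S1)).
pose s w := p w + gamma *: r w + tau *: d w.
have Ls : vL2 n s by do !apply: vL2D => //; exact: vL2Z.
pose z2 w := cn1 A a (q w) (s w); pose z1 w := cn2 A a (q w) (s w).
have Lz2 : vL2 n z2 by exact: vL2_cn1 (ltnW nN) Lq Ls.
have Lz1 : vL2 n z1 by exact: vL2_cn2 (ltnW nN) Lq Ls.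
have Sz1 := vS_of (ltnW nN) Lz1; have Sz2 := vS_of (ltnW nN) Lz2.
have Sp := vS_of (ltnW nN) Lp; have Sr := vS_of (ltnW nN) Lr; have Sq := vS_of (ltnW nN) Lq.
have E w : z2 w - a *: z1 w = q w /\ z1 w - a *: (z2 w *m A) = s w.
  exact/(cnP _ A_le0).
exists z1, z2; split=> // eta Le; have Se := vS_of (ltnW nN) Le; split.
  rewrite (_ : (fun w => z1 w - _) = (fun w => (p w + a *: (z2 w *m A)) + gamma *: r w)); last first.
    apply/funext => w; have [_ /eqP] := E w; rewrite subr_eq => /eqP ->.
    by rewrite /s; apply/rowP => j; rewrite !mxE; ring.
  rewrite (_ : (fun w => y1 w + _) = (fun w => (y1 w + a *: (y2 w *m A)) + a *: (z2 w *m A))); last first.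
    by apply/funext => w; rewrite mulmxDl scalerDr addrA.
  have SzA := vSZ a (vSM A Sz2); have S12 := vSD S1 (vSZ a (vSM A S2)).
  rewrite (vEDl (vSD Sp SzA) (vSZ gamma Sr) Se) (vEDl Sp SzA Se) (vEDl S12 SzA Se).
  by rewrite (vEZl gamma Sr Se) hp// hr.
rewrite (_ : z2 = (fun w => q w + a *: z1 w)); last first.
  by apply/funext => w; have [/eqP] := E w; rewrite subr_eq => /eqP.
rewrite (_ : (fun w => y2 w + _) = (fun w => (y2 w + a *: y1 w) + a *: z1 w)); last first.
  by apply/funext => w; rewrite scalerDr addrA.
have Sz := vSZ a Sz1; have S21 := vSD S2 (vSZ a S1).
by rewrite (vEDl Sq Sz Se) (vEDl S21 Sz Se) hq.
Qed.

(** Backward recursion from the terminal time; the step is made total, with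
    an arbitrary value outside the square integrable vectors, in order to
    iterate it. *)
Lemma adj_exists d : L2seq d -> exists Y1 Y2, [/\ L2seq Y1, L2seq Y2 & is_adj d Y1 Y2].
Proof.
move=> Ld.
have /choice[F hF] : forall q : nat * (vec * vec), exists z : vec * vec,
    (q.1 < N)%N -> vL2 q.1.+1 q.2.1 -> vL2 q.1.+1 q.2.2 -> [/\ vL2 q.1 z.1, vL2 q.1 z.2 &
    forall eta, vL2 q.1 eta ->
    vE (fun w => z.1 w - tau *: d q.1 w) eta =
      vE (fun w => q.2.1 w + a *: ((q.2.2 w + z.2 w) *m A)) eta
      + gamma * vE q.2.2 (fun w => h q.1 w *: eta w) /\
    vE z.2 eta = vE (fun w => q.2.2 w + a *: (q.2.1 w + z.1 w)) eta].
  move=> [n [y1 y2]] /=; have [nN|/negP nN] := boolP (n < N)%N; last by exists (y1, y2).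
  have [[L1 L2]|H] := pselect (vL2 n.+1 y1 /\ vL2 n.+1 y2); last first.
    by exists (y1, y2) => _ L1 L2; exfalso; apply: H.
  have [z1 [z2 hz]] := adj_step nN (Ld n (ltnW nN)) L1 L2.
  by exists (z1, z2).
pose T2 w := cn1 A a 0 (beta *: d N w); pose T1 w := cn2 A a 0 (beta *: d N w).
have L0 : vL2 N (fun _ : Om => 0 : 'rV[R]_m) by exact: vL2_cst.
have LT : vL2 N T1 /\ vL2 N T2.
  have LdN : vL2 N (fun w => beta *: d N w) by apply: vL2Z; [exact: hG|exact: Ld].
  by split; [exact: (vL2_cn2 (leqnn N) L0 LdN)|exact: (vL2_cn1 (leqnn N) L0 LdN)].
pose fix Bk (k : nat) : vec * vec := if k is j.+1 then F ((N - k)%N, Bk j) else (T1, T2).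
have LB k : (k <= N)%N -> vL2 (N - k)%N (Bk k).1 /\ vL2 (N - k)%N (Bk k).2.
  elim: k => [|k IH kN]; first by rewrite subn0.
  have [I1 I2] := IH (ltnW kN); have e : (N - k.+1).+1 = (N - k)%N by rewrite subnSK.
  have lt : (N - k.+1 < N)%N by rewrite -subn_gt0 subKn.
  have /= := hF ((N - k.+1)%N, Bk k) lt; rewrite e => /(_ I1 I2)[]; by split.
exists (fun n => (Bk (N - n)%N).1), (fun n => (Bk (N - n)%N).2); split.
- by move=> n nN; have [] := LB (N - n)%N (leq_subr _ _); rewrite subKn.
- by move=> n nN; have [] := LB (N - n)%N (leq_subr _ _); rewrite subKn.
split.
- rewrite subnn; apply: aeW => w /=.
  have [_ <-] := (proj2 (cnP _ A_le0 (T2 w) (T1 w) _ _)) (conj erefl erefl).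
  by rewrite addrC subrK.
- rewrite subnn; apply: aeW => w /=.
  have [/eqP] := (proj2 (cnP _ A_le0 (T2 w) (T1 w) _ _)) (conj erefl erefl).
  by rewrite subr_eq0 => /eqP.
move=> n nN eta Le.
have e : (N - n)%N = (N - n.+1).+1 by rewrite subnSK.
have [I1 I2] := LB (N - n.+1)%N (leq_subr _ _); rewrite subKn// in I1 I2.
have en : (N - (N - n.+1).+1)%N = n by rewrite -e subKn// ltnW.
have /= [_ _] := hF (n, Bk (N - n.+1)%N) nN I1 I2.
by rewrite e /= en => /(_ eta Le).
Qed.

(** The backward equations are tested with the state (x, v) at time n and
    the forward equations with the adjoint at time n + 1; the noise terms of
    both are gamma E <Y2(t_{n+1}), h x> and cancel. *)
Lemma duality_step n (d y1 y2 y1' y2' u x v x' v' : vec) : (n < N)%N ->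
  vL2 n d -> vL2 n y1 -> vL2 n y2 -> vL2 n.+1 y1' -> vL2 n.+1 y2' ->
  vL2 n u -> vL2 n x -> vL2 n v -> vL2 n.+1 x' -> vL2 n.+1 v' ->
  {ae P, forall w, step_eq n (u w) 0 (x w) (v w) (x' w) (v' w) w} ->
  (forall eta, vL2 n eta ->
    vE (fun w => y1 w - tau *: d w) eta =
      vE (fun w => y1' w + a *: ((y2' w + y2 w) *m A)) eta
      + gamma * vE y2' (fun w => h n w *: eta w) /\
    vE y2 eta = vE (fun w => y2' w + a *: (y1' w + y1 w)) eta) ->
  vE (fun w => y1 w - a *: (y2 w *m A)) x + vE (fun w => y2 w - a *: y1 w) v =
  vE (fun w => y1' w - a *: (y2' w *m A)) x' + vE (fun w => y2' w - a *: y1' w) v'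
  - tau * vE y2' u + tau * vE d x.
Proof.
move=> nN Ld L1 L2 L1' L2' Lu Lx Lv Lx' Lv' S W.
have nN' := ltnW nN.
have [Sd S1 S2] := And3 (vS_of nN' Ld) (vS_of nN' L1) (vS_of nN' L2).
have [S1' S2'] := conj (vS_of nN L1') (vS_of nN L2').
have [Su Sx Sv] := And3 (vS_of nN' Lu) (vS_of nN' Lx) (vS_of nN' Lv).
have [Sx' Sv'] := conj (vS_of nN Lx') (vS_of nN Lv').
have Shx := vS_of nN (vL2_noiseS nN Lx).
have [W1 _] := W x Lx; have [_ W2] := W v Lv.
have symA y z : vS P y -> vS P z -> vE (fun w => y w *m A) z = vE y (fun w => z w *m A).
  by move=> Sy Sz; rewrite vEM// A_sym.
(* the first backward equation tested with x, the second with v *)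
have E1 : vE y1 x - tau * vE d x = vE y1' x + a * vE y2' (fun w => x w *m A)
    + a * vE y2 (fun w => x w *m A) + gamma * vE y2' (fun w => h n w *: x w).
  move: W1; rewrite (vEBl S1 (vSZ tau Sd) Sx) (vEZl tau Sd Sx).
  rewrite (vEDl S1' (vSZ a (vSM A (vSD S2' S2))) Sx) (vEZl a (vSM A (vSD S2' S2)) Sx).
  rewrite (symA _ _ (vSD S2' S2) Sx) (vEDl S2' S2 (vSM A Sx)) => ->.
  by rewrite mulrDr addrA.
have E2 : vE y2 v = vE y2' v + a * vE y1' v + a * vE y1 v.
  rewrite W2 (vEDl S2' (vSZ a (vSD S1' S1)) Sv) (vEZl a (vSD S1' S1) Sv).
  by rewrite (vEDl S1' S1 Sv) mulrDr addrA.
(* the forward equations paired with the adjoint at the next time *)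
have E3 : vE y1' x' - vE y1' x = a * vE y1' v' + a * vE y1' v.
  rewrite -(vEBr Sx' Sx S1') -mulrDr -(vEDr Sv' Sv S1') -(vEZr a (vSD Sv' Sv) S1').
  apply: vE_ae => //; [exact: vSB|apply: vSZ; exact: vSD|exact: aeW|].
  by apply: filterS S => w [].
have E4 : vE y2' v' - vE y2' v = a * vE y2' (fun w => x' w *m A)
    + a * vE y2' (fun w => x w *m A) + tau * vE y2' u
    + gamma * vE y2' (fun w => h n w *: x w).
  have SxA := vSM A Sx; have SxA' := vSM A Sx'.
  have SD1 := vSD (vSZ a SxA') (vSZ a SxA); have SD2 := vSD SD1 (vSZ tau Su).
  rewrite -(vEBr Sv' Sv S2') -(vEZr a SxA' S2') -(vEZr a SxA S2') -(vEZr tau Su S2').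
  rewrite -(vEZr gamma Shx S2') -(vEDr (vSZ a SxA') (vSZ a SxA) S2').
  rewrite -(vEDr SD1 (vSZ tau Su) S2') -(vEDr SD2 (vSZ gamma Shx) S2').
  apply: vE_ae => //; [exact: vSB|exact: vSD SD2 (vSZ gamma Shx)|exact: aeW|].
  apply: filterS S => w [_ ->]; rewrite mulmxDl scalerDr addr0 !scalerA.
  by rewrite [h n w * _]mulrC.
rewrite (vEBl S1 (vSZ a (vSM A S2)) Sx) (vEZl a (vSM A S2) Sx) (symA _ _ S2 Sx).
rewrite (vEBl S2 (vSZ a S1) Sv) (vEZl a S1 Sv).
rewrite (vEBl S1' (vSZ a (vSM A S2')) Sx') (vEZl a (vSM A S2') Sx') (symA _ _ S2' Sx').
rewrite (vEBl S2' (vSZ a S1') Sv') (vEZl a S1' Sv').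
move: E1 E2 E3 E4.
move: (vE y1 x) (vE d x) (vE y1' x) (vE y2' _) (vE y2 _) (vE y2' _) (vE y2 v)
  (vE y2' v) (vE y1' v) (vE y1 v) (vE y1' x') (vE y1' v') (vE y2' v') (vE y2' _) (vE y2' u).
move=> *; lra.
Qed.

(** Summation by parts in time. The terminal relations make the weight of x
    equal to beta d and that of v equal to zero at the final time; at time 0
    both x and v vanish. *)
Lemma duality d Y1 Y2 u x v : L2seq d -> L2seq Y1 -> L2seq Y2 ->
  (forall n, (n < N)%N -> vL2 n (u n)) -> L2seq x -> L2seq v ->
  is_st u (fun _ _ => 0) x v ->
  {ae P, forall w, x 0%N w = 0} -> {ae P, forall w, v 0%N w = 0} ->
  is_adj d Y1 Y2 ->
  tau * (\sum_(n < N) vE (d n) (x n)) + beta * vE (d N) (x N) =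
  tau * (\sum_(n < N) vE (Y2 n.+1) (u n)).
Proof.
move=> Ld L1 L2 Lu Lx Lv S x0 v0 [T1 T2 W].
pose s n := vE (fun w => Y1 n w - a *: (Y2 n w *m A)) (x n)
  + vE (fun w => Y2 n w - a *: Y1 n w) (v n).
have step n : (n < N)%N -> s n = s n.+1 - tau * vE (Y2 n.+1) (u n) + tau * vE (d n) (x n).
  move=> nN; have nN' := ltnW nN.
  apply: (duality_step nN) => //; [exact: Ld|exact: L1|exact: L2|exact: L1|exact: L2
    |exact: Lu|exact: Lx|exact: Lv|exact: Lx|exact: Lv|exact: S|exact: W].
have Sd := vS_of (leqnn N) (Ld _ (leqnn N)).
have vS0 : vS P (fun _ : Om => 0 : 'rV[R]_m) by apply: (vS_of (leqnn N)); exact: vL2_cst.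
have vE0 y : vE y (fun=> 0) = 0.
  by rewrite /vE big1// => j _; rewrite iprC; under [X in ipr _ _ X]funext do rewrite mxE; exact: ipr0l.
have s0 : s 0%N = 0.
  have [SY1 SY2 Sx Sv] := And4 (vS_of (leq0n N) (L1 0%N (leq0n N))) (vS_of (leq0n N) (L2 0%N (leq0n N)))
     (vS_of (leq0n N) (Lx 0%N (leq0n N))) (vS_of (leq0n N) (Lv 0%N (leq0n N))).
  have SA := vSB SY1 (vSZ a (vSM A SY2)); have SB := vSB SY2 (vSZ a SY1).
  rewrite /s (vE_ae SA SA Sx vS0 _ x0); last exact: aeW.
  rewrite (vE_ae SB SB Sv vS0 _ v0); last exact: aeW.
  by rewrite !vE0 addr0.
have sN : s N = beta * vE (d N) (x N).
  have [SY1 SY2 Sx Sv] := And4 (vS_of (leqnn N) (L1 N (leqnn N))) (vS_of (leqnn N) (L2 N (leqnn N)))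
     (vS_of (leqnn N) (Lx N (leqnn N))) (vS_of (leqnn N) (Lv N (leqnn N))).
  have SA := vSB SY1 (vSZ a (vSM A SY2)); have SB := vSB SY2 (vSZ a SY1).
  rewrite /s (vE_ae SA (vSZ beta Sd) Sx Sx); last 2 first.
  - by apply: filterS T1 => w ->; rewrite addrC addKr.
  - exact: aeW.
  rewrite (vE_ae SB vS0 Sv Sv); last 2 first.
  - by apply: filterS T2 => w ->; rewrite subrr.
  - exact: aeW.
  by rewrite (vEZl beta Sd Sx) [vE (fun=> 0) _]vEC vE0 addr0.
have tel : \sum_(n < N) (s n.+1 - s n) = s N - s 0%N.
  by rewrite -(big_mkord xpredT (fun n => s n.+1 - s n)) telescope_sumr.
rewrite -sN -[s N](subrK (s 0%N)) -tel s0 addr0 mulr_sumr -big_split mulr_sumr.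
apply: eq_bigr => n _ /=; rewrite (step n)//; ring.
Qed.

Definition cost_seq (X : nat -> 'rV[R]_m) (u x : nat -> vec) : R :=
  tau * (\sum_(n < N) (vE (fun w => x n w - X n) (fun w => x n w - X n)
     + alpha * vE (u n) (u n)))
  + beta * vE (fun w => x N w - X N) (fun w => x N w - X N).

Lemma cost_expand X u x V z : L2seq x -> L2seq z ->
  (forall n, (n < N)%N -> vL2 n (u n)) -> (forall n, (n < N)%N -> vL2 n (V n)) ->
  cost_seq X (fun n w => u n w + V n w) (fun n w => x n w + z n w) =
  cost_seq X u x
  + 2 * (tau * (\sum_(n < N) (vE (fun w => x n w - X n) (z n) + alpha * vE (u n) (V n)))
         + beta * vE (fun w => x N w - X N) (z N))
  + (tau * (\sum_(n < N) (vE (z n) (z n) + alpha * vE (V n) (V n))) + beta * vE (z N) (z N)).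
Proof.
move=> Lx Lz Lu LV.
have sq (p q : vec) : vS P p -> vS P q -> vE (fun w => p w + q w) (fun w => p w + q w) =
    vE p p + 2 * vE p q + vE q q.
  move=> Sp Sq; have SD := vSD Sp Sq.
  by rewrite (vEDl Sp Sq SD) (vEDr Sp Sq Sp) (vEDr Sp Sq Sq) (vEC _ q p); ring.
have SX n : (n <= N)%N -> vS P (fun w => x n w - X n).
  move=> nN; apply: (vS_of nN); apply: vL2B; [exact: hG|exact: Lx|exact: vL2_cst].
have dist n : (n <= N)%N -> vE (fun w => x n w + z n w - X n) (fun w => x n w + z n w - X n) =
    vE (fun w => x n w - X n) (fun w => x n w - X n) + 2 * vE (fun w => x n w - X n) (z n)
    + vE (z n) (z n).
  move=> nN; rewrite -(sq _ _ (SX n nN) (vS_of nN (Lz n nN))).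
  by congr vE; apply/funext => w; rewrite addrAC.
rewrite /cost_seq dist//.
rewrite (eq_bigr (fun n : 'I_N => (vE (fun w => x n w - X n) (fun w => x n w - X n)
    + alpha * vE (u n) (u n)) + 2 * (vE (fun w => x n w - X n) (z n) + alpha * vE (u n) (V n))
    + (vE (z n) (z n) + alpha * vE (V n) (V n)))); last first.
  move=> n _; have nN := ltn_ord n; rewrite dist ?(ltnW nN)//.
  rewrite (sq _ _ (vS_of (ltnW nN) (Lu n nN)) (vS_of (ltnW nN) (LV n nN))); ring.
have split3 (p q r : 'I_N -> R) :
    \sum_n (p n + 2 * q n + r n) = \sum_n p n + 2 * (\sum_n q n) + \sum_n r n.
  by rewrite !big_split/= -mulr_sumr.
rewrite split3.
move: (\sum_(n < N) _) (\sum_(n < N) _) (\sum_(n < N) _) (vE _ _) (vE _ _) (vE _ _) => *.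
ring.
Qed.

Section Optimality.
Context (X : nat -> 'rV[R]_m) (u x Y1 Y2 : nat -> vec).
Hypothesis tau0 : 0 < tau.
Hypothesis alpha0 : 0 < alpha.
Hypothesis beta0 : 0 <= beta.
Hypothesis Lu : forall n, (n < N)%N -> vL2 n (u n).
Hypothesis Lx : L2seq x.
Hypothesis L1 : L2seq Y1.
Hypothesis L2 : L2seq Y2.
Hypothesis hadj : is_adj (fun n w => X n - x n w) Y1 Y2.

(** The linear part of the quadratic cost pairs the variation of the state
    with the misfit; [duality] rewrites it as a pairing of the variation of
    the control with the adjoint. *)
Lemma cost_increment V z zv : (forall n, (n < N)%N -> vL2 n (V n)) ->
  L2seq z -> L2seq zv -> is_st V (fun _ _ => 0) z zv ->
  {ae P, forall w, z 0%N w = 0} -> {ae P, forall w, zv 0%N w = 0} ->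
  cost_seq X (fun n w => u n w + V n w) (fun n w => x n w + z n w) =
  cost_seq X u x
  + 2 * tau * (\sum_(n < N) (alpha * vE (u n) (V n) - vE (Y2 n.+1) (V n)))
  + (tau * (\sum_(n < N) (vE (z n) (z n) + alpha * vE (V n) (V n))) + beta * vE (z N) (z N)).
Proof.
move=> LV Lz Lzv S z0 zv0; rewrite cost_expand//; congr (_ + _ + _).
have Ld : L2seq (fun n w => X n - x n w).
  by move=> n nN; apply: vL2B; [exact: hG|exact: vL2_cst|exact: Lx].
have := duality Ld L1 L2 LV Lz Lzv S z0 zv0 hadj.
have neg n : (n <= N)%N -> vE (fun w => X n - x n w) (z n) = - vE (fun w => x n w - X n) (z n).
  move=> nN; have SX : vS P (fun w => x n w - X n).
    by apply: (vS_of nN); apply: vL2B; [exact: hG|exact: Lx|exact: vL2_cst].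
  rewrite -(vENl SX (vS_of nN (Lz n nN))).
  by congr vE; apply/funext => w; rewrite opprB.
rewrite neg// (eq_bigr (fun n : 'I_N => - vE (fun w => x n w - X n) (z n))); last first.
  by move=> n _; rewrite neg// ltnW.
rewrite !big_split/= !sumrN.
move: (\sum_(n < N) _) (\sum_(n < N) _) (\sum_(n < N) _) (vE _ _) => s1 s2 s3 e H.
lra.
Qed.

Lemma cost_minimal_at :
  (forall n, (n < N)%N -> forall eta, vL2 n eta -> alpha * vE (u n) eta = vE (Y2 n.+1) eta) ->
  forall V z zv, (forall n, (n < N)%N -> vL2 n (V n)) ->
  L2seq z -> L2seq zv -> is_st V (fun _ _ => 0) z zv ->
  {ae P, forall w, z 0%N w = 0} -> {ae P, forall w, zv 0%N w = 0} ->
  cost_seq X u x + tau * alpha * (\sum_(n < N) vE (V n) (V n)) <=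
  cost_seq X (fun n w => u n w + V n w) (fun n w => x n w + z n w).
Proof.
move=> H V z zv LV Lz Lzv S z0 zv0; rewrite (cost_increment LV Lz Lzv S z0 zv0).
have -> : \sum_(n < N) (alpha * vE (u n) (V n) - vE (Y2 n.+1) (V n)) = 0.
  by rewrite big1// => n _; rewrite H ?subrr//; exact: LV.
rewrite mulr0 addr0.
rewrite lerD2l big_split/= -mulr_sumr mulrDr mulrA addrAC lerDr addr_ge0//.
  by rewrite mulr_ge0 ?(ltW tau0)// sumr_ge0// => n _; exact: vE_ge0.
by rewrite mulr_ge0// vE_ge0.
Qed.

(** The variation e V, with V equal to eta at time k and zero otherwise,
    changes the cost by a quadratic polynomial in e; it is nonnegative, so
    its linear coefficient vanishes. *)
Lemma first_order v f :
  is_st u f x v -> L2seq v ->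
  (forall u' x' v', (forall n, (n < N)%N -> vL2 n (u' n)) -> L2seq x' -> L2seq v' ->
    is_st u' f x' v' -> {ae P, forall w, x' 0%N w = x 0%N w} ->
    {ae P, forall w, v' 0%N w = v 0%N w} -> cost_seq X u x <= cost_seq X u' x') ->
  forall n, (n < N)%N -> forall eta, vL2 n eta -> alpha * vE (u n) eta = vE (Y2 n.+1) eta.
Proof.
move=> S Lv H k kN eta Le.
pose V n : vec := if n == k then eta else fun=> 0.
have LV n : (n < N)%N -> vL2 n (V n).
  by rewrite /V; case: eqP => [-> //|_ _]; exact: vL2_cst.
have L0 n : (n < N)%N -> vL2 n (fun _ : Om => 0 : 'rV[R]_m) by move=> _; exact: vL2_cst.
pose z n := (st 0 0 V (fun _ _ => 0) n).1; pose zv n := (st 0 0 V (fun _ _ => 0) n).2.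
have Lz : L2seq z by move=> n nN; exact: (st_L2 0 0 LV L0 nN).1.
have Lzv : L2seq zv by move=> n nN; exact: (st_L2 0 0 LV L0 nN).2.
have zstep n w := st_step 0 0 V (fun _ _ => 0) n w.
pose Q := tau * (\sum_(n < N) (vE (z n) (z n) + alpha * vE (V n) (V n))) + beta * vE (z N) (z N).
have key e : 0 <= 2 * tau * (alpha * vE (u k) eta - vE (Y2 k.+1) eta) * e + Q * e ^+ 2.
  pose Ve n w := e *: V n w; pose ze n w := e *: z n w; pose zve n w := e *: zv n w.
  have LVe n : (n < N)%N -> vL2 n (Ve n).
    by move=> nN; apply: vL2Z; [exact: hG (ltnW nN)|exact: LV].
  have Lze : L2seq ze by move=> n nN; apply: vL2Z; [exact: hG|exact: Lz].
  have Lzve : L2seq zve by move=> n nN; apply: vL2Z; [exact: hG|exact: Lzv].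
  have Sz n w : step_eq n (Ve n w) 0 (ze n w) (zve n w) (ze n.+1 w) (zve n.+1 w) w.
    have [h1 h2] := zstep n w; rewrite /ze /zve /Ve; split.
      by rewrite -scalerBr h1 -scalerDr !scalerA mulrC.
    rewrite -scalerBr h2 -scalerDr -scalemxAl !addr0 !scalerDr !scalerA.
    by rewrite (mulrC e a) (mulrC e tau) (mulrC e (h n w * gamma)).
  have := H (fun n w => u n w + Ve n w) (fun n w => x n w + ze n w) (fun n w => v n w + zve n w).
  rewrite (cost_increment LVe Lze Lzve); last 3 first.
  - by move=> n nN; apply: aeW => w.
  - by apply: aeW => w; rewrite /ze scaler0.
  - by apply: aeW => w; rewrite /zve scaler0.
  rewrite -addrA lerDl.
  have -> : \sum_(n < N) (alpha * vE (u n) (Ve n) - vE (Y2 n.+1) (Ve n)) =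
      (alpha * vE (u k) eta - vE (Y2 k.+1) eta) * e.
    rewrite (bigD1 (Ordinal kN))//= big1 ?addr0; last first.
      move=> n nk; have nN := ltn_ord n.
      have SV : vS P (V n) by exact: vS_of (ltnW nN) (LV n nN).
      have V0 y : vE y (V n) = 0.
        rewrite /V (negbTE (nk : n != k :> nat)) /vE big1// => j _; rewrite iprC.
        by under [X in ipr _ _ X]funext do rewrite mxE; exact: ipr0l.
      rewrite (vEZr e SV (vS_of (ltnW nN) (Lu nN))) (vEZr e SV (vS_of nN (L2 nN))).
      by rewrite !V0 !mulr0 subrr.
    have Se := vS_of (ltnW kN) Le.
    rewrite /Ve /V eqxx (vEZr e Se (vS_of (ltnW kN) (Lu kN))) (vEZr e Se (vS_of kN (L2 kN))).
    by ring.
  have -> : tau * (\sum_(n < N) (vE (ze n) (ze n) + alpha * vE (Ve n) (Ve n))) + beta * vE (ze N) (ze N)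
      = Q * e ^+ 2.
    have sq (p : vec) : vS P p -> vE (fun w => e *: p w) (fun w => e *: p w) = vE p p * e ^+ 2.
      by move=> Sp; rewrite vEZl ?vEZr//; [ring|exact: vSZ].
    rewrite (sq _ (vS_of (leqnn N) (Lz _ (leqnn N)))).
    rewrite (eq_bigr (fun n : 'I_N => (vE (z n) (z n) + alpha * vE (V n) (V n)) * e ^+ 2)).
      by rewrite -mulr_suml /Q; ring.
    move=> n _; have nN := ltn_ord n.
    rewrite (sq _ (vS_of (ltnW nN) (Lz _ (ltnW nN)))) (sq _ (vS_of (ltnW nN) (LV _ nN))); ring.
  rewrite mulrA; apply.
  - by move=> n nN; apply: vL2D; [exact: hG (ltnW nN)|exact: Lu|exact: LVe].
  - by move=> n nN; apply: vL2D; [exact: hG|exact: Lx|exact: Lze].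
  - by move=> n nN; apply: vL2D; [exact: hG|exact: Lv|exact: Lzve].
  - move=> n nN; apply: filterS (S n nN) => w [h1 h2]; have [h3 h4] := Sz n w.
    split; first by rewrite opprD addrACA h1 h3 -scalerDr addrACA.
    rewrite opprD addrACA h2 h4 addr0; apply/rowP => j; rewrite !mulmxDl !mxE; ring.
  - by apply: aeW => w; rewrite /ze scaler0 addr0.
  - by apply: aeW => w; rewrite /zve scaler0 addr0.
apply/eqP; rewrite -subr_eq0; apply/eqP.
move: key; set B := alpha * _ - _ => key.
have Q0 : 0 <= Q.
  rewrite addr_ge0 ?mulr_ge0 ?vE_ge0 ?(ltW tau0)// sumr_ge0// => n _.
  by rewrite addr_ge0 ?mulr_ge0 ?vE_ge0 ?(ltW alpha0).
have Q1 : 0 < Q + 1 by lra.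
(* close to the minimizer of the quadratic in e; the 1 in Q + 1 keeps the
   denominator positive when Q vanishes *)
have := key (- (tau * B) / (Q + 1)).
rewrite (_ : _ + _ = - (tau * B) ^+ 2 * ((Q + 2) / (Q + 1) ^+ 2)); last first.
  by field; rewrite gt_eqF.
rewrite mulNr oppr_ge0 pmulr_lle0; last by rewrite divr_gt0 ?exprn_gt0//; lra.
move=> h'; have /eqP : (tau * B) ^+ 2 = 0 by apply/le_anti; rewrite h' sqr_ge0.
by rewrite sqrf_eq0 mulf_eq0 (gt_eqF tau0) => /eqP.
Qed.

End Optimality.

End DiscreteLQ.

(** * Step processes *)

Section TimeGrid.
Context (R : realType) (T : R) (N : nat).
Hypothesis hT : 0 < T.
Hypothesis hN : (0 < N)%N.
Local Notation tau := (tau T N).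
Local Notation tn := (tn T N).

Lemma tau_gt0 : 0 < tau.
Proof. by rewrite /tau divr_gt0// ltr0n. Qed.

Lemma tn0 : tn 0 = 0. Proof. by rewrite /tn mul0r. Qed.

Lemma tnN : tn N = T.
Proof. by rewrite /tn /tau mulrC divfK// pnatr_eq0 -lt0n. Qed.

Lemma tnS n : tn n.+1 = tn n + tau.
Proof. by rewrite /tn -addn1 natrD mulrDl mul1r. Qed.

Lemma tn_ge0 n : 0 <= tn n.
Proof. by rewrite mulr_ge0// ltW// tau_gt0. Qed.

Lemma ltr_tn n k : (tn n < tn k) = (n < k)%N.
Proof. by rewrite ltr_pM2r ?tau_gt0// ltr_nat. Qed.

Lemma ler_tn n k : (tn n <= tn k) = (n <= k)%N.
Proof. by rewrite ler_pM2r ?tau_gt0// ler_nat. Qed.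

Lemma tn_le n : (n <= N)%N -> tn n <= T.
Proof. by rewrite -ler_tn tnN. Qed.

Lemma tn_lt n : (n < N)%N -> tn n < T.
Proof. by rewrite -ltr_tn tnN. Qed.

Lemma tn_itvcc n : (n <= N)%N -> tn n \in `[0, T].
Proof. by move=> nN; rewrite in_itv/= tn_ge0 tn_le. Qed.

Lemma tn_itvco n : (n < N)%N -> tn n \in `[0, T[.
Proof. by move=> nN; rewrite in_itv/= tn_ge0 tn_lt. Qed.

Definition slot (t : R) : nat := Num.truncn (t / tau).

Lemma slot_eq t n : tn n <= t -> t < tn n.+1 -> slot t = n.
Proof.
move=> h1 h2; apply: truncn_def; rewrite ler_pdivlMr ?tau_gt0// ltr_pdivrMr ?tau_gt0//.
by rewrite h1.
Qed.

Lemma slot_tn n : slot (tn n) = n.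
Proof. by apply: slot_eq => //; rewrite ltr_tn. Qed.

Lemma slot_le t : 0 <= t -> tn (slot t) <= t.
Proof.
move=> t0; have q0 : 0 <= t / tau by rewrite divr_ge0 ?(ltW tau_gt0).
by rewrite -ler_pdivlMr ?tau_gt0// truncn_le.
Qed.

Lemma slot_gt t : t < tn (slot t).+1.
Proof. by rewrite -ltr_pdivrMr ?tau_gt0// truncnS_gt. Qed.

Lemma slot_ltN t : 0 <= t -> t < T -> (slot t < N)%N.
Proof. by move=> t0 tT; rewrite -ltr_tn tnN; exact: le_lt_trans (slot_le t0) tT. Qed.

Lemma slot_leN t : 0 <= t -> t <= T -> (slot t <= N)%N.
Proof. by move=> t0 tT; rewrite -ler_tn tnN; exact: le_trans (slot_le t0) tT. Qed.

Lemma integral_step (phi : R -> R) : (forall t, 0 <= phi t) ->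
  (forall n t, (n < N)%N -> tn n <= t -> t < tn n.+1 -> phi t = phi (tn n)) ->
  (\int[@lebesgue_measure R]_(t in `]0%R, T[) (phi t)%:E =
   (tau * \sum_(n < N) phi (tn n))%:E)%E.
Proof.
move=> phi0 hphi.
transitivity (\int[@lebesgue_measure R]_(t in `]0%R, T[)
    \sum_(n < N) ((phi (tn n))%:E * (\1_(`[tn n, tn n.+1[%classic) t)%:E))%E.
  apply: eq_integral => t; rewrite inE/= in_itv/= => /andP[t0 tT].
  have sN := slot_ltN (ltW t0) tT; pose k := Ordinal sN.
  rewrite (bigD1 k)//= big1 ?adde0; last first.
    move=> n nk; rewrite indicE memNset ?mule0//= in_itv/= => /andP[h1 h2].
    by case/negP: nk; apply/eqP/val_inj => /=; rewrite (slot_eq h1 h2).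
  rewrite indicE mem_set ?mule1; last by rewrite /= in_itv/= slot_le ?slot_gt// ltW.
  by rewrite -(hphi (slot t) t)// ?slot_gt ?slot_le// ltW.
rewrite ge0_integral_sum//; last 2 first.
- by move=> n; apply: emeasurable_funM; apply/measurable_EFinP => //; exact: measurable_funTS (measurable_indic _ _).
- by move=> n t _; rewrite -EFinM lee_fin mulr_ge0.
rewrite mulr_sumr -sumEFin; apply: eq_bigr => n _.
rewrite ge0_integralZl//; last 2 first.
- by apply/measurable_EFinP; apply: measurable_funTS; exact: measurable_indic.
- by rewrite lee_fin.
rewrite integral_indic// EFinM muleC; congr (_ * _)%E.
have nN := ltn_ord n.
have lenS : ((tn n.+1)%:E - (tn n)%:E = tau%:E)%E.
  by rewrite -EFinD tnS addrAC subrr add0r.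
have [n0|n0] := posnP n.
  rewrite (_ : _ `&` _ = `]tn n, tn n.+1[%classic); last first.
    apply/seteqP; split=> t /=; rewrite !in_itv/= n0 tn0.
      by move=> [/andP[h1 h2] /andP[h3 h4]]; rewrite h3.
    move=> /andP[h1 h2]; rewrite h1 h2 (ltW h1); split=> //=.
    by apply: lt_le_trans h2 _; rewrite tn_le// -n0.
  by rewrite -lenS; have := lebesgue_measure_itv `]tn n, tn n.+1[; rewrite /= lte_fin ltr_tn ltnSn.
rewrite (_ : _ `&` _ = `[tn n, tn n.+1[%classic); last first.
  apply/seteqP; split=> t /=; first by case.
  rewrite !in_itv/= => /andP[h1 h2]; rewrite h1 h2; split=> //.
  rewrite (lt_le_trans _ h1) ?(lt_le_trans h2) ?tn_le//.
  by rewrite -tn0 ltr_tn.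
by rewrite -lenS; have := lebesgue_measure_itv `[tn n, tn n.+1[; rewrite /= lte_fin ltr_tn ltnSn.
Qed.

End TimeGrid.

Section Processes.
Context (R : realType) (d : nat) (D : set 'rV[R]_d) (Th : set (simplex R d)).
Local Notation F := (funRd R d).
Local Notation V_h := (Vh D Th).
Context (m : nat) (e : 'I_m -> F).
Hypothesis fr : vh_frame D Th e.
Context (dd : measure_display) (Om : measurableType dd) (P : probability Om R).
Context (T : R) (W : R -> Om -> R) (N : nat).
Hypothesis hP : measure_is_complete P.
Hypothesis hW : wiener P T W.
Hypothesis hT : 0 < T.
Hypothesis hN : (0 < N)%N.
Local Notation tau := (tau T N).
Local Notation tn := (tn T N).
Local Notation process := (R -> Om -> F).
Local Notation coe := (co D e).
Local Notation vec := (Om -> 'rV[R]_m).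

Definition filt_gen (t : R) : set (set Om) :=
  [set A | exists s (B : set R), [/\ 0 <= s, s <= t, measurable B &
         A = W s @^-1` B]] `|` [set A | P.-negligible A].

Local Notation G n := <<s filt_gen (tn n) >>.

Lemma dot_ge0 (x : 'rV[R]_m) : 0 <= dot x x.
Proof. by apply: sumr_ge0 => j _; rewrite -expr2 sqr_ge0. Qed.

Lemma L2norm_Vh u : V_h u -> L2norm D u = Num.sqrt (dot (coe u) (coe u)).
Proof.
by move=> Vu; rewrite -(L2norm_co fr Vu) sqrtr_sqr ger0_norm// /L2norm sqrtr_ge0.
Qed.

(** Polarization expresses the coordinates of X by the norms of X and X -
    e_j, and the norm of X - v is a continuous function of the coordinates. *)
Lemma K_rvP (C : set (set Om)) (X : Om -> F) :
  K_rv <<s C >> V_h (L2norm D) X <->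
  (forall w, V_h (X w)) /\ forall j, Gmeas <<s C >> (fun w => coe (X w) 0 j).
Proof.
have Ve := frame_in fr; have hD := frame_dom fr.
split=> [[VX mX]|[VX mX]]; split=> //.
  move=> j.
  have M v : V_h v -> Gmeas <<s C >> (fun w => L2norm D (X w - v) ^+ 2).
    by move=> Vv; apply/GmeasP; apply: measurable_funX; apply/GmeasP; exact: mX.
  rewrite (_ : (fun w => _) = (fun w => 2^-1 * (L2norm D (X w - 0) ^+ 2
      - L2norm D (X w - e j) ^+ 2 + 1))); last first.
    apply/funext => w; have LX := Vh_L2 (VX w); have Le := Vh_L2 (Ve j).
    have LB := L2B hD LX Le.
    rewrite subr0 !L2norm_sq (ipBl hD LX Le LB) (ipBr hD LX Le LX) (ipBr hD LX Le Le).
    rewrite (frame_on fr) eqxx mulr1n [ip D (e j) _]ipC [coe _ 0 j]mxE.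
    by move: (ip D (X w) (e j)) (ip D (X w) (X w)) => p q; lra.
  apply/GmeasP; apply: measurable_funM => //; apply: measurable_funD => //.
  by apply: measurable_funB; apply/GmeasP; apply: M => //; exact: Vh0.
move=> v Vv.
suff : Gmeas <<s C >> (fun w => L2norm D (X w - v)) by [].
rewrite (_ : (fun w => _) = (fun w => Num.sqrt (dot (coe (X w) - coe v) (coe (X w) - coe v)))); last first.
  by apply/funext => w; rewrite L2norm_Vh ?(coB fr)//; exact: (VhB fr).
apply/GmeasP; apply: measurableT_comp.
  by apply: continuous_measurable_fun; exact: sqrt_continuous.
apply: measurable_sum => j; rewrite (_ : (fun w => _) = (fun w => (coe (X w) 0 j - coe v 0 j) ^+ 2)).
  by apply: measurable_funX; apply: measurable_funB => //; apply/GmeasP.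
by apply/funext => w; rewrite !mxE expr2.
Qed.


Lemma K_rv_mono (G1 G2 : set (set Om)) K (nrm : F -> R) X : G1 `<=` G2 ->
  K_rv G1 K nrm X -> K_rv G2 K nrm X.
Proof. by move=> h [h1 h2]; split=> // v Kv B mB; apply: h; exact: h2. Qed.

Lemma G_measurable n : (n <= N)%N -> G n `<=` measurable.
Proof. by move=> nN; apply: (filt_measurable hP hW); exact: tn_le. Qed.

Lemma G_mono n k : (n <= k)%N -> G n `<=` G k.
Proof. by move=> nk; apply: filt_mono; rewrite ler_tn. Qed.

Lemma G_noise n : (n < N)%N -> Gmeas (G n.+1) (dW W T N n.+1).
Proof.
move=> nN.
have mW k : (k <= n.+1)%N -> Gmeas (G n.+1) (W (tn k)).
  move=> kn B mB; apply: sub_gen_smallest; left; exists (tn k), B; split => //.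
    exact: tn_ge0.
  by rewrite ler_tn.
apply/GmeasP; apply: measurable_funB; apply/GmeasP; exact: mW.
Qed.

Lemma noise_second_moment : exists c : nat -> R, (forall n, (n < N)%N -> 0 <= c n) /\
  forall n, (n < N)%N -> forall B, G n B ->
    (\int[P]_(w in B) (dW W T N n.+1 w ^+ 2)%:E = (c n)%:E * P B)%E.
Proof.
have /choice[c hc] : forall n, exists c : R, (n < N)%N -> 0 <= c /\ forall B, G n B ->
    (\int[P]_(w in B) (dW W T N n.+1 w ^+ 2)%:E = c%:E * P B)%E.
  move=> n; have [nN|/negP nN] := boolP (n < N)%N; last by exists 0.
  have [c c0 hc] := increment_second_moment hP hW (tn_ge0 hT hN n)
    (ltac:(by rewrite ltr_tn) : tn n < tn n.+1) (tn_le hT hN nN).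
  by exists c.
exists c; split=> [n nN|n nN]; first by have [] := hc n nN.
by have [_] := hc n nN.
Qed.

Lemma integral_dot (x : vec) : (forall j, measurable_fun setT (fun w => x w 0 j)) ->
  (\int[P]_w (dot (x w) (x w))%:E = \sum_j \int[P]_w (x w 0 j ^+ 2)%:E)%E.
Proof.
move=> mx; rewrite -ge0_integral_sum//.
- by apply: eq_integral => w _; rewrite sumEFin; congr EFin; apply: eq_bigr => j _; rewrite expr2.
- by move=> j; apply/measurable_EFinP; exact: measurable_funX.
- by move=> j w _; rewrite lee_fin sqr_ge0.
Qed.

Lemma integral_dot_vE (x : vec) : vS P x ->
  (\int[P]_w (dot (x w) (x w))%:E = (vE P x x)%:E)%E.
Proof.
move=> sx; rewrite integral_dot; last by move=> j; exact: (sx j).1.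
by rewrite /vE -sumEFin; apply: eq_bigr => j _; rewrite ipr_sqE.
Qed.

Lemma vS_dot (x : vec) : (forall j, measurable_fun setT (fun w => x w 0 j)) ->
  (\int[P]_w (dot (x w) (x w))%:E < +oo)%E -> vS P x.
Proof.
move=> mx If j; split=> //; apply: le_lt_trans If; rewrite integral_dot//.
rewrite (bigD1 j)//= leeDl// sume_ge0// => k _; apply: integral_ge0 => w _.
by rewrite lee_fin sqr_ge0.
Qed.

Lemma measurable_dot (x : vec) : (forall j, measurable_fun setT (fun w => x w 0 j)) ->
  measurable_fun setT (fun w => dot (x w) (x w)).
Proof. by move=> mx; apply: measurable_sum => j; exact: measurable_funM. Qed.

Lemma L2tx_step (f : R -> F) : (forall n, (n < N)%N -> V_h (f (tn n))) ->
  (forall n t, (n < N)%N -> tn n <= t -> t < tn n.+1 -> f t = f (tn n)) ->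
  L2tx_sq D T f = (tau * \sum_(n < N) dot (coe (f (tn n))) (coe (f (tn n))))%:E.
Proof.
move=> Vf sf; rewrite /L2tx_sq.
rewrite (integral_step hT hN (phi := fun t => L2norm D (f t) ^+ 2)).
- by congr (_ * _)%:E; apply: eq_bigr => n _; rewrite (L2norm_co fr)//; exact: Vf.
- by move=> t; rewrite sqr_ge0.
- by move=> n t nN h1 h2; rewrite (sf n t).
Qed.

Section StepSequences.
Context (u : nat -> vec).
Hypothesis mu : forall n, (n < N)%N -> forall j, measurable_fun setT (fun w => u n w 0 j).

Lemma integral_sum_dot : (\int[P]_w (tau * \sum_(n < N) dot (u n w) (u n w))%:E =
  tau%:E * \sum_(n < N) \int[P]_w (dot (u n w) (u n w))%:E)%E.
Proof.
have md (n : 'I_N) : measurable_fun setT (fun w => (dot (u n w) (u n w))%:E).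
  by apply/measurable_EFinP; apply: measurable_dot; exact: mu.
rewrite -ge0_integral_sum//; last by move=> n w _; rewrite lee_fin dot_ge0.
rewrite -ge0_integralZl//.
- by apply: eq_integral => w _; rewrite sumEFin -EFinM.
- exact: emeasurable_sum.
- by move=> w _; apply: sume_ge0 => n _; rewrite lee_fin dot_ge0.
- by rewrite lee_fin ltW// tau_gt0.
Qed.

Lemma integral_sum_dot_vE : (forall n, (n < N)%N -> vS P (u n)) ->
  (\int[P]_w (tau * \sum_(n < N) dot (u n w) (u n w))%:E =
   (tau * \sum_(n < N) vE P (u n) (u n))%:E)%E.
Proof.
move=> su; rewrite integral_sum_dot (EFinM tau) -sumEFin; congr (_ * _)%E.
by apply: eq_bigr => n _; rewrite integral_dot_vE//; exact: su.
Qed.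

(** A finite sum of nonnegative integrals is finite only if each of them is. *)
Lemma vS_sum_dot : (\int[P]_w (tau * \sum_(n < N) dot (u n w) (u n w))%:E < +oo)%E ->
  forall n, (n < N)%N -> vS P (u n).
Proof.
move=> If n nN; apply: vS_dot; first exact: mu.
have [//|/negP H] := boolP (\int[P]_w (dot (u n w) (u n w))%:E < +oo)%E.
exfalso; move: If; rewrite integral_sum_dot (bigD1 (Ordinal nN))//=.
have -> : (\int[P]_w (dot (u n w) (u n w))%:E = +oo)%E.
  by apply/eqP; rewrite -leye_eq leNgt; exact/negP.
rewrite addye; last first.
  rewrite gt_eqF//; apply: lt_le_trans (ltNyr 0) _; apply: sume_ge0 => k _.
  by apply: integral_ge0 => w _; rewrite lee_fin dot_ge0.
by rewrite gt0_muley ?lte_fin ?tau_gt0// ltxx.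
Qed.

End StepSequences.

(** The step process with given coordinates on the time grid. *)
Definition proc (u : nat -> vec) : process := fun t w => syn e (u (slot T N t) w).

Lemma proc_tn u n w : proc u (tn n) w = syn e (u n w).
Proof. by rewrite /proc slot_tn. Qed.

Lemma co_proc u n w : coe (proc u (tn n) w) = u n w.
Proof. by rewrite proc_tn (synK fr). Qed.

Lemma proc_step u n t : tn n <= t -> t < tn n.+1 -> proc u t = proc u (tn n).
Proof. by move=> h1 h2; rewrite /proc (slot_eq hT hN h1 h2) slot_tn. Qed.

(** The time integral of the squared norm of a step process is a finite sum,
    so that its expectation is finite exactly when the values on the grid
    are square integrable. *)
Lemma step_processP (I : set R) X : (forall n, (n < N)%N -> I (tn n)) ->
  step_process D Th P W T N I X -> forall n, (n < N)%N ->
  (forall w, V_h (X (tn n) w)) /\ vL2 P (G n) (fun w => coe (X (tn n) w)).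
Proof.
move=> hI [KX IX sX].
have K n (nN : (n < N)%N) := (K_rvP (filt_gen (tn n)) (X (tn n))).1 (KX _ (hI n nN)).
have VX n (nN : (n < N)%N) w : V_h (X (tn n) w) by have [] := K n nN.
have S n : (n < N)%N -> vS P (fun w => coe (X (tn n) w)).
  apply: (vS_sum_dot (u := fun n w => coe (X (tn n) w))) => [k kN j|].
    by apply: (Gmeas_measurable (G_measurable (ltnW kN))); have [_] := K k kN.
  move: IX; congr (_ < _)%E; apply: eq_integral => w _.
  apply: (L2tx_step (f := X^~ w)) => [k kN|k t kN h1 h2]; first exact: VX.
  by rewrite (sX k t).
move=> n nN; have [V GX] := K n nN; split=> // j.
by apply/(L2GE P (G_measurable (ltnW nN))); split; [exact: GX|exact: S].
Qed.

Lemma proc_K_rv u t : vL2 P (G (slot T N t)) (u (slot T N t)) -> 0 <= t ->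
  K_rv (filt P W t) V_h (L2norm D) (proc u t).
Proof.
move=> Lu t0; apply: (@K_rv_mono (G (slot T N t))).
  by apply: filt_mono; exact: slot_le.
apply/K_rvP; split=> [w|j]; first exact: (Vh_syn fr).
have [+ _] := Lu j; congr Gmeas; apply/funext => w.
by rewrite (synK fr).
Qed.

Lemma proc_step_process (I : set R) u :
  (forall t, I t -> 0 <= t /\ vL2 P (G (slot T N t)) (u (slot T N t))) ->
  (forall n, (n < N)%N -> vL2 P (G n) (u n)) ->
  step_process D Th P W T N I (proc u).
Proof.
move=> hI Lu; split.
- by move=> t /hI[t0 Lt]; exact: proc_K_rv.
- rewrite (eq_integral (fun w => (tau * \sum_(n < N) dot (u n w) (u n w))%:E)); last first.
    move=> w _; rewrite (L2tx_step (f := (proc u)^~ w)).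
    + by congr (_ * _)%:E; apply: eq_bigr => n _; rewrite co_proc.
    + by move=> n nN; rewrite proc_tn; exact: (Vh_syn fr).
    + by move=> n t nN h1 h2; rewrite (proc_step _ h1 h2).
  have Su n : (n < N)%N -> vS P (u n).
    by move=> nN; exact: (vL2_vS (G_measurable (ltnW nN)) (Lu n nN)).
  by rewrite integral_sum_dot_vE ?ltry// => n nN j; exact: (Su n nN j).1.
- by move=> n t _; exact: proc_step.
Qed.

Lemma controlP U : control_space D Th P W T N U -> forall n, (n < N)%N ->
  (forall w, V_h (U (tn n) w)) /\ vL2 P (G n) (fun w => coe (U (tn n) w)).
Proof. by move=> hU; apply: (step_processP _ hU) => n nN; exact: tn_itvco. Qed.

Lemma proc_control u : (forall n, (n < N)%N -> vL2 P (G n) (u n)) ->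
  control_space D Th P W T N (proc u).
Proof.
move=> Lu; apply: proc_step_process => // t /=; rewrite in_itv/= => /andP[t0 tT].
by split=> //; apply: Lu; exact: slot_ltN.
Qed.

Lemma stateP X : state_space D Th P W T N X -> forall n, (n <= N)%N ->
  (forall w, V_h (X (tn n) w)) /\ vL2 P (G n) (fun w => coe (X (tn n) w)).
Proof.
move=> [sX IX] n; rewrite leq_eqVlt => /orP[/eqP ->|]; last first.
  by apply: (step_processP _ sX) => k kN; apply: tn_itvcc => //; exact: ltnW.
have [KX _ _] := sX; have := KX _ (tn_itvcc hT hN (leqnn N)).
move=> /K_rvP[VX GX]; split=> // j.
have mX k : measurable_fun setT (fun w => coe (X (tn N) w) 0 k).
  by apply: (Gmeas_measurable (G_measurable (leqnn N))); exact: GX.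
apply/(L2GE P (G_measurable (leqnn N))); split; first exact: GX.
rewrite -(tnN T hN) in IX; apply: (vS_dot mX); move: IX; congr (_ < _)%E.
by apply: eq_integral => w _; rewrite (L2norm_co fr).
Qed.

Lemma proc_state u : (forall n, (n <= N)%N -> vL2 P (G n) (u n)) ->
  state_space D Th P W T N (proc u).
Proof.
move=> Lu; split.
  apply: proc_step_process => [t /=|n nN]; last by apply: Lu; exact: ltnW.
  rewrite in_itv/= => /andP[t0 tT].
  by split=> //; apply: Lu; exact: slot_leN.
rewrite (eq_integral (fun w => (dot (u N w) (u N w))%:E)); last first.
  by move=> w _; rewrite -{1}(tnN T hN) proc_tn (L2norm_co fr) ?(synK fr)//; exact: (Vh_syn fr).
by rewrite integral_dot_vE ?ltry//; exact: (vL2_vS (G_measurable (leqnn N)) (Lu N (leqnn N))).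
Qed.

End Processes.

(** * The gradient form and upper integrals *)

Local Opaque ip ip_grad L2norm H10norm.

Lemma le_of_quadratic (R : realFieldType) (a b c : R) : 0 <= c ->
  0 <= a - 2 * (b / (c + 1)) * b + (b / (c + 1)) ^+ 2 * c -> b ^+ 2 <= (c + 1) * a.
Proof.
move=> c0 H; have c1 : 0 < c + 1 by lra.
have : 0 <= (c + 1) * (a - 2 * (b / (c + 1)) * b + (b / (c + 1)) ^+ 2 * c).
  by rewrite mulr_ge0// ltW.
rewrite (_ : _ * _ = (c + 1) * a - b ^+ 2 - b ^+ 2 / (c + 1)); last by field; rewrite gt_eqF.
have : 0 <= b ^+ 2 / (c + 1) by rewrite divr_ge0 ?sqr_ge0// ltW.
by move: (b ^+ 2 / (c + 1)) ((c + 1) * a) (b ^+ 2) => x y z; lra.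
Qed.

Section GradientForm.
Context (R : realType) (d : nat) (D : set 'rV[R]_d).
Hypothesis hD : bounded_domain D.
Local Notation F := (funRd R d).
Implicit Types u v : F.

Lemma ip_gradB_sq s u v : H10 D u -> H10 D v ->
  ip_grad D (u - s *: v) (u - s *: v) =
  ip_grad D u u - 2 * s * ip_grad D u v + s ^+ 2 * ip_grad D v v.
Proof.
move=> Hu Hv; have Hs := H10Z hD (- s) Hv; have HB := H10D hD Hu Hs.
rewrite -scaleNr (ip_gradDl hD Hu Hs HB) (ip_gradZl hD _ Hv HB).
rewrite !(ip_gradC D _ (u + _)) (ip_gradDl hD Hu Hs Hu) (ip_gradDl hD Hu Hs Hv).
rewrite !(ip_gradZl hD _ Hv) // (ip_gradC D v u).
by move: (ip_grad D u u) (ip_grad D u v) (ip_grad D v v) => p q r; ring.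
Qed.

Lemma ip_grad_polar u v : H10 D u -> H10 D v ->
  ip_grad D u v = 2^-1 * (ip_grad D u u - ip_grad D (u - v) (u - v) + ip_grad D v v).
Proof.
move=> Hu Hv; have := ip_gradB_sq 1 Hu Hv; rewrite scale1r => ->.
by move: (ip_grad D u u) (ip_grad D u v) (ip_grad D v v) => p q r; lra.
Qed.

(** A weak form of the Cauchy-Schwarz inequality, from the nonnegativity of
    the form at u - s v with s = (u, v) / ((v, v) + 1); adding 1 avoids a
    case distinction on (v, v) = 0. *)
Lemma ip_grad_bound u v : H10 D u -> H10 D v ->
  ip_grad D u v ^+ 2 <= (ip_grad D v v + 1) * ip_grad D u u.
Proof.
move=> Hu Hv; apply: le_of_quadratic (ip_grad_ge0 D v) _.
by rewrite -(ip_gradB_sq _ Hu Hv); exact: ip_grad_ge0.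
Qed.

End GradientForm.

(** The integral of a nonnegative function is the supremum over the simple
    functions below it, which allows comparison with any larger function,
    for instance with the supremum in time of the norm of sigma. *)
Lemma ge0_integral_mono (R : realType) (dd : measure_display) (Om : measurableType dd)
  (P : probability Om R) (f g : Om -> \bar R) : (forall w, 0 <= f w)%E ->
  (forall w, f w <= g w)%E -> (\int[P]_w f w <= \int[P]_w g w)%E.
Proof.
move=> f0 fg; have g0 w : (0 <= g w)%E by exact: le_trans (f0 w) (fg w).
rewrite !ge0_integralTE//; apply: ereal_sup_le => _ [p pf <-].
by exists p => // w; exact: le_trans (pf w) (fg w).
Qed.

(** * Conditional expectation in the finite element space *)

Local Opaque ip ip_grad L2norm H10norm.

Section CondExpUnique.
Context (R : realType) (dd : measure_display) (Om : measurableType dd).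
Context (P : probability Om R) (C : set (set Om)).
Local Notation G := <<s C >>.
Hypothesis hG : G `<=` measurable.

Lemma Gmeas_sg (f : Om -> R) : Gmeas G f -> Gmeas G (fun w => Num.sg (f w)).
Proof.
move=> Gf.
apply/GmeasP; apply: (measurableT_comp (f := @Num.sg R)); last exact/GmeasP.
apply: nondecreasing_measurable => // x y xy.
rewrite /Num.sg; case: (ltgtP x 0) => hx; case: (ltgtP y 0) => hy //=; lra.
Qed.

(** The sign of f - g is an admissible weight, so that E |f - g| = 0. *)
Lemma condexp_unique (f g : Om -> R) : Gmeas G f -> Gmeas G g ->
  P.-integrable setT (EFin \o f) -> P.-integrable setT (EFin \o g) ->
  (forall A, G A -> \int[P]_(w in A) (f w)%:E = \int[P]_(w in A) (g w)%:E)%E ->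
  {ae P, forall w, f w = g w}.
Proof.
move=> Gf Gg If Ig H; pose s w := Num.sg (f w - g w).
have Gs : Gmeas G s by apply: Gmeas_sg; apply/GmeasP; apply: measurable_funB; exact/GmeasP.
have ms := Gmeas_measurable hG Gs.
have Is (u : Om -> R) : P.-integrable setT (EFin \o u) -> P.-integrable setT (fun w => (s w * u w)%:E).
  move=> Iu; apply: (le_integrable measurableT _ _ Iu).
    apply/measurable_EFinP; apply: measurable_funM => //.
    by apply/measurable_EFinP; exact: measurable_int Iu.
  move=> w _ /=; rewrite lee_fin normrM ler_piMl// normr_sg.
  by case: (_ != 0).
have E := integral_weight hG Gs If Ig (Is f If) (Is g Ig) H.
have ID : P.-integrable setT (fun w => (f w - g w)%:E).
  have := integrableB measurableT If Ig; congr (_.-integrable _ _).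
have : (\int[P]_w `|(f w - g w)%:E| = 0)%E.
  rewrite (eq_integral (fun w => (s w * f w)%:E - (s w * g w)%:E)%E); last first.
    by move=> w _; rewrite -EFinB -mulrBr /s -normrEsg.
  rewrite integralB ?E ?subee//; [|exact: Is|exact: Is].
  exact: integrable_fin_num (Is g Ig).
have mD : measurable_fun setT (fun w => (f w - g w)%:E) by exact: measurable_int ID.
move=> /(ae_eq_integral_abs P measurableT mD); apply: filterS => w /(_ I) [] /eqP.
by rewrite subr_eq0 => /eqP.
Qed.

End CondExpUnique.
Section CondExpVh.
Context (R : realType) (d : nat) (D : set 'rV[R]_d) (Th : set (simplex R d)).
Local Notation F := (funRd R d).
Local Notation V_h := (Vh D Th).
Context (m : nat) (e : 'I_m -> F).
Hypothesis fr : vh_frame D Th e.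
Context (dd : measure_display) (Om : measurableType dd) (P : probability Om R).
Local Notation coe := (co D e).
Local Notation vec := (Om -> 'rV[R]_m).

Lemma L2norm_le_sum u : V_h u -> L2norm D u <= \sum_j `|coe u 0 j|.
Proof.
move=> Vu; have S0 : 0 <= \sum_j `|coe u 0 j| by apply: sumr_ge0.
rewrite (L2norm_Vh fr Vu) -[leRHS]ger0_norm// -sqrtr_sqr ler_wsqrtr// expr2 mulr_suml.
apply: ler_sum => j _; rewrite -expr2 -real_normK ?num_real// expr2.
by apply: ler_wpM2l => //; rewrite (bigD1 j)//= lerDl sumr_ge0.
Qed.

Lemma co_le_L2norm u j : V_h u -> `|coe u 0 j| <= L2norm D u.
Proof.
move=> Vu; rewrite (L2norm_Vh fr Vu) -sqrtr_sqr ler_wsqrtr// /dot (bigD1 j)//= -expr2.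
by rewrite lerDl sumr_ge0// => i _; rewrite -expr2 sqr_ge0.
Qed.

Lemma L2norm_integral_lty (X : Om -> F) : (forall w, V_h (X w)) ->
  (forall j, P.-integrable setT (fun w => (coe (X w) 0 j)%:E)) ->
  (\int[P]_w (L2norm D (X w))%:E < +oo)%E.
Proof.
move=> VX IX; apply: (@le_lt_trans _ _ (\int[P]_w (\sum_j `|coe (X w) 0 j|)%:E)%E).
  apply: ge0_integral_mono => w; first by rewrite lee_fin (L2norm_Vh fr (VX w)) sqrtr_ge0.
  by rewrite lee_fin; exact: L2norm_le_sum.
under eq_integral => w _ do rewrite -sumEFin.
rewrite ge0_integral_sum//; last first.
  move=> j; have /integrableP[mX _] := IX j.
  by apply/measurable_EFinP; apply: measurableT_comp => //; exact/measurable_EFinP.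
by apply: lte_sum_pinfty => j _; have /integrableP[_ ?] := IX j.
Qed.

Lemma co_integrable (X : Om -> F) j : (forall w, V_h (X w)) ->
  measurable_fun setT (fun w => coe (X w) 0 j) ->
  (\int[P]_w (L2norm D (X w))%:E < +oo)%E -> P.-integrable setT (fun w => (coe (X w) 0 j)%:E).
Proof.
move=> VX mX IX; apply/integrableP; split; first exact/measurable_EFinP.
apply: le_lt_trans IX; apply: ge0_integral_mono => w //.
by rewrite abse_EFin lee_fin; exact: co_le_L2norm.
Qed.

Lemma integral_ip A (X : Om -> F) phi : measurable A -> (forall w, V_h (X w)) ->
  (forall j, P.-integrable setT (fun w => (coe (X w) 0 j)%:E)) -> V_h phi ->
  (\int[P]_(w in A) (ip D (X w) phi)%:E =
   \sum_j (coe phi 0 j)%:E * \int[P]_(w in A) (coe (X w) 0 j)%:E)%E.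
Proof.
move=> mA VX IX Vphi.
have IA j : P.-integrable A (fun w => (coe (X w) 0 j)%:E).
  exact: (integrableS measurableT mA (@subsetT _ A) (IX j)).
rewrite (eq_integral (fun w => \sum_j (coe phi 0 j)%:E * (coe (X w) 0 j)%:E)%E); last first.
  move=> w _; rewrite (ip_co fr (VX w) Vphi) /dot -sumEFin.
  by apply: eq_bigr => j _; rewrite mulrC EFinM.
rewrite integral_sum//; last by move=> j; exact: integrableZl.
by apply: eq_bigr => j _; rewrite integralZl.
Qed.

Lemma vE_delta (x : vec) (a : Om -> R) j :
  vE P x (fun w => a w *: delta_mx 0 j) = ipr P setT (fun w => x w 0 j) a.
Proof.
rewrite /vE (bigD1 j)//= big1 ?addr0; last first.
  move=> i ij; rewrite iprC; under [X in ipr _ _ X]funext do rewrite !mxE eqxx (negbTE ij) mulr0.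
  exact: ipr0l.
by congr ipr; apply/funext => w; rewrite !mxE !eqxx mulr1.
Qed.

Lemma integral_indic_weight A (f : Om -> R) :
  (\int[P]_(w in A) (f w)%:E = \int[P]_w (f w * \1_A w)%:E)%E.
Proof.
rewrite integral_mkcond; apply: eq_integral => w _; rewrite patchE indicE.
by case: (w \in A); rewrite ?mulr1 ?mulr0.
Qed.

Lemma vS_integrable (z : vec) j : vS P z -> P.-integrable setT (fun w => (z w 0 j)%:E).
Proof.
move=> sz; have s1 : sqint P setT (fun=> 1 : R).
  split; first exact: measurable_cst.
  by rewrite integral_cst// expr1n mul1e; apply: le_lt_trans (probability_le1 _ _) (ltry _).
by have := sqintM measurableT s1 (sz j); congr (_.-integrable _ _); apply/funext => w; rewrite mul1r.
Qed.

Section Step.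
Context (C C' : set (set Om)) (k : Om -> R) (c : R).
Local Notation G := <<s C >>.
Local Notation G' := <<s C' >>.
Hypothesis hG' : G' `<=` measurable.
Hypothesis GG' : G `<=` G'.
Hypothesis hk : Gmeas G' k.
Hypothesis c0 : 0 <= c.
Hypothesis hsq : forall A, G A -> (\int[P]_(w in A) (k w ^+ 2)%:E = c%:E * P A)%E.

Let hG : G `<=` measurable. Proof. by move=> A /GG' /hG'. Qed.

Let sk : sqint P setT k.
Proof.
split; first exact: (Gmeas_measurable hG').
rewrite hsq; last by move=> S [[S0 SD _] _]; rewrite -(setD0 setT); exact: SD.
apply: lte_mul_pinfty => //; exact: le_lt_trans (probability_le1 P measurableT) (ltry _).
Qed.

Lemma L2G_indic A : G A -> L2G P G (\1_A : Om -> R).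
Proof.
move=> GA; split; first by apply/GmeasP; exact: measurable_indic.
apply: (@le_lt_trans _ _ (\int[P]_w 1%:E)%E).
  apply: ge0_integral_mono => w; first by rewrite lee_fin sqr_ge0.
  by rewrite lee_fin indicE; case: (_ \in _); rewrite ?expr1n ?expr0n.
by rewrite integral_cst// mul1e; apply: le_lt_trans (probability_le1 P measurableT) (ltry _).
Qed.

Lemma vL2_delta (a : Om -> R) (j : 'I_m) : L2G P G a ->
  vL2 P G (fun w => a w *: (delta_mx 0 j : 'rV[R]_m)).
Proof.
move=> La i; have := L2GZ hG (i == j)%:R La; congr L2G.
by apply/funext => w; rewrite !mxE eqxx/= mulrC.
Qed.

(** Testing the conditional expectation against indicators of events times
    basis vectors, or against all square integrable vectors, is the same. *)
Lemma condE_ae (p q : Om -> F) (z : vec) : (forall w, V_h (p w)) -> (forall w, V_h (q w)) ->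
  vS P (fun w => coe (p w)) -> vS P (fun w => coe (q w)) -> vL2 P G z ->
  (forall eta, vL2 P G eta -> vE P z eta =
     vE P (fun w => coe (p w)) eta + vE P (fun w => coe (q w)) (fun w => k w *: eta w)) ->
  {ae P, forall w, condE P D Th G (fun w => p w + k w *: q w) w = syn e (z w)}.
Proof.
move=> Vp Vq Sp Sq Lz H; have hD := frame_dom fr.
set Z := (fun w => p w + k w *: q w).
have VZ w : V_h (Z w) by apply: (VhD hD) => //; exact: (VhZ hD).
have cZ w j : coe (Z w) 0 j = coe (p w) 0 j + k w * coe (q w) 0 j.
  have Vkq := VhZ hD (k w) (Vq w).
  by rewrite /Z (coD fr (Vp w) Vkq) (coZ fr _ (Vq w)) mxE [X in _ + X]mxE.
have Sz := vL2_vS hG Lz.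
have Ip j := vS_integrable j Sp; have Iz j := vS_integrable j Sz.
have Ikq j : P.-integrable setT (fun w => (k w * coe (q w) 0 j)%:E).
  exact: (sqintM measurableT sk (Sq j)).
have IZ j : P.-integrable setT (fun w => (coe (Z w) 0 j)%:E).
  have := integrableD measurableT (Ip j) (Ikq j); congr (_.-integrable _ _).
  by apply/funext => w; rewrite cZ EFinD.
have key A j : G A -> (\int[P]_(w in A) (z w 0 j)%:E = \int[P]_(w in A) (coe (Z w) 0 j)%:E)%E.
  move=> GA; have mA := hG GA; have LA := L2G_indic GA; have SA := L2G_sqint hG LA.
  have := H _ (vL2_delta j LA).
  rewrite (_ : (fun w => k w *: _) = (fun w => (k w * \1_A w) *: delta_mx 0 j)); last first.
    by apply/funext => w; rewrite scalerA.
  rewrite !vE_delta => E.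
  have [Skl _] := sq_weight hG sk.1 c0 hsq LA.
  have Ep := iprE measurableT (Sp j) SA; have Ez := iprE measurableT (Sz j) SA.
  have Eq := iprE measurableT (Sq j) Skl.
  rewrite integral_indic_weight Ez E EFinD -Ep -Eq.
  rewrite [in RHS](eq_integral (fun w => (coe (p w) 0 j)%:E + (k w * coe (q w) 0 j)%:E)%E); last first.
    by move=> w _; rewrite cZ EFinD.
  have IpA := integrableS measurableT mA (@subsetT _ A) (Ip j).
  have IqA := integrableS measurableT mA (@subsetT _ A) (Ikq j).
  rewrite (integralD mA IpA IqA) (integral_indic_weight A (fun w => coe (p w) 0 j)).
  rewrite (integral_indic_weight A (fun w => k w * coe (q w) 0 j)); congr (_ + _)%E.
  by apply: eq_integral => w _; rewrite mulrA (mulrC (coe _ _ _)).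
have sZ : is_condE P D Th G Z (fun w => syn e (z w)).
  have Vs w : V_h (syn e (z w)) by exact: (Vh_syn fr).
  have Is j : P.-integrable setT (fun w => (coe (syn e (z w)) 0 j)%:E).
    by have := Iz j; congr (_.-integrable _ _); apply/funext => w; rewrite (synK fr).
  split.
  - apply/(K_rvP fr); split=> // j; have [+ _] := Lz j.
    by congr Gmeas; apply/funext => w; rewrite (synK fr).
  - exact: L2norm_integral_lty.
  - exact: L2norm_integral_lty.
  - move=> A phi GA Vphi; have mA := hG GA.
    rewrite (integral_ip mA Vs Is Vphi) (integral_ip mA VZ IZ Vphi).
    apply: eq_bigr => j _; rewrite -key//; congr (_ * _)%E.
    by apply: eq_integral => w _; rewrite (synK fr).
have := xgetI (fun=> 0) sZ; rewrite -/(condE P D Th G Z).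
move: (condE P D Th G Z) => zeta [/(K_rvP fr)[Vzeta Gzeta] _ Izeta Ezeta].
have /filter_forall : forall j, {ae P, forall w, coe (zeta w) 0 j = z w 0 j}.
  move=> j; apply: (condexp_unique hG (Gzeta j) (Lz j).1 _ (Iz j)).
    by apply: co_integrable => //; exact: (Gmeas_measurable hG).
  have T (X : Om -> F) A : (\int[P]_(w in A) (coe (X w) 0 j)%:E =
      \int[P]_(w in A) (ip D (X w) (e j))%:E)%E.
    by apply: eq_integral => w _; rewrite mxE.
  by move=> A GA; rewrite (key A j GA) !T; exact: Ezeta GA (frame_in fr j).
apply: filterS => w hw; rewrite -(coK fr (Vzeta w)); congr syn; exact/rowP.
Qed.

(** The conditional expectation in [Vh] is characterized by an identity on
    events for each coordinate; the forward direction compares it with the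
    square integrable candidate built from [cond_vec] and [cond_noise]. *)
Lemma condEP (p q : Om -> F) (z : vec) : (forall w, V_h (p w)) -> (forall w, V_h (q w)) ->
  vS P (fun w => coe (p w)) -> vS P (fun w => coe (q w)) -> vL2 P G z ->
  {ae P, forall w, condE P D Th G (fun w => p w + k w *: q w) w = syn e (z w)} <->
  (forall eta, vL2 P G eta -> vE P z eta =
     vE P (fun w => coe (p w)) eta + vE P (fun w => coe (q w)) (fun w => k w *: eta w)).
Proof.
move=> Vp Vq Sp Sq Lz; split; last exact: condE_ae.
move=> H eta Leta.
have [z1 [Lz1 h1]] := cond_vec hG Sp.
have [z2 [Lz2 h2]] := cond_noise hG' GG' hk c0 hsq Sq.
have S1 := vL2_vS hG Lz1; have S2 := vL2_vS hG Lz2; have Sz := vL2_vS hG Lz.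
have h12 eta' : vL2 P G eta' -> vE P (fun w => z1 w + z2 w) eta' =
    vE P (fun w => coe (p w)) eta' + vE P (fun w => coe (q w)) (fun w => k w *: eta' w).
  by move=> L'; rewrite (vEDl S1 S2 (vL2_vS hG L')) h1// h2.
rewrite -h12//; apply: vE_ae => //; [exact: vSD|exact: (vL2_vS hG Leta)|
  exact: (vL2_vS hG Leta)| |exact: aeW].
have := condE_ae Vp Vq Sp Sq (vL2D hG Lz1 Lz2) h12.
by apply: filterS2 H => w -> /(congr1 coe); rewrite !(synK fr).
Qed.

End Step.

Lemma condEP0 (C : set (set Om)) (p : Om -> F) (z : vec) : <<s C >> `<=` measurable ->
  (forall w, V_h (p w)) -> vS P (fun w => coe (p w)) -> vL2 P <<s C >> z ->
  {ae P, forall w, condE P D Th <<s C >> p w = syn e (z w)} <->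
  (forall eta, vL2 P <<s C >> eta -> vE P z eta = vE P (fun w => coe (p w)) eta).
Proof.
move=> hG Vp Sp Lz.
have h0 : Gmeas <<s C >> (fun=> 0 : R) by apply/GmeasP; exact: measurable_cst.
have hsq A : <<s C >> A -> (\int[P]_(w in A) (0 ^+ 2)%:E = 0%:E * P A)%E.
  by move=> _; rewrite mul0e expr0n; exact: integral0.
have := condEP hG (fun A (hA : <<s C >> A) => hA) h0 (lexx 0) hsq Vp Vp Sp Sp Lz.
have -> : (fun w => p w + 0 *: p w) = p.
  apply/funext => w; have E0 : 0 *: p w = 0 by exact: scale0r.
  by rewrite E0; exact: addr0.
move=> ->.
have E (eta : vec) : vE P (fun w => coe (p w)) (fun w => 0 *: eta w) = 0.
  rewrite /vE big1// => j _; rewrite iprC.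
  rewrite (_ : (fun w => (0 *: eta w) 0 j) = (fun=> 0)); first exact: ipr0l.
  by apply/funext => w; rewrite scale0r mxE.
by split=> H eta /H; rewrite E addr0.
Qed.

End CondExpVh.

(** * The state, the adjoint and the optimality system *)

Local Opaque ip ip_grad L2norm H10norm ipr vE.

Lemma shift_eq (V : zmodType) (x y z : V) : x = y - z <-> y = x + z.
Proof. by split=> ->; rewrite ?subrK ?addrK. Qed.

Lemma step_eqB (R : realType) (dd : measure_display) (Om : measurableType dd)
    (m : nat) (h : nat -> Om -> R) (A : 'M[R]_m) (tau gamma : R) n
    (u f x v x' v' u2 x2 v2 x2' v2' : 'rV[R]_m) w :
  step_eq h A tau gamma n u f x v x' v' w -> step_eq h A tau gamma n u2 f x2 v2 x2' v2' w ->
  step_eq h A tau gamma n (u2 - u) 0 (x2 - x) (v2 - v) (x2' - x') (v2' - v') w.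
Proof.
have swap (p q r s : 'rV[R]_m) : p - q - (r - s) = (p - r) - (q - s).
  by apply/rowP => j; rewrite !mxE; ring.
move=> [h1 h2] [k1 k2]; split; rewrite swap.
  by rewrite h1 k1; apply/rowP => j; rewrite !mxE; ring.
rewrite h2 k2; apply/rowP => j; rewrite !(mulmxDl, mulNmx) !mxE; ring.
Qed.

Section Forward.
Context (R : realType) (d : nat) (D : set 'rV[R]_d) (Th : set (simplex R d)).
Local Notation F := (funRd R d).
Local Notation V_h := (Vh D Th).
Context (m : nat) (e : 'I_m -> F).
Hypothesis fr : vh_frame D Th e.
Context (dd : measure_display) (Om : measurableType dd) (P : probability Om R).
Context (T : R) (W : R -> Om -> R) (N : nat).
Hypothesis hP : measure_is_complete P.
Hypothesis hW : wiener P T W.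
Hypothesis hT : 0 < T.
Hypothesis hN : (0 < N)%N.
Context (alpha beta gamma : R) (X10 X20 : F) (Xt : R -> F) (sigma : R -> Om -> F).
Hypothesis hX10 : H10 D X10.
Hypothesis hX20 : H10 D X20.
Hypothesis hXt : CtH10 D T Xt.
Hypothesis hsigma : L2F_CtH10 P D W T sigma.
Local Notation tau := (tau T N).
Local Notation tn := (tn T N).
Local Notation process := (R -> Om -> F).
Local Notation coe := (co D e).
Local Notation vec := (Om -> 'rV[R]_m).
Local Notation C n := (filt_gen P W (tn n)).
Local Notation G n := <<s C n >>.
Local Notation h n := (dW W T N n.+1).
Local Notation A := (- stiff D e).
Local Notation ritz := (ritz D Th).
Local Notation Delta := (laplace_h D Th).

Local Notation control := (control_space D Th P W T N).
Local Notation states := (state_space D Th P W T N).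
Let hD := frame_dom fr.
Let G_meas := G_measurable hP hW hT hN.
Let state_grid := stateP fr hP hW hT hN.
Let control_grid := controlP fr hP hW hT hN.

Lemma A_le0 (x : 'rV[R]_m) : \sum_j (x *m A) 0 j * x 0 j <= 0.
Proof.
have := stiff_ge0 fr x; rewrite /dot -oppr_le0 -sumrN; congr (_ <= _).
by apply: eq_bigr => j _; rewrite mulmxN [RHS]mulrC [in RHS]mxE mulrN mulrC.
Qed.

Lemma A_sym : A^T = A.
Proof. by rewrite linearN/= stiff_sym. Qed.

Lemma Vh_laplace v : V_h v -> V_h (Delta v). Proof. by move=> /(laplace_spec fr)[]. Qed.
Lemma co_laplace v : V_h v -> coe (Delta v) = coe v *m A.
Proof. by move=> /(laplace_spec fr)[_ ->]; rewrite mulmxN. Qed.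
Lemma Vh_ritz v : H10 D v -> V_h (ritz v). Proof. by move=> /(ritz_spec fr)[]. Qed.

Definition csigma n : vec := fun w => coe (ritz (sigma (tn n) w)).

Lemma sigma_H10 n w : (n <= N)%N -> H10 D (sigma (tn n) w).
Proof. by move=> nN; have [/(_ _ (tn_itvcc hT hN nN))[h _] _ _] := hsigma. Qed.

(** The coordinates of the Ritz projection are linear in the numbers (grad
    sigma, grad e_j). These are measurable by polarization, and square
    integrable since they are bounded by the H^1_0 norm, whose supremum in
    time has finite second moment. *)
Lemma csigma_L2 n : (n <= N)%N -> vL2 P (G n) (csigma n).
Proof.
move=> nN; have hG := G_meas nN.
have [/(_ _ (tn_itvcc hT hN nN))[Hs Ks] _ Is] := hsigma.
have -> : csigma n = (fun w => (\row_j ip_grad D (sigma (tn n) w) (e j)) *m invmx (stiff D e)).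
  by apply/funext => w; rewrite /csigma (ritz_spec fr (Hs w)).2.
apply: vL2M => // j.
have He : H10 D (e j) by exact: Vh_H10 (frame_in fr j).
have M v : H10 D v ->
    Gmeas (G n) (fun w => ip_grad D (sigma (tn n) w - v) (sigma (tn n) w - v)).
  move=> Hv; rewrite (_ : (fun w => _) = (fun w => H10norm D (sigma (tn n) w - v) ^+ 2)).
    by apply/GmeasP; apply: measurable_funX; apply/GmeasP; exact: Ks.
  by apply/funext => w; rewrite H10norm_sq.
have M0 : Gmeas (G n) (fun w => ip_grad D (sigma (tn n) w) (sigma (tn n) w)).
  rewrite (_ : (fun w => _) = (fun w => ip_grad D (sigma (tn n) w - 0) (sigma (tn n) w - 0))).
    exact: M (H10_0 D).
  apply/funext => w; have E : sigma (tn n) w - 0 = sigma (tn n) w by exact: subr0.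
  by rewrite E.
rewrite (_ : (fun w => _) = (fun w => ip_grad D (sigma (tn n) w) (e j))); last first.
  by apply/funext => w; rewrite mxE.
split.
  rewrite (_ : (fun w => _) = (fun w => 2^-1 * (ip_grad D (sigma (tn n) w) (sigma (tn n) w)
      - ip_grad D (sigma (tn n) w - e j) (sigma (tn n) w - e j) + ip_grad D (e j) (e j)))); last first.
    by apply/funext => w; exact: (ip_grad_polar hD (Hs w) He).
  apply/GmeasP; apply: measurable_funM => //; apply: measurable_funD => //.
  by apply: measurable_funB; apply/GmeasP; [exact: M0|exact: M].
set K := ip_grad D (e j) (e j) + 1.
have K0 : 0 <= K by rewrite addr_ge0// ip_grad_ge0.
have mn : measurable_fun setT (fun w => (ip_grad D (sigma (tn n) w) (sigma (tn n) w))%:E).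
  by apply/measurable_EFinP; exact: (Gmeas_measurable hG).
apply: (@le_lt_trans _ _ (\int[P]_w (K%:E * (ip_grad D (sigma (tn n) w) (sigma (tn n) w))%:E))%E).
  apply: ge0_integral_mono => w; first by rewrite lee_fin sqr_ge0.
  by rewrite -EFinM lee_fin; exact: ip_grad_bound.
rewrite ge0_integralZl//; last by move=> w _; rewrite lee_fin ip_grad_ge0.
apply: lte_mul_pinfty => //; apply: le_lt_trans Is.
apply: ge0_integral_mono => w; first by rewrite lee_fin ip_grad_ge0.
apply: ereal_sup_ubound; exists (tn n); first exact: tn_itvcc.
by rewrite H10norm_sq.
Qed.

(** All terms belong to [Vh], on which passing to coordinates is injective
    and linear. *)
Lemma step_coordP n (x v x' v' u : F) w : (n <= N)%N ->
  V_h x -> V_h v -> V_h x' -> V_h v' -> V_h u ->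
  (x' - x = (tau / 2) *: (v' + v) /\
   v' - v = (tau / 2) *: Delta (x' + x) + tau *: u
     + h n w *: (gamma *: x + ritz (sigma (tn n) w))) <->
  step_eq (fun n => h n) A tau gamma n (coe u) (csigma n w) (coe x) (coe v) (coe x') (coe v') w.
Proof.
move=> nN Vx Vv Vx' Vv' Vu; have Vs := Vh_ritz (sigma_H10 w nN).
have Vvv := VhD hD Vv' Vv; have Vxx := VhD hD Vx' Vx; have VD := Vh_laplace Vxx.
have Vg := VhZ hD gamma Vx; have Vgs := VhD hD Vg Vs.
have V1 := VhZ hD (tau / 2) VD; have V2 := VhZ hD tau Vu.
have V12 := VhD hD V1 V2; have V3 := VhZ hD (h n w) Vgs.
have E1 : coe (x' - x) = coe x' - coe x by rewrite (coB fr).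
have E2 : coe (v' - v) = coe v' - coe v by rewrite (coB fr).
have E3 : coe ((tau / 2) *: (v' + v)) = (tau / 2) *: (coe v' + coe v).
  by rewrite (coZ fr)// (coD fr).
have E4 : coe ((tau / 2) *: Delta (x' + x) + tau *: u
     + h n w *: (gamma *: x + ritz (sigma (tn n) w))) =
    (tau / 2) *: ((coe x' + coe x) *m A) + tau *: coe u + h n w *: (gamma *: coe x + csigma n w).
  rewrite (coD fr V12 V3) (coD fr V1 V2) (coZ fr _ VD) (coZ fr _ Vu) (coZ fr _ Vgs).
  by rewrite (coD fr Vg Vs) (coZ fr _ Vx) (co_laplace Vxx) (coD fr Vx' Vx).
rewrite /step_eq -E1 -E2 -E3 -E4; split=> -[h1 h2]; first by rewrite h1 h2.
split; apply: (co_inj fr) => //.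
- exact: (VhB fr).
- exact: VhZ.
- exact: (VhB fr).
- exact: VhD.
Qed.

Definition cs (X : process) n : vec := fun w => coe (X (tn n) w).

Local Notation is_state := (is_state D Th P W T gamma N X10 X20 sigma).
Local Notation is_st := (is_st P N (fun n => h n) A tau gamma).

Lemma state_cs_L2 X : states X -> L2seq P (fun n => C n) N (cs X).
Proof. by move=> sX n nN; have [] := state_grid sX nN. Qed.

Lemma control_cs_L2 U : control U ->
  forall n, (n < N)%N -> vL2 P (G n) (cs U n).
Proof. by move=> sU n nN; have [] := control_grid sU nN. Qed.

Lemma is_state_st U X1 X2 : control U -> is_state U X1 X2 ->
  is_st (cs U) csigma (cs X1) (cs X2).
Proof.
move=> cU [s1 s2 _ _ H] n nN; have nN' := ltnW nN.
have [VU _] := control_grid cU nN.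
have [V1 _] := state_grid s1 nN'; have [V1' _] := state_grid s1 nN.
have [V2 _] := state_grid s2 nN'; have [V2' _] := state_grid s2 nN.
have [h1 h2] := H n nN; apply: filterS2 h1 h2 => w h1 h2.
by apply/(step_coordP w nN' (V1 w) (V2 w) (V1' w) (V2' w) (VU w)).
Qed.

Lemma st_is_state U x v : control U ->
  L2seq P (fun n => C n) N x -> L2seq P (fun n => C n) N v ->
  is_st (cs U) csigma x v ->
  {ae P, forall w, x 0%N w = coe (ritz X10)} -> {ae P, forall w, v 0%N w = coe (ritz X20)} ->
  is_state U (proc e T N x) (proc e T N v).
Proof.
move=> cU Lx Lv S x0 v0; split.
- exact: (proc_state fr hP hW hT hN).
- exact: (proc_state fr hP hW hT hN).
- apply: filterS x0 => w hw; rewrite -(tn0 T N) (proc_tn e hT hN) hw.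
  by rewrite (coK fr)//; exact: Vh_ritz.
- apply: filterS v0 => w hw; rewrite -(tn0 T N) (proc_tn e hT hN) hw.
  by rewrite (coK fr)//; exact: Vh_ritz.
move=> n nN; have [VU _] := control_grid cU nN.
have Q w := proj2 (step_coordP w (ltnW nN) (Vh_syn fr (x n w)) (Vh_syn fr (v n w))
  (Vh_syn fr (x n.+1 w)) (Vh_syn fr (v n.+1 w)) (VU w)).
split; apply: filterS (S n nN) => w hw; rewrite !(proc_tn e hT hN);
  by have := Q w; rewrite !(synK fr) => /(_ hw)[].
Qed.


Lemma st_exists u : (forall n, (n < N)%N -> vL2 P (G n) (u n)) -> exists x v,
  [/\ L2seq P (fun n => C n) N x, L2seq P (fun n => C n) N v, is_st u csigma x v,
      forall w, x 0%N w = coe (ritz X10) & forall w, v 0%N w = coe (ritz X20)].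
Proof.
move=> Lu; have [c [c0 hc]] := noise_second_moment hP hW hT hN.
pose s := st (fun n => h n) A tau gamma (coe (ritz X10)) (coe (ritz X20)) u csigma.
have L n (nN : (n <= N)%N) : vL2 P (G n) (s n).1 /\ vL2 P (G n) (s n).2.
  apply: (st_L2 (C := fun n => C n) A tau gamma _ _ _ c0 hc) => //.
  - by move=> k _; exact: G_mono.
  - by move=> k kN; exact: (G_noise hT hN kN).
  - by move=> k kN; apply: csigma_L2; exact: ltnW.
exists (fun n => (s n).1), (fun n => (s n).2); split=> //.
- by move=> n /L[].
- by move=> n /L[].
- by move=> n nN; apply: aeW => w; apply: (st_step _ _ _ A_le0).
Qed.

Local Notation st1 := (state1 D Th P W T gamma N X10 X20 sigma).
Local Notation st2 := (state2 D Th P W T gamma N X10 X20 sigma).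

(** The state operator is defined by choice; the process built from the
    recursion in coordinates shows that there is something to choose. *)
Lemma stateE U : control U -> is_state U (st1 U) (st2 U).
Proof.
move=> cU; have [x [v [Lx Lv S x0 v0]]] := st_exists (control_cs_L2 cU).
have H := st_is_state cU Lx Lv S (aeW _ x0) (aeW _ v0).
have {}H : [set X | is_state U X.1 X.2] (proc e T N x, proc e T N v) by exact: H.
rewrite /state1 /state2 /state.
exact: (xgetI _ H).
Qed.

Lemma state_init U X1 X2 : is_state U X1 X2 ->
  {ae P, forall w, cs X1 0 w = coe (ritz X10)} /\ {ae P, forall w, cs X2 0 w = coe (ritz X20)}.
Proof.
move=> [_ _ h1 h2 _]; split; [apply: filterS h1|apply: filterS h2] => w hw;
  by rewrite /cs (tn0 T N) hw.
Qed.

(** On each interval [t_n, t_{n+1}) both processes keep their value at t_n. *)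
Lemma state_proc_eq X Y : states X -> states Y ->
  (forall n, (n <= N)%N -> {ae P, forall w, cs X n w = cs Y n w}) -> proc_eq P `[0, T] X Y.
Proof.
move=> sX sY H t; rewrite /= in_itv/= => /andP[t0 tT].
have grid n : (n <= N)%N -> {ae P, forall w, X (tn n) w = Y (tn n) w}.
  move=> nN; have [VX _] := state_grid sX nN.
  have [VY _] := state_grid sY nN.
  by apply: filterS (H n nN) => w hw; apply: (co_inj fr).
move: tT; rewrite le_eqVlt => /orP[/eqP ->|tT].
  by have := grid N (leqnn N); rewrite (tnN T hN).
have nN := slot_ltN hT hN t0 tT; have h1 := slot_le hT hN t0; have h2 := slot_gt hT hN t.
have [[_ _ /(_ _ _ nN h1 h2) ->] _] := sX.
have [[_ _ /(_ _ _ nN h1 h2) ->] _] := sY.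
exact: grid (ltnW nN).
Qed.

Lemma control_proc_eq X Y : control X -> control Y ->
  (forall n, (n < N)%N -> {ae P, forall w, cs X n w = cs Y n w}) -> proc_eq P `[0, T[ X Y.
Proof.
move=> sX sY H t; rewrite /= in_itv/= => /andP[t0 tT].
have nN := slot_ltN hT hN t0 tT; have h1 := slot_le hT hN t0; have h2 := slot_gt hT hN t.
have [VX _] := control_grid sX nN; have [VY _] := control_grid sY nN.
have [_ _ /(_ _ _ nN h1 h2) ->] := sX; have [_ _ /(_ _ _ nN h1 h2) ->] := sY.
by apply: filterS (H _ nN) => w hw; apply: (co_inj fr).
Qed.

Lemma is_state_unique U U' X1 X2 X1' X2' :
  control U -> control U' ->
  (forall n, (n < N)%N -> {ae P, forall w, cs U n w = cs U' n w}) ->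
  is_state U X1 X2 -> is_state U' X1' X2' ->
  proc_eq P `[0, T] X1 X1' /\ proc_eq P `[0, T] X2 X2'.
Proof.
move=> cU cU' E S S'; have S0 := is_state_st cU S; have S0' := is_state_st cU' S'.
have [i1 i2] := state_init S; have [i1' i2'] := state_init S'.
have [s1 s2 _ _ _] := S; have [s1' s2' _ _ _] := S'.
have I1 : {ae P, forall w, cs X1 0 w = cs X1' 0 w} by apply: filterS2 i1 i1' => w -> ->.
have I2 : {ae P, forall w, cs X2 0 w = cs X2' 0 w} by apply: filterS2 i2 i2' => w -> ->.
have U0 := st_unique A_le0 S0 S0' I1 I2 E.
by split; apply: state_proc_eq => // n nN; apply: filterS (U0 n nN) => w [].
Qed.

Definition target n := coe (Xt_h D Th Xt (tn n)).

Lemma Vh_target n : (n <= N)%N -> V_h (Xt_h D Th Xt (tn n)).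
Proof. by move=> nN; apply: Vh_ritz; have [] := hXt (tn_itvcc hT hN nN). Qed.

Lemma Xt_htau_tn n : Xt_htau D Th T N Xt (tn n) = Xt_h D Th Xt (tn n).
Proof. by rewrite /Xt_htau -/(slot T N (tn n)) (slot_tn hT hN). Qed.

Local Notation cost := (cost D Th P W T alpha beta gamma N X10 X20 Xt sigma).
Local Notation cost_seq := (cost_seq P N tau alpha beta target).
Hypothesis halpha : 0 < alpha.
Hypothesis hbeta : 0 <= beta.

(** Step processes turn the time integral into a sum over the grid, and
    orthonormality of the basis turns L2 norms into Euclidean ones. *)
Lemma costE U : control U ->
  cost U = (2^-1 * cost_seq (cs U) (cs (st1 U)))%:E.
Proof.
move=> cU; have [s1 _ _ _ _] := stateE cU.
have Lu := control_cs_L2 cU; have Lx := state_cs_L2 s1.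
have hG n (nN : (n <= N)%N) := G_meas nN.
have VX n (nN : (n <= N)%N) := (state_grid s1 nN).1.
have VU n (nN : (n < N)%N) := (control_grid cU nN).1.
have [[_ _ stX] _] := s1; have [_ _ stU] := cU.
pose z n : vec := fun w => cs (st1 U) n w - target n.
have Lz n : (n <= N)%N -> vL2 P (G n) (z n).
  by move=> nN; apply: vL2B; [exact: hG|exact: Lx|exact: vL2_cst].
have Sz n : (n <= N)%N -> vS P (z n) by move=> nN; exact: (vL2_vS (hG n nN) (Lz n nN)).
have Su n : (n < N)%N -> vS P (cs U n) by move=> nN; exact: (vL2_vS (hG n (ltnW nN)) (Lu n nN)).
have coz n w : (n <= N)%N -> coe (st1 U (tn n) w - Xt_htau D Th T N Xt (tn n)) = z n w.
  by move=> nN; rewrite Xt_htau_tn (coB fr)//; [exact: VX|exact: Vh_target].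
have Vz n w : (n <= N)%N -> V_h (st1 U (tn n) w - Xt_htau D Th T N Xt (tn n)).
  by move=> nN; rewrite Xt_htau_tn; apply: (VhB fr); [exact: VX|exact: Vh_target].
have E1 w : L2tx_sq D T (fun t => st1 U t w - Xt_htau D Th T N Xt t)
    = (tau * \sum_(n < N) dot (z n w) (z n w))%:E.
  rewrite (L2tx_step fr hT hN).
  - by congr (_ * _)%:E; apply: eq_bigr => n _; rewrite coz// ltnW.
  - by move=> n nN; apply: Vz; exact: ltnW.
  - move=> n t nN h1 h2; rewrite (stX n t nN h1 h2).
    have EX : Xt_htau D Th T N Xt t = Xt_htau D Th T N Xt (tn n).
      by rewrite Xt_htau_tn /Xt_htau -/(slot T N t) (slot_eq hT hN h1 h2).
    by rewrite EX.
have E2 w : L2tx_sq D T (U^~ w) = (tau * \sum_(n < N) dot (cs U n w) (cs U n w))%:E.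
  rewrite (L2tx_step fr hT hN)//.
  - by move=> n nN; exact: VU.
  - by move=> n t nN h1 h2; rewrite (stU n t nN h1 h2).
have E3 w : L2norm D (st1 U T w - Xt_htau D Th T N Xt T) ^+ 2 = dot (z N w) (z N w).
  have EN := coz N w (leqnn N); have VN := Vz N w (leqnn N).
  by rewrite (tnN T hN) in EN VN; rewrite (L2norm_co fr VN) EN.
rewrite /Defs.cost; under eq_integral => w _ do rewrite E1 E2 E3.
have msum (u : nat -> vec) : (forall n, (n < N)%N -> vS P (u n)) ->
    measurable_fun setT (fun w => (tau * \sum_(n < N) dot (u n w) (u n w))%:E).
  move=> su; apply/measurable_EFinP; apply: measurable_funM => //.
  by apply: measurable_sum => n; apply: measurable_dot => j; exact: (su n (ltn_ord n) j).1.
have ge0sum (u : nat -> vec) w : (0 <= (tau * \sum_(n < N) dot (u n w) (u n w))%:E)%E.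
  rewrite lee_fin mulr_ge0 ?(ltW (tau_gt0 hT hN))// sumr_ge0// => n _; exact: dot_ge0.
have Sz' n : (n < N)%N -> vS P (z n) by move=> nN; apply: Sz; exact: ltnW.
have m1 := msum z Sz'; have m2 := msum _ Su.
have m3 : measurable_fun setT (fun w => (dot (z N w) (z N w))%:E).
  by apply/measurable_EFinP; apply: measurable_dot => j; exact: (Sz N (leqnn N) j).1.
have m2' : measurable_fun setT (fun w => alpha%:E * (tau * \sum_(n < N) dot (cs U n w) (cs U n w))%:E)%E.
  exact: emeasurable_funM.
rewrite (_ : (fun w => _) = (fun w => ((tau * \sum_(n < N) dot (z n w) (z n w))%:E
    + alpha%:E * (tau * \sum_(n < N) dot (cs U n w) (cs U n w))%:E)
    + beta%:E * (dot (z N w) (z N w))%:E)%E); last by apply/funext => w; rewrite EFinM.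
have a0 : (0 <= alpha%:E)%E by rewrite lee_fin ltW.
have b0 : (0 <= beta%:E)%E by rewrite lee_fin.
rewrite ge0_integralD//; last 4 first.
- by move=> w _; rewrite adde_ge0// mule_ge0.
- exact: emeasurable_funD.
- by move=> w _; rewrite mule_ge0// lee_fin dot_ge0.
- exact: emeasurable_funM.
rewrite ge0_integralD//; last by move=> w _; rewrite mule_ge0.
rewrite !ge0_integralZl//; last by move=> w _; rewrite lee_fin dot_ge0.
rewrite (integral_sum_dot_vE hT hN)//; last by move=> n nN j; exact: (Sz' n nN j).1.
rewrite (integral_sum_dot_vE hT hN (u := cs U))//; last by move=> n nN j; exact: (Su n nN j).1.
rewrite integral_dot_vE; last exact: Sz.
change ((2^-1 * (tau * (\sum_(n < N) vE P (z n) (z n))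
    + alpha * (tau * \sum_(n < N) vE P (cs U n) (cs U n)) + beta * vE P (z N) (z N)))%:E
  = (2^-1 * cost_seq (cs U) (cs (st1 U)))%:E).
rewrite /cost_seq big_split/= -mulr_sumr; congr (_ * (_ + _))%:E.
by rewrite mulrDr; congr (_ + _); rewrite mulrCA.
Qed.


Lemma cs_proc u n : cs (proc e T N u) n = u n.
Proof. by apply/funext => w; rewrite /cs (co_proc fr hT hN). Qed.

Lemma cost_seq_ae u x x' : L2seq P (fun n => C n) N x -> L2seq P (fun n => C n) N x' ->
  (forall n, (n <= N)%N -> {ae P, forall w, x n w = x' n w}) ->
  cost_seq u x = cost_seq u x'.
Proof.
move=> Lx Lx' H.
have E n : (n <= N)%N -> vE P (fun w => x n w - target n) (fun w => x n w - target n) =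
    vE P (fun w => x' n w - target n) (fun w => x' n w - target n).
  move=> nN; have hG := G_meas nN; have Lt := vL2_cst P (C n) (target n).
  have S := vL2_vS hG (vL2B hG (Lx n nN) Lt); have S' := vL2_vS hG (vL2B hG (Lx' n nN) Lt).
  have Hn : {ae P, forall w, x n w - target n = x' n w - target n}.
    by apply: filterS (H n nN) => w ->.
  exact: (vE_ae S S' S S' Hn Hn).
rewrite /cost_seq; congr (_ + _); congr (_ * _); last exact: E N (leqnn N).
by apply: eq_bigr => n _; congr (_ + _); exact: E n (ltnW (ltn_ord n)).
Qed.

Section AdjointEquations.
Context (U : process).
Hypothesis cU : control U.

Definition misfit n : vec := fun w => target n - cs (st1 U) n w.

Lemma misfit_L2 : L2seq P (fun n => C n) N misfit.
Proof.
have [s1 _ _ _ _] := stateE cU.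
move=> n nN; apply: vL2B; [exact: (G_meas nN)|exact: vL2_cst|].
exact: (state_cs_L2 s1).
Qed.

Lemma co_misfit n w : (n <= N)%N ->
  V_h (Xt_h D Th Xt (tn n) - st1 U (tn n) w) /\
  coe (Xt_h D Th Xt (tn n) - st1 U (tn n) w) = misfit n w.
Proof.
move=> nN; have [s1 _ _ _ _] := stateE cU; have [V1 _] := state_grid s1 nN.
have Vt := Vh_target nN.
by split; [exact: (VhB fr)|rewrite (coB fr)].
Qed.

Local Notation is_adjoint := (is_adjoint D Th P W T beta gamma N X10 X20 Xt sigma).
Local Notation is_adj := (is_adj P (fun n => C n) N (fun n => h n) A tau gamma beta misfit).

(** [condEP] for the first equation, with noise gamma dW, and [condEP0] for
    the second. *)
Lemma adjoint_stepP Y1 Y2 n : states Y1 -> states Y2 ->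
  (n < N)%N ->
  ({ae P, forall w, Y1 (tn n) w =
      condE P D Th (filt P W (tn n)) (fun w =>
        Y1 (tn n.+1) w + (tau / 2) *: Delta (Y2 (tn n.+1) w + Y2 (tn n) w)
        + (gamma * dW W T N n.+1 w) *: Y2 (tn n.+1) w) w
      + tau *: (Xt_h D Th Xt (tn n) - st1 U (tn n) w)} <->
   forall eta, vL2 P (G n) eta ->
    vE P (fun w => cs Y1 n w - tau *: misfit n w) eta =
      vE P (fun w => cs Y1 n.+1 w + (tau / 2) *: ((cs Y2 n.+1 w + cs Y2 n w) *m A)) eta
      + gamma * vE P (cs Y2 n.+1) (fun w => h n w *: eta w)) /\
  ({ae P, forall w, Y2 (tn n) w =
      condE P D Th (filt P W (tn n)) (fun w =>
        Y2 (tn n.+1) w + (tau / 2) *: (Y1 (tn n.+1) w + Y1 (tn n) w)) w} <->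
   forall eta, vL2 P (G n) eta ->
    vE P (cs Y2 n) eta =
      vE P (fun w => cs Y2 n.+1 w + (tau / 2) *: (cs Y1 n.+1 w + cs Y1 n w)) eta).
Proof.
move=> s1 s2 nN; have nN' := ltnW nN.
have hG := G_meas nN'; have hG' := G_meas nN.
have [V1 L1] := state_grid s1 nN'; have [V1' L1'] := state_grid s1 nN.
have [V2 L2] := state_grid s2 nN'; have [V2' L2'] := state_grid s2 nN.
have S1 : vS P (cs Y1 n) := vL2_vS hG L1.
have S1' : vS P (cs Y1 n.+1) := vL2_vS hG' L1'.
have S2 : vS P (cs Y2 n) := vL2_vS hG L2.
have S2' : vS P (cs Y2 n.+1) := vL2_vS hG' L2'.
have VY w := VhD hD (V2' w) (V2 w); have VD w := Vh_laplace (VY w).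
have VaD w := VhZ hD (tau / 2) (VD w).
have VY1 w := VhD hD (V1' w) (V1 w); have VaY w := VhZ hD (tau / 2) (VY1 w).
split.
  have [c [c0 hc]] := noise_second_moment hP hW hT hN.
  pose p w := Y1 (tn n.+1) w + (tau / 2) *: Delta (Y2 (tn n.+1) w + Y2 (tn n) w).
  have Vp w : V_h (p w) by exact: (VhD hD (V1' w) (VaD w)).
  have Ep : (fun w => coe (p w)) =
      (fun w => cs Y1 n.+1 w + (tau / 2) *: ((cs Y2 n.+1 w + cs Y2 n w) *m A)).
    apply/funext => w; rewrite /p (coD fr (V1' w) (VaD w)) (coZ fr _ (VD w)).
    by rewrite (co_laplace (VY w)) (coD fr (V2' w) (V2 w)).
  have Sp : vS P (fun w => coe (p w)).
    by rewrite Ep; exact: (vSD S1' (vSZ (tau / 2) (vSM A (vSD S2' S2)))).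
  pose z : vec := fun w => cs Y1 n w - tau *: misfit n w.
  have Lz : vL2 P (G n) z.
    exact: (vL2B hG L1 (vL2Z hG tau (misfit_L2 nN'))).
  have hk : Gmeas (G n.+1) (fun w => gamma * dW W T N n.+1 w).
    apply/GmeasP; apply: measurable_funM => //; apply/GmeasP; exact: G_noise.
  have hsq B : G n B -> (\int[P]_(w in B) ((gamma * dW W T N n.+1 w) ^+ 2)%:E =
      (gamma ^+ 2 * c n)%:E * P B)%E.
    move=> GB; have mB := hG B GB.
    under eq_integral => w _ do rewrite exprMn EFinM.
    rewrite ge0_integralZl//; last 3 first.
    - apply/measurable_EFinP; apply: measurable_funX; apply: measurable_funTS.
      exact: (Gmeas_measurable hG' (G_noise hT hN nN)).
    - by move=> w _; rewrite lee_fin sqr_ge0.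
    - by rewrite lee_fin sqr_ge0.
    by rewrite (hc n nN B GB) EFinM muleA.
  have c0' : 0 <= gamma ^+ 2 * c n by rewrite mulr_ge0 ?sqr_ge0 ?c0.
  have GG : G n `<=` G n.+1 by exact: G_mono.
  have K := condEP fr hG' GG hk c0' hsq Vp V2' Sp S2' Lz.
  have noiseE eta : vL2 P (G n) eta ->
      vE P (cs Y2 n.+1) (fun w => (gamma * h n w) *: eta w) =
      gamma * vE P (cs Y2 n.+1) (fun w => h n w *: eta w).
    move=> Leta; rewrite -vEZr//; last first.
      exact: (vL2_vS hG' (vL2_noise hG' GG (G_noise hT hN nN) (c0 n nN) (hc n nN) Leta)).
    by congr vE; apply/funext => w; rewrite scalerA.
  have zE w : syn e (z w) = Y1 (tn n) w - tau *: (Xt_h D Th Xt (tn n) - st1 U (tn n) w).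
    have [Vm Em] := co_misfit w nN'; have Vtm := VhZ hD tau Vm.
    rewrite /z -Em -(coZ fr _ Vm) -(coB fr (V1 w) Vtm) (coK fr)//.
    exact: (VhB fr (V1 w) Vtm).
  split=> [H|H].
    have {}H : {ae P, forall w, condE P D Th (G n)
        (fun w => p w + (gamma * h n w) *: Y2 (tn n.+1) w) w = syn e (z w)}.
      by apply: filterS H => w; rewrite zE => H; exact: (shift_eq _ _ _).2 H.
    by move=> eta Leta; rewrite (K.1 H eta Leta) Ep noiseE.
  have /K.2 : forall eta, vL2 P (G n) eta -> vE P z eta =
      vE P (fun w => coe (p w)) eta + vE P (cs Y2 n.+1) (fun w => (gamma * h n w) *: eta w).
    by move=> eta Leta; rewrite (H eta Leta) Ep noiseE.
  by apply: filterS => w; rewrite zE => E; exact: (shift_eq _ _ _).1 E.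
pose p w := Y2 (tn n.+1) w + (tau / 2) *: (Y1 (tn n.+1) w + Y1 (tn n) w).
have Vp w : V_h (p w) by exact: (VhD hD (V2' w) (VaY w)).
have Ep : (fun w => coe (p w)) =
    (fun w => cs Y2 n.+1 w + (tau / 2) *: (cs Y1 n.+1 w + cs Y1 n w)).
  apply/funext => w; rewrite /p (coD fr (V2' w) (VaY w)) (coZ fr _ (VY1 w)).
  by rewrite (coD fr (V1' w) (V1 w)).
have Sp : vS P (fun w => coe (p w)) by rewrite Ep; exact: (vSD S2' (vSZ (tau / 2) (vSD S1' S1))).
have := condEP0 fr hG Vp Sp L2; rewrite Ep => <-.
have zE w : syn e (coe (Y2 (tn n) w)) = Y2 (tn n) w by rewrite (coK fr).
by split; apply: filterS => w; rewrite zE => ->.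
Qed.

Lemma adjoint_adjP Y1 Y2 : states Y1 -> states Y2 ->
  is_adjoint U Y1 Y2 <-> is_adj (cs Y1) (cs Y2).
Proof.
move=> s1 s2.
have [V1 _] := state_grid s1 (leqnn N).
have [V2 _] := state_grid s2 (leqnn N).
have VD w := Vh_laplace (V2 w); have VaD w := VhZ hD (tau / 2) (VD w).
have E1 w : Y1 (tn N) w = (tau / 2) *: Delta (Y2 (tn N) w)
     + beta *: (Xt_htau D Th T N Xt (tn N) - st1 U (tn N) w) <->
   cs Y1 N w = (tau / 2) *: (cs Y2 N w *m A) + beta *: misfit N w.
  have [Vm Em] := co_misfit w (leqnn N); have Vbm := VhZ hD beta Vm.
  rewrite Xt_htau_tn -Em -(coZ fr _ Vm) -(co_laplace (V2 w)) -(coZ fr _ (VD w)).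
  rewrite -(coD fr (VaD w) Vbm); split; first exact: congr1.
  by apply: (co_inj fr (V1 w)); exact: VhD.
have E2 w : Y2 (tn N) w = (tau / 2) *: Y1 (tn N) w <-> cs Y2 N w = (tau / 2) *: cs Y1 N w.
  rewrite -(coZ fr _ (V1 w)); split; first exact: congr1.
  by apply: (co_inj fr (V2 w)); exact: VhZ.
split.
  move=> [_ _ h1 h2 h3]; split.
  - by apply: filterS h1 => w /E1.
  - by apply: filterS h2 => w /E2.
  move=> n nN eta Leta; have [a1 a2] := adjoint_stepP s1 s2 nN; have [b1 b2] := h3 n nN.
  by split; [apply: a1.1|apply: a2.1].
move=> [h1 h2 h3]; split=> //.
- by apply: filterS h1 => w /E1.
- by apply: filterS h2 => w /E2.
move=> n nN; have [a1 a2] := adjoint_stepP s1 s2 nN.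
by split; [apply: a1.2|apply: a2.2] => eta Leta; have [] := h3 n nN eta Leta.
Qed.

Local Notation ad1 := (adjoint1 D Th P W T beta gamma N X10 X20 Xt sigma).
Local Notation ad2 := (adjoint2 D Th P W T beta gamma N X10 X20 Xt sigma).

Lemma adjointE : is_adjoint U (ad1 U) (ad2 U).
Proof.
have [c [c0 hc]] := noise_second_moment hP hW hT hN.
have [Y1 [Y2 [L1 L2 H]]] := adj_exists tau gamma beta (G_meas)
  (fun n _ => G_mono hT hN (leqnSn n)) (@G_noise _ _ _ P _ W _ hT hN) c0 hc A_le0 misfit_L2.
have K : is_adjoint U (proc e T N Y1) (proc e T N Y2).
  apply/adjoint_adjP; [exact: (proc_state fr hP hW hT hN)|exact: (proc_state fr hP hW hT hN)|].
  have E1 : cs (proc e T N Y1) = Y1 by apply/funext => n; exact: cs_proc.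
  have E2 : cs (proc e T N Y2) = Y2 by apply/funext => n; exact: cs_proc.
  by rewrite -E1 -E2 in H.
have {}K : [set Y | is_adjoint U Y.1 Y.2] (proc e T N Y1, proc e T N Y2) by exact: K.
rewrite /adjoint1 /adjoint2 /adjoint.
exact: (xgetI _ K).
Qed.

End AdjointEquations.


Local Notation ad1 := (adjoint1 D Th P W T beta gamma N X10 X20 Xt sigma).
Local Notation ad2 := (adjoint2 D Th P W T beta gamma N X10 X20 Xt sigma).

(** The optimality condition, tested with square integrable vectors
    measurable at time t_n. *)
Definition stationary U := forall n, (n < N)%N -> forall eta, vL2 P (G n) eta ->
  alpha * vE P (cs U n) eta = vE P (cs (ad2 U) n.+1) eta.

Lemma adjoint_cs U : control U -> [/\ L2seq P (fun n => C n) N (cs (ad1 U)),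
  L2seq P (fun n => C n) N (cs (ad2 U)) &
  is_adj P (fun n => C n) N (fun n => h n) A tau gamma beta
    (fun n w => target n - cs (st1 U) n w) (cs (ad1 U)) (cs (ad2 U))].
Proof.
move=> cU; have K := adjointE cU; have [s1 s2 _ _ _] := K.
split; [exact: state_cs_L2|exact: state_cs_L2|].
exact: (adjoint_adjP cU s1 s2).1 K.
Qed.

(** The difference of two states solves the homogeneous equations with the
    difference of the controls, so [cost_minimal_at] applies to it. *)
Lemma cost_growth U V : control U -> control V -> stationary U ->
  cost_seq (cs U) (cs (st1 U)) + tau * alpha * (\sum_(n < N)
    vE P (fun w => cs V n w - cs U n w) (fun w => cs V n w - cs U n w)) <=
  cost_seq (cs V) (cs (st1 V)).
Proof.
move=> cU cV sU; have [c [c0 hc]] := noise_second_moment hP hW hT hN.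
have hG := G_meas.
have SU := stateE cU; have SV := stateE cV.
have [Lu1 Lu2 _ _ _] := SU; have [Lv1 Lv2 _ _ _] := SV.
have [L1 L2 HA] := adjoint_cs cU.
have [iu1 iu2] := state_init SU; have [iv1 iv2] := state_init SV.
pose dv n : vec := fun w => cs V n w - cs U n w.
pose z n : vec := fun w => cs (st1 V) n w - cs (st1 U) n w.
pose zv n : vec := fun w => cs (st2 V) n w - cs (st2 U) n w.
have Ldv n (nN : (n < N)%N) : vL2 P (G n) (dv n) :=
  vL2B (hG n (ltnW nN)) (control_cs_L2 cV nN) (control_cs_L2 cU nN).
have Lz : L2seq P (fun n => C n) N z :=
  fun n nN => vL2B (hG n nN) (state_cs_L2 Lv1 nN) (state_cs_L2 Lu1 nN).
have Lzv : L2seq P (fun n => C n) N zv :=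
  fun n nN => vL2B (hG n nN) (state_cs_L2 Lv2 nN) (state_cs_L2 Lu2 nN).
have S : is_st dv (fun _ _ => 0) z zv.
  move=> n nN; apply: filterS2 (is_state_st cU SU nN) (is_state_st cV SV nN) => w.
  exact: step_eqB.
have z0 : {ae P, forall w, z 0%N w = 0}.
  by apply: filterS2 iu1 iv1 => w E1 E2; rewrite /z E1 E2 subrr.
have zv0 : {ae P, forall w, zv 0%N w = 0}.
  by apply: filterS2 iu2 iv2 => w E1 E2; rewrite /zv E1 E2 subrr.
have := cost_minimal_at hG (fun n _ => G_mono hT hN (leqnSn n)) (@G_noise _ _ _ P _ W _ hT hN)
  c0 hc A_sym (tau_gt0 hT hN) hbeta (control_cs_L2 cU) (state_cs_L2 Lu1) L1 L2 HA sU Ldv Lz Lzv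
  S z0 zv0.
have -> : (fun n w => cs U n w + dv n w) = cs V.
  by apply/funext => n; apply/funext => w; rewrite /dv addrC subrK.
have -> // : (fun n w => cs (st1 U) n w + z n w) = cs (st1 V).
by apply/funext => n; apply/funext => w; rewrite /z addrC subrK.
Qed.

Lemma le_cost U V : control U -> control V -> (cost U <= cost V)%E <->
  cost_seq (cs U) (cs (st1 U)) <= cost_seq (cs V) (cs (st1 V)).
Proof.
move=> cU cV; by rewrite (costE cU) (costE cV) lee_fin ler_pM2l// invr_gt0.
Qed.

(** Every competitor in coordinates is realized by a step process, and the
    cost depends on the state only up to null sets. *)
Lemma minimizer_stationary U : control U ->
  (forall V, control V -> (cost U <= cost V)%E) -> stationary U.
Proof.
move=> cU Hmin; have [c [c0 hc]] := noise_second_moment hP hW hT hN.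
have hG := G_meas.
have SU := stateE cU; have [Lu1 Lu2 _ _ _] := SU.
have [L1 L2 HA] := adjoint_cs cU; have [iu1 iu2] := state_init SU.
have F := first_order hG (fun n _ => G_mono hT hN (leqnSn n)) (@G_noise _ _ _ P _ W _ hT hN)
  c0 hc A_le0 A_sym (tau_gt0 hT hN) halpha hbeta (control_cs_L2 cU) (state_cs_L2 Lu1) L1 L2 HA
  (is_state_st cU SU) (state_cs_L2 Lu2).
apply: F => u x v Lu Lx Lv S x0 v0.
have cV := proc_control fr hP hW hT hN Lu; set V := proc e T N u in cV.
have EV : cs V = u by apply/funext => n; exact: cs_proc.
have SV := stateE cV; have [Lv1 _ _ _ _] := SV; have [iv1 iv2] := state_init SV.
have := Hmin V cV; rewrite (le_cost cU cV) EV => /le_trans; apply.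
have SV' := is_state_st cV SV; rewrite EV in SV'.
have I1 : {ae P, forall w, cs (st1 V) 0%N w = x 0%N w}.
  by apply: filterS2 (filterI iv1 iu1) x0 => w [-> E] ->; rewrite E.
have I2 : {ae P, forall w, cs (st2 V) 0%N w = v 0%N w}.
  by apply: filterS2 (filterI iv2 iu2) v0 => w [-> E] ->; rewrite E.
have Iu n : (n < N)%N -> {ae P, forall w, u n w = u n w} by move=> _; exact: aeW.
have Q := st_unique A_le0 SV' S I1 I2 Iu.
rewrite (cost_seq_ae u (state_cs_L2 Lv1) Lx)// => n nN.
by apply: filterS (Q n nN) => w [].
Qed.

Lemma stationary_minimizer U : control U -> stationary U ->
  forall V, control V -> (cost U <= cost V)%E.
Proof.
move=> cU sU V cV; apply/(le_cost cU cV); apply: le_trans (cost_growth cU cV sU).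
rewrite lerDl mulr_ge0//; first by rewrite mulr_ge0 ?(ltW halpha)// ltW ?tau_gt0.
by apply: sumr_ge0 => n _; exact: vE_ge0.
Qed.

Lemma stationary_unique U V : control U -> control V -> stationary U ->
  (cost V <= cost U)%E -> forall n, (n < N)%N -> {ae P, forall w, cs V n w = cs U n w}.
Proof.
move=> cU cV sU /(le_cost cV cU) VU n nN; have hG := G_meas (ltnW nN).
have ta : 0 < tau * alpha by rewrite mulr_gt0 ?tau_gt0.
have S0 : \sum_(n < N) vE P (fun w => cs V n w - cs U n w) (fun w => cs V n w - cs U n w) = 0.
  apply/le_anti/andP; split; last by apply: sumr_ge0 => k _; exact: vE_ge0.
  by rewrite -(pmulr_rle0 _ ta) -(lerD2l (cost_seq (cs U) (cs (st1 U)))) addr0;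
    exact: le_trans (cost_growth cU cV sU) VU.
have /eqP := S0; rewrite psumr_eq0; last by move=> k _; exact: vE_ge0.
move=> /allP/(_ (Ordinal nN) (mem_index_enum _)) /eqP E.
have SV := vL2_vS hG (vL2B hG (control_cs_L2 cV nN) (control_cs_L2 cU nN)).
apply: filterS (vE_eq0 SV E) => w /eqP; by rewrite subr_eq0 => /eqP.
Qed.

Lemma stationaryP U Y : control U -> states Y ->
  (forall n, (n < N)%N -> {ae P, forall w, cs Y n.+1 w = cs (ad2 U) n.+1 w}) ->
  stationary U <-> forall n, (n < N)%N ->
    {ae P, forall w, alpha *: U (tn n) w = condE P D Th (filt P W (tn n)) (Y (tn n.+1)) w}.
Proof.
move=> cU sY EY.
have [_ L2 _] := adjoint_cs cU.
have step n (nN : (n < N)%N) :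
  {ae P, forall w, alpha *: U (tn n) w = condE P D Th (filt P W (tn n)) (Y (tn n.+1)) w} <->
  (forall eta, vL2 P (G n) eta -> alpha * vE P (cs U n) eta = vE P (cs (ad2 U) n.+1) eta).
  have hG := G_meas (ltnW nN); have hG' := G_meas nN.
  have [VU _] := control_grid cU nN; have Lu := control_cs_L2 cU nN.
  have Su : vS P (cs U n) := vL2_vS hG Lu.
  have [VY LY] := state_grid sY nN; have SY : vS P (cs Y n.+1) := vL2_vS hG' LY.
  have S2 : vS P (cs (ad2 U) n.+1) := vL2_vS hG' (L2 _ nN).
  have E1 : {ae P, forall w, alpha *: U (tn n) w = condE P D Th (filt P W (tn n)) (Y (tn n.+1)) w} <->
    {ae P, forall w, condE P D Th (G n) (Y (tn n.+1)) w = syn e (alpha *: cs U n w)}.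
    have zE w : syn e (alpha *: cs U n w) = alpha *: U (tn n) w.
      by rewrite -(coZ fr _ (VU w)) (coK fr)//; exact: VhZ.
    by split; apply: filterS => w; rewrite zE.
  rewrite E1 (condEP0 fr hG VY SY (vL2Z hG alpha Lu)).
  have E2 eta : vL2 P (G n) eta ->
      (vE P (fun w => alpha *: cs U n w) eta = alpha * vE P (cs U n) eta) *
      (vE P (fun w => coe (Y (tn n.+1) w)) eta = vE P (cs (ad2 U) n.+1) eta).
    move=> Leta; have Se := vL2_vS hG Leta; split; first exact: vEZl.
    by apply: (vE_ae SY S2 Se Se (EY n nN)); exact: aeW.
  by split=> H eta Leta; have := H eta Leta; rewrite !(E2 eta Leta).
by split=> H n nN; apply/step => //; exact: H.
Qed.

Lemma optimality :
  forall X1 X2 U, states X1 -> states X2 -> control U ->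
  unique_optimal_tuple D Th P W T alpha beta gamma N X10 X20 Xt sigma X1 X2 U
  <->
  exists Y1 Y2 : process,
    [/\ states Y1 /\ states Y2,
        proc_eq P `[0, T] X1 (st1 U) /\ proc_eq P `[0, T] X2 (st2 U),
        proc_eq P `[0, T] Y1 (ad1 U) /\ proc_eq P `[0, T] Y2 (ad2 U) &
        forall n, (n < N)%N ->
          {ae P, forall w, alpha *: U (tn n) w =
             condE P D Th (filt P W (tn n)) (Y2 (tn n.+1)) w}].
Proof.
move=> X1 X2 U sX1 sX2 cU; have [sA1 sA2 _ _ _] := adjointE cU; split.
  move=> [[_ Hmin e1 e2] _]; exists (ad1 U), (ad2 U).
  split; [by split|by split|by split=> t _; exact: aeW|].
  apply/(stationaryP cU sA2); last exact: minimizer_stationary.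
  by move=> n _; exact: aeW.
move=> [Y1 [Y2 [[sY1 sY2] [e1 e2] [_ eY2] HU]]].
have sU : stationary U.
  apply/(stationaryP cU sY2) => // n nN.
  by apply: filterS (eY2 _ (tn_itvcc hT hN nN)) => w E; rewrite /cs E.
split.
  by split; [exact: cU|exact: stationary_minimizer cU sU|exact: e1|exact: e2].
move=> X1' X2' U' sX1' sX2' cU' [_ Hmin e1' e2'].
have EU := stationary_unique cU cU' sU (Hmin U cU).
have [F1 F2] := is_state_unique cU' cU EU (stateE cU') (stateE cU).
split; last exact: control_proc_eq.
- by move=> t It; apply: filterS2 (filterI (e1' t It) (e1 t It)) (F1 t It) => w [-> ->].
- by move=> t It; apply: filterS2 (filterI (e2' t It) (e2 t It)) (F2 t It) => w [-> ->].
Qed.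

End Forward.

Unset Implicit Arguments.

Theorem proposition5p1
  (R : realType) (d : nat) (hd : (1 <= d <= 3)%N)
  (D : set 'rV[R]_d) (hD : bounded_domain D)
  (k : nat) (hk : (1 <= k)%N) (hDk : Ck_boundary k D)
  (h kappa : R) (Th : set (simplex R d)) (hTh : triangulation D h kappa Th)
  (dd : measure_display) (Om : measurableType dd) (P : probability Om R)
  (hP : measure_is_complete P)
  (T alpha beta gamma : R) (hT : 0 < T) (halpha : 0 < alpha) (hbeta : 0 <= beta)
  (W : R -> Om -> R) (hW : wiener P T W)
  (N : nat) (hN : (0 < N)%N) (htau : tau T N < 1)
  (X10 X20 : funRd R d) (hX10 : H10 D X10) (hX20 : H10 D X20)
  (Xt : R -> funRd R d) (hXt : CtH10 D T Xt)
  (sigma : R -> Om -> funRd R d) (hsigma : L2F_CtH10 P D W T sigma)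
  (X1 X2 U : R -> Om -> funRd R d)
  (hX1 : state_space D Th P W T N X1) (hX2 : state_space D Th P W T N X2)
  (hU : control_space D Th P W T N U) :
  unique_optimal_tuple D Th P W T alpha beta gamma N X10 X20 Xt sigma X1 X2 U
  <->
  exists Y1 Y2 : R -> Om -> funRd R d,
    [/\ state_space D Th P W T N Y1 /\ state_space D Th P W T N Y2,
        proc_eq P `[0, T] X1 (state1 D Th P W T gamma N X10 X20 sigma U) /\
        proc_eq P `[0, T] X2 (state2 D Th P W T gamma N X10 X20 sigma U),
        proc_eq P `[0, T]
          Y1 (adjoint1 D Th P W T beta gamma N X10 X20 Xt sigma U) /\
        proc_eq P `[0, T]
          Y2 (adjoint2 D Th P W T beta gamma N X10 X20 Xt sigma U) &
        forall n, (n < N)%N ->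
          {ae P, forall w, alpha *: U (tn T N n) w =
             condE P D Th (filt P W (tn T N n)) (Y2 (tn T N n.+1)) w}].
Proof.
have d0 : (0 < d)%N by case/andP: hd.
have [m [e [Ve ee Vspan]]] := Vh_basis hD hTh.
have fr : vh_frame D Th e by split=> // v; exact: (Vh_eq0 hD hTh).
exact: (optimality fr hP hW hT hN gamma hX10 hX20 hXt hsigma halpha hbeta hX1 hX2 hU).
Qed.
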